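(* Consider the generalized vertex algebra $V_L$ of the lattice $L=\mathbb Z(\gamma+\delta)+\mathbb Z(\gamma-\delta)$ as a $\hat{\mathfrak g}$-module of level $-\frac43$ via the vectors $e=e^{3(\gamma-\delta)}$, $h=4\delta(-1)$, $f=-\frac29Qe^{3(\gamma+\delta)}$. The vectors $e^{-\gamma+\delta}$ and $e^{2\delta}$ are singular vectors for the action of $\hat{\mathfrak g}$. Moreover, $$U(\hat{\mathfrak g}).e^{-\gamma+\delta}\cong L(-\tfrac23\Lambda_0-\tfrac23\Lambda_1),\qquad U(\hat{\mathfrak g}).e^{2\delta}\cong L(-\tfrac43\Lambda_1).$$
   Context: Affine side. $\mathfrak g=sl_2(\mathbb C)$ with basis $e,f,h$, $[h,e]=2e$, $[h,f]=-2f$, $[e,f]=h$, and form $(e,f)=1$, $(h,h)=2$. $\hat{\mathfrak g}=\mathfrak g\otimes\mathbb C[t,t^{-1}]\oplus\mathbb Cc\oplus\mathbb Cd$ is the affine Lie algebra of type $A_1^{(1)}$, $[x(n),y(m)]=[x,y](n+m)+n(x,y)\delta_{n+m,0}c$, where $x(n)=x\otimes t^n$; $\Lambda_0,\Lambda_1$ are its fundamental weights and $L(\lambda)$ is the irreducible highest weight $\hat{\mathfrak g}$-module with highest weight $\lambda$ (for $\lambda=a\Lambda_0+b\Lambda_1$ the level is $a+b$ and $h(0)$ acts on the highest weight vector by $b$). A weight vector $v$ in a $\hat{\mathfrak g}$-module is singular if $\hat{\mathfrak n}_+v=0$, where $\hat{\mathfrak n}_+=\mathbb Ce\oplus\mathfrak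 g\otimes t\mathbb C[t]$. Lattice side. $\widetilde L=\mathbb Z\gamma+\mathbb Z\delta$ with $\langle\gamma,\gamma\rangle=-\langle\delta,\delta\rangle=\frac16$, $\langle\gamma,\delta\rangle=0$; $\mathfrak h=\mathbb C\otimes_{\mathbb Z}\widetilde L$, $\hat{\mathfrak h}=\mathfrak h\otimes\mathbb C[t,t^{-1}]\oplus\mathbb Cc$, $\alpha(n)=\alpha\otimes t^n$, and $M(1)$ is the level $1$ Heisenberg vertex algebra (Fock space of $\hat{\mathfrak h}$ with zero highest weight). $V_{\widetilde L}=M(1)\otimes\mathbb C[\widetilde L]$ is the generalized vertex algebra of the rational lattice $\widetilde L$ (Dong–Lepowsky), where $\mathbb C[\widetilde L]$ is the group algebra with basis $e^\alpha$, $\alpha(0)e^\beta=\langle\alpha,\beta\rangle e^\beta$, and $$Y(e^\alpha,z)=\exp\Bigl(\sum_{n\ge1}\tfrac{\alpha(-n)}{n}z^n\Bigr)\exp\Bigl(-\sum_{n\ge1}\tfrac{\alpha(n)}{n}z^{-n}\Bigr)e^\alpha z^{\alpha(0)},$$ extended to $M(1)\otimes e^\alpha$ by the usual normal ordered products. Write $Y(v,z)=\sum_{s\in\frac16\mathbb Z}v_sz^{-s-1}$. $V_L=M(1)\otimes\mathbb C[L]\subset V_{\widetilde L}$. $Q=e^{-6\gamma}_0$. Set $e=e^{3(\gamma-\delta)}$, $h=4\delta(-1)\mathbf 1$, $f=-\frac29Qe^{3(\gamma+\delta)}=-(4\gamma(-1)^2-\frac23\gamma(-2))e^{-3(\gamma-\delta)}$.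 These vectors generate a subalgebra of $V_L$ isomorphic to the simple affine vertex operator algebra $L(-\frac43\Lambda_0)$, and $V_L$ is a weak $L(-\frac43\Lambda_0)$-module; $\hat{\mathfrak g}$ acts on $V_L$ at level $-\frac43$ by $a(n)=a_n$ for $a\in\{e,f,h\}$ ($d$ acts, up to an additive constant, as $-L(0)$ for the Virasoro element $\omega=3\gamma(-1)^2\mathbf 1-2\gamma(-2)\mathbf 1-3\delta(-1)^2\mathbf 1$; weights are understood modulo the resulting $d$-shift). *)

(* Defs.v *)
From HB Require Import structures.
From mathcomp Require Import all_boot all_order all_algebra.
From mathcomp Require Import finmap multiset.
From mathcomp Require Import boolp classical_sets functions fsbigop reals.
From mathcomp Require Import complex.
From mathcomp.multinomials Require Import monalg.

Set Implicit Arguments.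
Unset Strict Implicit.
Unset Printing Implicit Defensive.

Import Order.TTheory GRing.Theory Num.Theory.

Local Open Scope classical_set_scope.
Local Open Scope ring_scope.

(* ====================  The affine Lie algebra A_1^(1)  ==================== *)

Inductive sl2 := sl2e | sl2f | sl2h.

(* Basis of the affine Lie algebra: [Loop x n] is x(n) = x (x) t^n. *)
Inductive ghat := Loop of sl2 & int | Cen | Der.

Section Affine.
Variable F : fieldType.

(* Brackets of basis vectors are listed as linear combinations
   [:: (a1, x1); ...] of basis vectors. *)
Definition sl2_bracket (x y : sl2) : seq (F * sl2) :=
  match x, y with
  | sl2h, sl2e => [:: (2, sl2e)]
  | sl2e, sl2h => [:: (- 2, sl2e)]
  | sl2h, sl2f => [:: (- 2, sl2f)]
  | sl2f, sl2h => [:: (2, sl2f)]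
  | sl2e, sl2f => [:: (1, sl2h)]
  | sl2f, sl2e => [:: (- 1, sl2h)]
  | _, _ => [::]
  end.

Definition sl2_form (x y : sl2) : F :=
  match x, y with
  | sl2e, sl2f | sl2f, sl2e => 1
  | sl2h, sl2h => 2
  | _, _ => 0
  end.

Definition ghat_bracket (x y : ghat) : seq (F * ghat) :=
  match x, y with
  | Loop a n, Loop b m =>
      [seq (p.1, Loop p.2 (n + m)) | p <- sl2_bracket a b] ++
      (if n + m == 0 then [:: (n%:~R * sl2_form a b, Cen)] else [::])
  | Der, Loop a n => [:: (n%:~R, Loop a n)]
  | Loop a n, Der => [:: (- n%:~R, Loop a n)]
  | _, _ => [::]
  end.

(* The basis vectors spanning n_+ = C e + sl2 (x) t C[t]. *)
Definition ghat_nplus (x : ghat) : Prop :=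
  match x with
  | Loop sl2e n => 0 <= n
  | Loop _ n => 0 < n
  | _ => False
  end.

(* A module over the affine algebra is given by the operators of its basis
   vectors, subject to the bracket relations ([is_module] below).  The operators
   are considered on a subset [car] of a vector space, and all the notions below
   only look at [car], so that submodules are again of this form. *)
Record ghat_ops := GhatOps {
  space :> lmodType F;
  car : set space;
  act : ghat -> space -> space }.
Arguments car : clear implicits.
Arguments act : clear implicits.

Definition subspace (V : lmodType F) (W : set V) : Prop :=
  W 0 /\ (forall (a : F) u v, W u -> W v -> W (a *: u + v)).

Definition is_module (M : ghat_ops) : Prop :=
  [/\ subspace (car M),
      forall x v, car M v -> car M (act M x v),
      forall x (a : F) u v, car M u -> car M v ->
        act M x (a *: u + v) = a *: act M x u + act M x v
    & forall x y v, car M v ->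
        act M x (act M y v) - act M y (act M x v) =
        \sum_(p <- ghat_bracket x y) p.1 *: act M p.2 v].

Definition is_submodule (M : ghat_ops) (W : set M) : Prop :=
  [/\ W `<=` car M, subspace W & forall x v, W v -> W (act M x v)].

Definition irreducible (M : ghat_ops) : Prop :=
  (exists2 v, car M v & v <> 0) /\
  (forall W : set M, is_submodule W -> W = [set 0] \/ W = car M).

(* The elements u.v for u in the enveloping algebra. *)
Inductive Uorbit (M : ghat_ops) (v : M) : set M :=
  | Uorbit_gen : Uorbit v v
  | Uorbit_zero : Uorbit v 0
  | Uorbit_lin (a : F) u w : Uorbit v u -> Uorbit v w -> Uorbit v (a *: u + w)
  | Uorbit_act x u : Uorbit v u -> Uorbit v (act M x u).

Definition Usub (M : ghat_ops) (v : M) : ghat_ops :=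
  @GhatOps M (Uorbit v) (act M).

Definition isomorphic (M N : ghat_ops) : Prop :=
  exists phi : M -> N,
  [/\ set_bij (car M) (car N) phi,
      forall (a : F) u v, car M u -> car M v ->
        phi (a *: u + v) = a *: phi u + phi v
    & forall x v, car M v -> phi (act M x v) = act N x (phi v)].

(* Weights, recorded by their values on h(0), c and d; [delta_im] is the
   imaginary root, so that adding a constant a to the action of d changes
   weights by a *: delta_im. *)
Definition weight : lmodType F := (F^o * F^o * F^o)%type.
Definition Lambda0 : weight := (0, 1, 0).
Definition Lambda1 : weight := (1, 1, 0).
Definition delta_im : weight := (0, 0, 1).

Definition has_weight (M : ghat_ops) (lambda : weight) (v : M) : Prop :=
  [/\ act M (Loop sl2h 0) v = lambda.1.1 *: v,
      act M Cen v = lambda.1.2 *: v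
    & act M Der v = lambda.2 *: v].

Definition singular (M : ghat_ops) (v : M) : Prop :=
  [/\ car M v, v <> 0, exists lambda, has_weight lambda v
    & forall x, ghat_nplus x -> act M x v = 0].

Definition irreducible_highest_weight (lambda : weight) (M : ghat_ops) : Prop :=
  [/\ is_module M, irreducible M
    & exists v : M,
        [/\ singular v, has_weight lambda v & car M = Uorbit v]].

(* M is isomorphic to L(lambda), the irreducible highest weight module of
   highest weight lambda: such a module exists (M is one), and M is isomorphic
   to every such module. *)
Definition isomorphic_to_L (lambda : weight) (M : ghat_ops) : Prop :=
  irreducible_highest_weight lambda M /\
  (forall N, irreducible_highest_weight lambda N -> isomorphic M N).

End Affine.

(* ==============  The generalized lattice vertex algebra  ================== *)

(* (a, b) is a gamma + b delta. *)
Definition lat : zmodType := (int * int)%type.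
Definition gamma : lat := (1, 0).
Definition delta : lat := (0, 1).

Definition lat_form (x y : lat) : rat :=
  (x.1%:~R * y.1%:~R - x.2%:~R * y.2%:~R) / 6%:R.

Definition sublattice_L : set lat :=
  [set x | exists m n : int, x = (gamma + delta) *~ m + (gamma - delta) *~ n].

(* Creation operators: (false, n) is gamma(-n-1) and (true, n) is
   delta(-n-1). *)
Definition osc : choiceType := (bool * nat)%type.
Definition osc_vec (i : bool) : lat := if i then delta else gamma.

(* Basis of M(1) (x) C[lat]: a monomial in the creation operators, i.e. a
   multiset of them, and a lattice element. *)
Definition state : choiceType := ({mset osc}%mset * lat)%type.

Section LatticeVertexAlgebra.
Variable F : fieldType.

Definition Vlat : lmodType F := {malg F[state]}.

Definition basis (m : {mset osc}%mset) (x : lat) : Vlat := << (m, x) >>.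

Definition evec (x : lat) : Vlat := basis mset0 x.

Definition extend_lin (f : state -> Vlat) (v : Vlat) : Vlat :=
  \sum_(k <- msupp v) v@_k *: f k.

(* The action of gamma(n) (i = false) and delta(n) (i = true): creation for
   n < 0, a scalar on each charge for n = 0, and n <i,i> times the partial
   derivative with respect to the variable i(-n) for n > 0. *)
Definition heis (i : bool) (n : int) : Vlat -> Vlat :=
  extend_lin (fun k =>
    match n with
    | Negz p => basis (msetD [mset (i, p)]%mset k.1) k.2
    | Posz 0 => ratr (lat_form (osc_vec i) k.2) *: basis k.1 k.2
    | Posz p.+1 =>
        (p.+1%:R * ratr (lat_form (osc_vec i) (osc_vec i)) * (k.1 (i, p))%:R) *:
        basis (msetB k.1 [mset (i, p)]%mset) k.2
    end).

Definition heis_lat (x : lat) (n : int) (v : Vlat) : Vlat :=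
  x.1%:~R *: heis false n v + x.2%:~R *: heis true n v.

(* [ser_pow A j k] and [ser_exp A k] are the coefficients of s^k in A(s)^j and
   in exp (A(s)), where A(s) = sum_n A_n s^n is a series of operators with
   A_0 = 0 (so that A(s)^j does not contribute for j > k). *)
Fixpoint ser_pow (A : nat -> Vlat -> Vlat) (j k : nat) (v : Vlat) : Vlat :=
  if j is j'.+1 then \sum_(i < k.+1) A i (ser_pow A j' (k - i)%N v)
  else if k == 0%N then v else 0.

Definition ser_exp (A : nat -> Vlat -> Vlat) (k : nat) (v : Vlat) : Vlat :=
  \sum_(j < k.+1) (j`!%:R)^-1 *: ser_pow A j k v.

(* Coefficients of z^k and of z^(-k) in exp (sum_{n>=1} x(-n)/n z^n) and in
   exp (- sum_{n>=1} x(n)/n z^(-n)). *)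
Definition Eminus (x : lat) : nat -> Vlat -> Vlat :=
  ser_exp (fun n v =>
    if n == 0%N then 0 else n%:R^-1 *: heis_lat x (- n%:Z) v).
Definition Eplus (x : lat) : nat -> Vlat -> Vlat :=
  ser_exp (fun n v =>
    if n == 0%N then 0 else - (n%:R^-1 *: heis_lat x n%:Z v)).

(* A field is given by its coefficients: [B q] is the coefficient of z^q.  The
   sums over infinite index sets below have finite support on each vector. *)
Definition zfield : Type := rat -> Vlat -> Vlat.

(* Y(e^x, z); note that e^x z^{x(0)} maps u (x) e^y to
   z^<x,y> u (x) e^(x+y). *)
Definition vertex_exp (x : lat) : zfield := fun q =>
  extend_lin (fun k =>
    \sum_(ij \in [set ij : nat * nat |
                  ij.1%:R - ij.2%:R + lat_form x k.2 = q])
      Eminus x ij.1 (Eplus x ij.2 (basis k.1 (x + k.2)))).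

(* The normal ordered product of (1/n!) (d/dz)^n i(z) and B(z), where
   i(z) = sum_m i(m) z^(-m-1), with i = gamma or delta.  For m = - k - 1 < 0
   (first sum) the coefficient of z^(-m-1-n) in (1/n!) (d/dz)^n z^(-m-1) is
   'C(k, n); for m >= 0 (second sum) it is
   binomial (- m - 1) n = (- 1)^n 'C(m + n, n). *)
Definition normal_prod (i : bool) (n : nat) (B : zfield) : zfield := fun q v =>
  \sum_(k \in [set: nat])
     'C(k, n)%:R *: heis i (- (k.+1%:Z)) (B (q - k%:R + n%:R) v)
  + \sum_(m \in [set: nat])
     ((- 1) ^+ n * 'C(m + n, n)%:R) *:
       B (q + m.+1%:R + n%:R) (heis i m%:Z v).

Definition Y_basis (k : state) : zfield :=
  foldr (fun (o : osc) B => normal_prod o.1 o.2 B) (vertex_exp k.2)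
    (enum_mset k.1).

Definition Y (u : Vlat) : zfield := fun q v =>
  \sum_(k <- msupp u) u@_k *: Y_basis k q v.

(* u_s, where Y(u, z) = sum_s u_s z^(-s-1). *)
Definition mode (u : Vlat) (s : rat) : Vlat -> Vlat := Y u (- s - 1).

Definition Q : Vlat -> Vlat := mode (evec (- gamma *+ 6)) 0.

Definition vec_e : Vlat := evec ((gamma - delta) *+ 3).
Definition vec_h : Vlat := 4 *: heis true (- 1) (evec 0).
Definition vec_f : Vlat := - (2 / 9) *: Q (evec ((gamma + delta) *+ 3)).

Definition sl2_vec (x : sl2) : Vlat :=
  match x with sl2e => vec_e | sl2h => vec_h | sl2f => vec_f end.

Definition omega : Vlat :=
  3 *: heis false (- 1) (heis false (- 1) (evec 0))
  - 2 *: heis false (- 2) (evec 0)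
  - 3 *: heis true (- 1) (heis true (- 1) (evec 0)).

(* d = - L(0) + kappa with kappa arbitrary.  As e^(- gamma + delta) and
   e^(2 delta) both have L(0)-eigenvalue - 1/3, d acts on them by kappa + 1/3,
   that is by 0 for kappa = - 1/3. *)
Definition VL_act (kappa : F) (x : ghat) (v : Vlat) : Vlat :=
  match x with
  | Loop a n => mode (sl2_vec a) n%:~R v
  | Cen => - (4 / 3) *: v
  | Der => kappa *: v - mode omega 1 v
  end.

Definition VL (kappa : F) : ghat_ops F :=
  @GhatOps F Vlat
    [set v | forall k, k \in msupp v -> sublattice_L k.2] (VL_act kappa).

End LatticeVertexAlgebra.

(* Main.v *)
(* Write x = 3 (gamma - delta); this vector is isotropic, e is e^x, and expanding Q
   gives f = - 4 gamma(-1)^2 e^(-x) + (2/3) gamma(-2) e^(-x).  On a charge y, the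
   operators e(n) and f(n) are components a_j and f_j of fixed degree j of the fields
   of e and f.  A family T(i,j) of operators whose commutators with the currents are
   those of a commutator [A_i, B_j] of two fields vanishes as soon as T(i,-i) kills
   the vacua e^y; this reduces [a,a], [a, gamma e^(-x)] and [a,f] to scalars on vacua.
   The same holds for [f,f], with a and delta in place of the two currents, since by
   the Jacobi identity [f,f] commutes with a.

   Irreducibility: a nonzero submodule contains a nonzero vector killed by a_j for
   j < 0 and by delta(k) for k > 0.  Newton's identities for exp show that x(k), and
   hence gamma(k), kills it too, so it is a multiple of a vacuum e^(y + n x), where e^y
   is the highest weight vector.  The principal grading gives n >= 0, and
   f_0 e^z = - 4 g (g + 1/6) e^(z - x), where g is the value of gamma(0) on e^z,
   does not vanish for z = y + n x, n > 0; so e^y lies in the submodule.  Uniqueness of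
   L(lambda): the submodule of M x N generated by the two highest weight vectors is the
   graph of an isomorphism. *)
Require Import Defs.
From mathcomp Require Import all_boot all_order all_algebra reals complex.
From mathcomp Require Import finmap multiset boolp classical_sets functions fsbigop.
From mathcomp.multinomials Require Import monalg.
From mathcomp Require Import ring lra zify.

Set Implicit Arguments.
Unset Strict Implicit.
Unset Printing Implicit Defensive.
Import Order.TTheory GRing.Theory Num.Theory.
Local Open Scope classical_set_scope.
Local Open Scope ring_scope.

(** The brackets are verified on modes, not deduced from a Jacobi identity for the generalized
    vertex algebra. Indexing a mode by its degree shift j removes the fractional powers z^<x,y>; the
    charge only returns in the translation j = - n - 1 - <x,y> for e(n) and j = 1 + <x,y> - n for
    f(n). Because x is isotropic, the exponentials in e^x and e^(-x) commute with one another, so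
    the nontrivial brackets among e and f come from the factors gamma(-1) and gamma(-2) of f. The
    obstacle is [f,f]. Commuting gamma(k) with it brings in the brackets of f with the fields of
    e^(-x) and gamma(-1) e^(-x). These are not scalars, so the induction used for the other brackets
    does not close up. As delta is orthogonal to gamma, commuting delta(k) produces no such terms,
    and modes of e^x can stand in for gamma because they determine the x(k). The values 0 and - 1/6
    of gamma(0) on the two highest weight vectors are the roots of the polynomial by which f_0 acts
    on vacua. *)

Local Arguments car {F} g _.
Local Arguments act {F} g _ _.

(** * Linear combinations *)

(* Reification for [lmod V], which proves identities between linear combinations
   in [V] by comparing coefficients. *)
Section LinearCombination.
Variables (F : fieldType) (V : lmodType F).

Inductive lexp := LVar of nat | LZero | LAdd of lexp & lexp | LOpp of lexp
  | LScale of F & lexp.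

Fixpoint leval (env : seq V) e : V :=
  match e with
  | LVar n => nth 0 env n
  | LZero => 0
  | LAdd e1 e2 => leval env e1 + leval env e2
  | LOpp e1 => - leval env e1
  | LScale a e1 => a *: leval env e1
  end.

Fixpoint lcoef e (n : nat) : F :=
  match e with
  | LVar m => if eqn m n then 1 else 0
  | LZero => 0
  | LAdd e1 e2 => lcoef e1 n + lcoef e2 n
  | LOpp e1 => - lcoef e1 n
  | LScale a e1 => a * lcoef e1 n
  end.

Lemma levalE env e : leval env e = \sum_(i < size env) lcoef e i *: nth 0 env i.
Proof.
elim: e => [m||e1 IH1 e2 IH2|e IH|a e IH] /=.
- have [m_lt|m_ge] := ltnP m (size env); last first.
    rewrite nth_default // big1 // => i _; rewrite ?eqnE gtn_eqF ?scale0r //.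
    exact: leq_trans (ltn_ord i) m_ge.
  rewrite (bigD1 (Ordinal m_lt)) //= ?eqnE eqxx scale1r big1 ?addr0 // => i.
  by rewrite -val_eqE /= ?eqnE eq_sym => /negPf ->; rewrite scale0r.
- by rewrite big1 // => i _; rewrite scale0r.
- by rewrite IH1 IH2 -big_split; apply: eq_bigr => i _; rewrite scalerDl.
- by rewrite IH -sumrN; apply: eq_bigr => i _; rewrite scaleNr.
- by rewrite IH scaler_sumr; apply: eq_bigr => i _; rewrite scalerA.
Qed.

Fixpoint lequal (n : nat) e1 e2 : Prop :=
  if n is n'.+1 then lcoef e1 n' = lcoef e2 n' /\ lequal n' e1 e2 else True.

Lemma lequalP env e1 e2 : lequal (size env) e1 e2 -> leval env e1 = leval env e2.
Proof.
rewrite !levalE => eq12; apply: eq_bigr => i _; congr (_ *: _).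
elim: (size env) (nat_of_ord i) eq12 (ltn_ord i) => {i} //= n IH i [e12 len].
by rewrite ltnS leq_eqVlt => /predU1P[-> //|]; apply: IH.
Qed.
End LinearCombination.

Ltac lmod_insert l t :=
  lazymatch l with
  | nil => constr:(cons t nil)
  | cons t _ => l
  | cons ?x ?r => let r' := lmod_insert r t in constr:(cons x r')
  end.
Ltac lmod_atoms l e :=
  lazymatch e with
  | (?a + ?b)%R => let l' := lmod_atoms l a in lmod_atoms l' b
  | (- ?a)%R => lmod_atoms l a
  | (_ *: ?a)%R => lmod_atoms l a
  | 0%R => l
  | _ => lmod_insert l e
  end.
Ltac lmod_index l t :=
  lazymatch l with
  | cons t _ => constr:(O)
  | cons _ ?r => let n := lmod_index r t in constr:(S n)
  end.
Ltac lmod_reify F l e :=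
  lazymatch e with
  | (?a + ?b)%R => let x := lmod_reify F l a in let y := lmod_reify F l b in
      constr:(@LAdd F x y)
  | (- ?a)%R => let x := lmod_reify F l a in constr:(@LOpp F x)
  | (?k *: ?a)%R => let x := lmod_reify F l a in constr:(@LScale F k x)
  | 0%R => constr:(@LZero F)
  | _ => let n := lmod_index l e in constr:(@LVar F n)
  end.
Ltac lmod_goal F V := lazymatch goal with
  | |- ?a = ?b =>
    let l := lmod_atoms (@nil (GRing.Lmodule.sort V)) a in
    let l := lmod_atoms l b in
    let x := lmod_reify F l a in
    let y := lmod_reify F l b in
    apply: (@lequalP F V l x y); cbn [size lequal lcoef eqn]; repeat split
  end.
Tactic Notation "lmod" constr(V) :=
  lazymatch type of V with GRing.Lmodule.type ?F =>
    let F' := lazymatch F with GRing.Field.Exports.GRing_Field__to__GRing_PzRing ?F' => F' | _ => F end in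
  lmod_goal F' V; first [done | ring | by field | idtac] end.

(** * Modules over the affine algebra *)

Section Subspace.
Variables (F : fieldType) (V : lmodType F) (W : set V).
Hypothesis subW : subspace W.

Lemma sub0 : W 0. Proof. by case: subW. Qed.
Lemma subP a u v : W u -> W v -> W (a *: u + v).
Proof. by case: subW => _; apply. Qed.
Lemma subD u v : W u -> W v -> W (u + v).
Proof. by move=> Wu Wv; rewrite -[u]scale1r; apply: subP. Qed.
Lemma subZ a u : W u -> W (a *: u).
Proof. by move=> Wu; rewrite -[_ *: _]addr0; apply: subP => //; apply: sub0. Qed.
Lemma subB u v : W u -> W v -> W (u - v).
Proof. by move=> Wu Wv; rewrite addrC -scaleN1r; apply: subP. Qed.
Lemma sub_sum I (r : seq I) (P : pred I) (f : I -> V) :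
  (forall i, P i -> W (f i)) -> W (\sum_(i <- r | P i) f i).
Proof.
by move=> Wf; elim/big_rec: _ => [|i v Pi Wv]; [exact: sub0|apply: subD; auto].
Qed.
Lemma sub_Zunit a u : a != 0 -> W (a *: u) -> W u.
Proof. by move=> a0 /(subZ a^-1); rewrite scalerA mulVf ?scale1r. Qed.
End Subspace.

Lemma subspace0 (F : fieldType) (V : lmodType F) : subspace [set (0 : V)].
Proof. by split=> // a u v /= -> ->; rewrite scaler0 addr0. Qed.

Section LinearOn.
Variables (F : fieldType) (V V' : lmodType F) (C : set V) (G : V -> V').
Hypothesis subC : subspace C.
Hypothesis linG : forall a u v, C u -> C v -> G (a *: u + v) = a *: G u + G v.

Lemma linon0 : G 0 = 0.
Proof.
have C0 := sub0 subC; move: (linG (- 1) C0 C0).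
by rewrite scaler0 addr0 scaleN1r addNr.
Qed.
Lemma linonZ a u : C u -> G (a *: u) = a *: G u.
Proof. by move=> Cu; rewrite -[a *: u]addr0 linG ?linon0 ?addr0 //; apply: sub0. Qed.
Lemma linonD u v : C u -> C v -> G (u + v) = G u + G v.
Proof. by move=> Cu Cv; rewrite -[in LHS](scale1r u) linG // scale1r. Qed.
Lemma linon_sum n (w : nat -> V) : (forall k, (k < n)%N -> C (w k)) ->
  G (\sum_(k < n) w k) = \sum_(k < n) G (w k).
Proof.
elim: n => [|n IHn] Cw; first by rewrite !big_ord0 linon0.
have Cn k : (k < n)%N -> C (w k) by move=> kn; apply/Cw/ltnW.
rewrite !big_ord_recr linonD ?IHn //=; last exact: Cw.
by apply: (sub_sum subC) => k _; apply: Cn.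
Qed.
End LinearOn.

Section Lin.
Variables (F : fieldType) (V V' : lmodType F).
Definition lin (f : V -> V') := forall (a : F) u v, f (a *: u + v) = a *: f u + f v.

Section LinTheory.
Variables (f : V -> V') (lf : lin f).
Let linS a u v : setT u -> setT v -> f (a *: u + v) = a *: f u + f v.
Proof. by []. Qed.
Let subT : subspace (setT : set V). Proof. by []. Qed.
Lemma lin0 : f 0 = 0. Proof. exact: (linon0 subT linS). Qed.
Lemma linZ a u : f (a *: u) = a *: f u. Proof. exact: (linonZ subT linS). Qed.
Lemma linD u v : f (u + v) = f u + f v. Proof. exact: (linonD linS). Qed.
Lemma linN u : f (- u) = - f u. Proof. by rewrite -scaleN1r linZ scaleN1r. Qed.
Lemma linB u v : f (u - v) = f u - f v. Proof. by rewrite linD linN. Qed.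
Lemma lin_sum I (r : seq I) (P : pred I) (g : I -> V) :
  f (\sum_(i <- r | P i) g i) = \sum_(i <- r | P i) f (g i).
Proof. exact: (big_morph f linD lin0). Qed.
End LinTheory.

Lemma lin_zero : lin (fun=> 0). Proof. by move=> a u v; rewrite scaler0 addr0. Qed.
Lemma lin_add f g : lin f -> lin g -> lin (fun v => f v + g v).
Proof. by move=> lf lg a u v; rewrite lf lg scalerDr addrACA. Qed.
Lemma lin_scale b f : lin f -> lin (fun v => b *: f v).
Proof. by move=> lf a u v; rewrite lf scalerDr !scalerA mulrC. Qed.
Lemma lin_sub f g : lin f -> lin g -> lin (fun v => f v - g v).
Proof.
by move=> lf lg a u v; rewrite lf lg scalerBr opprD addrACA.
Qed.
Lemma lin_bigsum I (r : seq I) (P : pred I) (g : I -> V -> V') :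
  (forall i, lin (g i)) -> lin (fun v => \sum_(i <- r | P i) g i v).
Proof.
move=> lg a u v; rewrite scaler_sumr -big_split; apply: eq_bigr => i _.
exact: lg.
Qed.
End Lin.

Lemma lin_comp (F : fieldType) (V V' V'' : lmodType F) (f : V' -> V'') (g : V -> V') :
  lin f -> lin g -> lin (fun v => f (g v)).
Proof. by move=> lf lg a u v; rewrite lg lf. Qed.
Lemma lin_id (F : fieldType) (V : lmodType F) : lin (@id V). Proof. by []. Qed.

(** Vandermonde by induction: [G t] minus [mu t n] kills the last eigenvector and rescales every
    other one, by a factor that is nonzero for a suitable [t]. A family of operators is allowed
    because h(0) or d alone does not separate the components of a vector. With [W] the zero subspace
    this is the independence of eigenvectors. *)
Lemma eigen_split (F : fieldType) (V : lmodType F) (C W : set V) (T : Type)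
    (G : T -> V -> V) (mu : T -> nat -> F) n (w : nat -> V) :
  subspace C -> subspace W ->
  (forall t a u v, C u -> C v -> G t (a *: u + v) = a *: G t u + G t v) ->
  (forall t u, W u -> W (G t u)) ->
  (forall i j, (i < n)%N -> (j < n)%N -> (forall t, mu t i = mu t j) -> i = j) ->
  (forall k, (k < n)%N -> C (w k) /\ forall t, G t (w k) = mu t k *: w k) ->
  W (\sum_(k < n) w k) -> forall k, (k < n)%N -> W (w k).
Proof.
move=> subC subW linG stabW; elim: n w => // n IHn w inj_mu Gw Wsum.
have Cw k : (k < n.+1)%N -> C (w k) by move=> /Gw[].
have Wlt k : (k < n)%N -> W (w k).
  move=> kn; have [t mu_t] : exists t, mu t k != mu t n.
    apply: contrapT => no_t; have kn' : k = n.
      apply: inj_mu; rewrite ?ltnS ?(ltnW kn) // => t.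
      by apply/eqP/negPn/negP => ne; apply: no_t; exists t.
    by rewrite kn' ltnn in kn.
  apply: (@sub_Zunit _ _ _ subW (mu t k - mu t n)); first by rewrite subr_eq0.
  apply: (IHn (fun k => (mu t k - mu t n) *: w k)) => //.
  - by move=> i j /ltnW i_n /ltnW jn; apply: inj_mu; rewrite ltnS.
  - move=> i /ltnW i_n; have [Cwi Gwi] := Gw i i_n; split; first exact: subZ.
    by move=> t'; rewrite (linonZ subC (linG t')) // Gwi !scalerA mulrC.
  - have : W (G t (\sum_(k < n.+1) w k) - mu t n *: \sum_(k < n.+1) w k).
      by apply: subB => //; [exact: stabW|exact: subZ].
    rewrite (linon_sum subC (linG t)) // scaler_sumr -sumrB big_ord_recr /=.
    rewrite [G t (w n)]((Gw n _).2 t) // subrr addr0.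
    by under eq_bigr => i _ do
      rewrite [G t _]((Gw i _).2 t) 1?ltnW ?ltnS // -scalerBl.
move=> k; rewrite ltnS leq_eqVlt => /predU1P[-> | /Wlt //].
have -> : w n = \sum_(k < n.+1) w k - \sum_(k < n) w k.
  by rewrite big_ord_recr /= [_ + w n]addrC addrK.
by apply: subB => //; apply: sub_sum => // i _; apply: Wlt.
Qed.

(* [false] stands for [gamma] and [true] for [delta]. *)
Definition osc_form (F : fieldType) (c c' : bool) : F :=
  if c == c' then (if c then - (1 / 6) else 1 / 6) else 0.

Lemma osc_form_values (F : fieldType) :
  ((osc_form F false false = 1 / 6) * (osc_form F false true = 0) *
   (osc_form F true false = 0) * (osc_form F true true = - (1 / 6)))%type.
Proof. by []. Qed.

(* The principal grading: the simple root vectors [e(0)] and [f(1)] have degree 1. *)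
Definition principal (x : ghat) : int :=
  match x with
  | Loop sl2e n => n * 2 + 1
  | Loop sl2f n => n * 2 - 1
  | Loop sl2h n => n * 2
  | _ => 0
  end.

(** Positive principal degree singles out n_+, and degree 0 contains only h(0), c and d. The grading
    by d alone would leave e(0) and f(0) in degree 0, and the top layer would not be a line. *)
Lemma principal_gt0 x : 0 < principal x <-> ghat_nplus x.
Proof. case: x => [[] n| |] //=; lia. Qed.

(** * Layers of a highest weight module for the principal grading *)

Section HighestWeight.
Variables (F : numFieldType) (M : ghat_ops F).
Hypothesis modM : is_module M.

Let subC : subspace (car M). Proof. by case: modM. Qed.
Let car_act x v : car M v -> car M (act M x v). Proof. by case: modM => _ h _ _; apply: h. Qed.
Let actP x (a : F) u v : car M u -> car M v ->
        act M x (a *: u + v) = a *: act M x u + act M x v.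
Proof. by case: modM => _ _ h _; apply: h. Qed.
Let act0 x : act M x 0 = 0.
Proof. exact: (linon0 subC (actP x)). Qed.
Let actZ x a u : car M u -> act M x (a *: u) = a *: act M x u.
Proof. exact: (linonZ subC (actP x)). Qed.
Let bracket x y v : car M v ->
  act M x (act M y v) = act M y (act M x v) +
     \sum_(p <- ghat_bracket F x y) p.1 *: act M p.2 v.
Proof. by case: modM => _ _ _ /[apply] <-; rewrite addrC subrK. Qed.

(** The bracket respects the principal degree; membership in a subspace [S] is the form in which
    layers use this. *)
Lemma bracket_principal (S : set M) x y v : subspace S ->
  (forall z, principal z = principal x + principal y -> S (act M z v)) ->
  S (\sum_(p <- ghat_bracket F x y) p.1 *: act M p.2 v).
Proof.
move=> subS Sv.
have S0 := sub0 subS.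
case: x y Sv => [a n| |] [b m| |] Sv /=; rewrite ?big_nil //.
- rewrite big_cat /=; apply: (subD subS).
    case: a b Sv => [] [] Sv /=; rewrite ?big_cons ?big_nil ?addr0 //=;
      by apply: (subZ subS); apply: Sv => /=; lia.
  case: eqP => nm; rewrite ?big_cons ?big_nil ?addr0 //=.
  by case: a b Sv => [] [] Sv /=; rewrite ?mulr0 ?scale0r //;
    apply: (subZ subS); apply: Sv => /=; lia.
- rewrite big_cons big_nil addr0 /=; apply: (subZ subS); apply: Sv => /=; lia.
- rewrite big_cons big_nil addr0 /=; apply: (subZ subS); apply: Sv => /=; lia.
Qed.

(** The adjoint action of h(0) + 4 d on e(n), f(n), h(n) has eigenvalues 4 n + 2, 4 n - 2, 4 n:
    twice the principal degree. *)
Definition principal_op (u : M) : M :=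
  act M (Loop sl2h 0) u + 4 *: act M Der u.

Lemma principal_opP a u v : car M u -> car M v ->
  principal_op (a *: u + v) = a *: principal_op u + principal_op v.
Proof.
move=> Cu Cv; rewrite /principal_op !actP // !scalerDr !scalerA.
by rewrite addrACA [4 * a]mulrC.
Qed.

Lemma principal_op_act x u : car M u ->
  principal_op (act M x u) =
    act M x (principal_op u) + (2 * principal x)%:~R *: act M x u.
Proof.
move=> Cu; rewrite /principal_op (bracket _ x Cu) (bracket Der x Cu).
rewrite (linonD (actP x)) ?actZ //; do ?[exact: car_act];
  last by apply: subZ => //; apply: car_act.
rewrite scalerDr addrACA; congr (_ + _).
case: x => [a n| |] /=; last 2 first.
- by rewrite ?big_seq1 ?big_nil /= ?oppr0 ?scale0r scaler0 addr0.
- by rewrite ?big_seq1 ?big_nil /= ?oppr0 ?scale0r scaler0 addr0.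
rewrite big_seq1 big_cat /= mul0r add0r scalerA.
rewrite [X in _ + X + _](_ : _ = 0) ?addr0; last first.
  by case: ifP => _; rewrite ?big_seq1 ?big_nil ?mul0r ?scale0r.
case: a => /=; rewrite ?big_seq1 ?big_nil /= ?add0r -?scalerDl; congr (_ *: _);
  by rewrite !(intrM, intrD, intrB) -?[_%:~R * _]mulr_intr; ring.
Qed.

Variables (lambda : weight F) (v : M).
Hypothesis Cv : car M v.
Hypothesis wv : has_weight lambda v.
Hypothesis nv : forall x, ghat_nplus x -> act M x v = 0.

(* Contains the component of degree [- k] of the submodule generated by [v]. *)
Inductive layer : int -> set M :=
  | layer_gen : layer 0 v
  | layer_zero k : layer k 0
  | layer_lin k (a : F) u w : layer k u -> layer k w -> layer k (a *: u + w)
  | layer_act x k u : principal x <= 0 -> layer k u ->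
      layer (k - principal x) (act M x u).

Lemma layer_sub k : subspace (layer k).
Proof. split; [exact: layer_zero|exact: layer_lin]. Qed.

Lemma layer_car k u : layer k u -> car M u.
Proof.
by elim=> // *; [exact: sub0|apply: subP|apply: car_act].
Qed.

Lemma layer_lt0 k u : layer k u -> k < 0 -> u = 0.
Proof.
elim=> {k u} // [k a u w _ IHu _ IHw k0|x k u x0 _ IH k0].
  by rewrite IHu // IHw // scaler0 addr0.
by rewrite IH ?act0 //; lia.
Qed.

(** A nonpositive [x] reaches layer 0 only from layers [k <= 0]. Those with [k < 0] vanish, and from
    [k = 0] the element [x] has principal degree 0, hence is h(0), c or d, which act on [v] by
    scalars. *)
Lemma layer0_line k u : layer k u -> k = 0 -> exists c : F, u = c *: v.
Proof.
elim=> {k u} [|k|k a u w _ IHu _ IHw /[dup] /IHu[c ->] /IHw[d ->]|x k u x0 Lu IH k0].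
- by exists 1; rewrite scale1r.
- by exists 0; rewrite scale0r.
- by exists (a * c + d); rewrite scalerDl scalerA.
have [k_lt0|k_ge0] := ltP k 0.
  by exists 0; rewrite (layer_lt0 Lu) // act0 scale0r.
have px : principal x = 0 by lia.
have {}k0 : k = 0 by lia.
have [c ->] := IH k0; rewrite actZ //.
case: wv => hv cv dv; case: x x0 px {k0} => [[] n| |] /= x0 px; try lia.
- by exists (c * lambda.1.1); rewrite (_ : n = 0) 1?hv ?scalerA //; lia.
- by exists (c * lambda.1.2); rewrite cv scalerA.
- by exists (c * lambda.2); rewrite dv scalerA.
Qed.

(** This takes the place of the PBW theorem. Layers are built with nonpositive elements only, so a
    positive [x] is moved past [y] towards [v]; the bracket term either has nonpositive degree and
    may be used to build layers, or has positive degree and is covered by the induction on [u]. *)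
Lemma layer_nplus k u : layer k u -> forall x, 0 < principal x ->
  layer (k - principal x) (act M x u).
Proof.
elim=> {k u} [|k|k a u w Lu IHu Lw IHw|y k u y0 Lu IH] x x0.
- by rewrite nv; [exact: layer_zero|apply/principal_gt0].
- by rewrite act0; exact: layer_zero.
- rewrite actP; [|exact: layer_car Lu|exact: layer_car Lw].
  by apply: layer_lin; auto.
rewrite bracket; last exact: layer_car Lu.
apply: (subD (layer_sub _)).
  by rewrite addrAC; apply/layer_act/IH.
apply: (bracket_principal (layer_sub _)) => z zxy.
have -> : k - principal y - principal x = k - principal z by lia.
by have [z0|z0] := lerP (principal z) 0; [apply: layer_act|apply: IH].
Qed.

Lemma layer_all x k u : layer k u -> layer (k - principal x) (act M x u).
Proof.
by move=> Lu; have [x0|x0] := lerP (principal x) 0;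
  [apply: layer_act|apply: layer_nplus].
Qed.

Lemma layer_eigen k u : layer k u ->
  principal_op u = (lambda.1.1 + 4 * lambda.2 - (2 * k)%:~R) *: u.
Proof.
elim=> {k u} [|k|k a u w Lu IHu Lw IHw|x k u x0 Lu IH].
- by case: wv => hv cv dv; rewrite /principal_op hv dv mulr0 mulr0z subr0 scalerA -scalerDl.
- by rewrite /principal_op !act0 !scaler0 addr0.
- rewrite principal_opP ?IHu ?IHw; last first.
  + exact: layer_car Lw.
  + exact: layer_car Lu.
  by rewrite scalerDr !scalerA mulrC.
have Cu := layer_car Lu.
rewrite principal_op_act // IH actZ // -scalerDl; congr (_ *: _).
by rewrite mulrBr intrB; ring.
Qed.

Lemma orbit_layers u : Uorbit v u -> exists n (w : nat -> M),
  (forall k, layer k%:Z (w k)) /\ u = \sum_(k < n) w k.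
Proof.
pose span u := exists n (w : nat -> M),
  (forall k, layer k%:Z (w k)) /\ u = \sum_(k < n) w k.
rewrite -/(span u).
have pad n m (w : nat -> M) : (n <= m)%N ->
    \sum_(k < m) (if (k < n)%N then w k else 0) = \sum_(k < n) w k.
  by move=> nm; rewrite -big_mkcond (big_ord_widen m w nm).
have span_lin a u1 u2 : span u1 -> span u2 -> span (a *: u1 + u2).
  move=> [n1 [w1 [L1 ->]]] [n2 [w2 [L2 ->]]].
  exists (maxn n1 n2), (fun k => a *: (if (k < n1)%N then w1 k else 0) +
    (if (k < n2)%N then w2 k else 0)); split.
    move=> k; apply: layer_lin; by case: ifP => _ //; exact: layer_zero.
  by rewrite big_split /= -scaler_sumr !pad ?leq_maxl ?leq_maxr.
have span0 : span 0.
  by exists 0, (fun=> 0); split=> [k|]; [exact: layer_zero|rewrite big_ord0].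
have spanL k u1 : layer k u1 -> span u1.
  case: k => [k|k] L1; last by rewrite (layer_lt0 L1).
  exists k.+1, (fun j => if j == k then u1 else 0); split.
    by move=> j; case: eqP => [->|_] //; exact: layer_zero.
  rewrite big_ord_recr /= eqxx big1 ?add0r // => i _.
  by rewrite (ltn_eqF (ltn_ord i)).
elim=> {u} [|||x u _ [n [w [Lw ->]]]] //.
- exact/spanL/layer_gen.
- by move=> a u1 u2 _ s1 _ s2; apply: span_lin.
rewrite (linon_sum subC (actP x)); last by move=> k _; apply: layer_car (Lw k).
elim: n => [|n IHn]; first by rewrite big_ord0.
rewrite big_ord_recr /= addrC -[act M x _]scale1r; apply: span_lin => //.
exact/spanL/layer_all/Lw.
Qed.

(** Layers are eigenspaces of [principal_op] with distinct eigenvalues in characteristic 0, so an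
    eigenvector lies in a single layer. Both cases apply [eigen_split] to a vanishing sum, with the
    zero subspace. *)
Lemma orbit_eigen mu u : Uorbit v u -> principal_op u = mu *: u -> u <> 0 ->
  exists2 k : nat, mu = lambda.1.1 + 4 * lambda.2 - (2 * k)%:R & layer k%:Z u.
Proof.
move=> Uu Gu u0; have [n [w [Lw defu]]] := orbit_layers Uu.
have [nu nuE] : exists nu : nat -> F,
  forall k, nu k = lambda.1.1 + 4 * lambda.2 - (2 * k)%:R by eexists.
have nu_inj i j : nu i = nu j -> i = j.
  by rewrite !nuE => /addrI/oppr_inj/eqP; rewrite eqr_nat => /eqP; lia.
have Gw k : principal_op (w k) = nu k *: w k by rewrite (layer_eigen (Lw k)) nuE.
have Cu : car M u.
  by rewrite defu; apply: sub_sum => // k _; apply: layer_car (Lw _).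
have stab0 w0 : [set 0] w0 -> [set (0 : M)] (principal_op w0).
  by move=> ->; rewrite /= /principal_op !act0 scaler0 addr0.
have [[k kn muk]|nomu] := pselect (exists2 k, (k < n)%N & mu = nu k).
  exists k; first by rewrite -nuE.
  (* Moving [u] into the summand with the same eigenvalue gives a vanishing sum of eigenvectors,
     whence [w k = u]. *)
  pose w' j := if j == k then w j - u else w j.
  suff w'0 : [set 0] (w' k).
    by move/eqP: w'0; rewrite /w' eqxx subr_eq0 => /eqP <-; apply: Lw.
  apply: (@eigen_split _ _ (car M) _ unit (fun=> principal_op) (fun=> nu) n w') => //.
  - exact: subspace0.
  - by move=> _; apply: principal_opP.
  - move=> i j _ _ e; exact (nu_inj i j (e tt)).
  - move=> j jn; rewrite /w'; case: eqP => [->|_].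
      split; first by apply: subB => //; apply: layer_car (Lw _).
      rewrite addrC -scaleN1r principal_opP ?Gw ?Gu ?muk //.
        by rewrite scalerA mulrC -scalerA -scalerDr.
      exact: layer_car (Lw _).
    by split=> //; apply: layer_car (Lw _).
  - rewrite /= /w' (bigD1 (Ordinal kn)) //= eqxx.
    rewrite (eq_bigr (fun i : 'I_n => w i)) => [|i].
      by move: defu; rewrite (bigD1 (Ordinal kn)) //= addrAC => <-; rewrite subrr.
    by rewrite -val_eqE /= => /negPf ->.
case: u0.
(* Here no layer has eigenvalue [mu]: [- u] joins the sum as an eigenvector with a new eigenvalue,
   and independence forces [u = 0]. *)
pose w' j := if j == n then - u else w j.
pose mu' j := if j == n then mu else nu j.
suff w'0 : [set 0] (w' n).
  by move/eqP: w'0; rewrite /w' eqxx oppr_eq0 => /eqP.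
apply: (@eigen_split _ _ (car M) _ unit (fun=> principal_op) (fun=> mu') n.+1 w') => //.
- exact: subspace0.
- by move=> _; apply: principal_opP.
- move=> i j; rewrite !ltnS /mu' => lein lejn /(_ tt); move: lein lejn.
  case: eqP => [->|/eqP i_n]; case: eqP => [->|/eqP j_n] // lein lejn e.
  + by case: nomu; exists j; rewrite // ltn_neqAle j_n.
  + by case: nomu; exists i; rewrite // ltn_neqAle i_n.
  + exact: nu_inj.
- move=> k _; rewrite /w' /mu'; case: eqP => _.
    rewrite -scaleN1r; split; first exact: subZ.
    by rewrite (linonZ subC principal_opP) // Gu !scalerA mulrC.
  by split=> //; apply: layer_car (Lw _).
- rewrite /= /w' big_ord_recr /= eqxx (eq_bigr (fun i : 'I_n => w i)) => [|i _].
    by rewrite -defu subrr.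
  by rewrite (ltn_eqF (ltn_ord i)).
Qed.

End HighestWeight.

Section CyclicSubmodule.
Variables (F : fieldType) (M : ghat_ops F).

Lemma Usub_module (v : M) : is_module M -> car M v -> is_module (Usub v).
Proof.
move=> [sM cM lM bM] Cv.
have carU u : Uorbit v u -> car M u.
  by elim=> *; [|exact: (sub0 sM)|exact: (subP sM)|exact: cM].
split.
- by split=> [|a u w]; [exact: Uorbit_zero|exact: Uorbit_lin].
- by move=> x u; apply: Uorbit_act.
- by move=> x a u w /carU Cu /carU Cw; apply: lM.
- by move=> x y u /carU Cu; apply: bM.
Qed.

Lemma Usub_orbit (v : M) : @Uorbit F (Usub v) v = Uorbit v.
Proof.
apply/seteqP; split=> u; elim=> *.
- exact: Uorbit_gen.
- exact: Uorbit_zero.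
- exact: Uorbit_lin.
- exact: Uorbit_act.
- exact: Uorbit_gen.
- exact: Uorbit_zero.
- exact: Uorbit_lin.
- exact: (@Uorbit_act F (Usub v)).
Qed.
End CyclicSubmodule.

(** * The submodule of a product generated by two highest weight vectors *)

Section ProductModule.
Variables (F : numFieldType) (M N : ghat_ops F).

Definition prod_ops : ghat_ops F :=
  @GhatOps F (M * N)%type [set p | car M p.1 /\ car N p.2]
    (fun x p => (act M x p.1, act N x p.2)).

Lemma prod_is_module : is_module M -> is_module N -> is_module prod_ops.
Proof.
move=> [sM cM lM bM] [sN cN lN bN]; split.
- split; first by split; [exact: (sub0 sM)|exact: (sub0 sN)].
  by move=> a [u u'] [v v'] /= [Cu Cu'] [Cv Cv']; split; apply: subP.
- by move=> x [v v'] /= [Cv Cv']; split; [apply: cM|apply: cN].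
- move=> x a [u u'] [v v'] /= [Cu Cu'] [Cv Cv'].
  by apply: injective_projections; rewrite /= (lM, lN).
- move=> x y [v v'] /= [Cv Cv'].
  apply: injective_projections => /=.
    by rewrite bM // (raddf_sum fst).
  by rewrite bN // (raddf_sum snd).
Qed.

Lemma orbit_prod (v : M) (v' : N) p :
  @Uorbit F prod_ops (v, v') p -> Uorbit v p.1 /\ Uorbit v' p.2.
Proof.
elim=> {p} [|||x p _ [? ?]] /=.
- by split; apply: Uorbit_gen.
- by split; apply: Uorbit_zero.
- by move=> a [u u'] [w w'] _ [? ?] _ [? ?]; split; apply: Uorbit_lin.
- by split; apply: Uorbit_act.
Qed.

Lemma orbit_prod_lift (v : M) (v' : N) u :
  Uorbit v u -> exists u', @Uorbit F prod_ops (v, v') (u, u').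
Proof.
elim=> {u} [||a u w _ [u' Uu] _ [w' Uw]|x u _ [u' Uu]].
- by exists v'; apply: Uorbit_gen.
- by exists 0; apply: Uorbit_zero.
- by exists (a *: u' + w'); apply: (@Uorbit_lin _ prod_ops _ _ (u, u') (w, w')).
- by exists (act N x u'); apply: (@Uorbit_act _ prod_ops _ _ (u, u')).
Qed.

Variables (lambda : weight F) (v : M) (v' : N).
Hypotheses (modM : is_module M) (modN : is_module N) (irrN : irreducible N).
Hypotheses (sv : singular v) (sv' : singular v').
Hypotheses (wv : has_weight lambda v) (wv' : has_weight lambda v').

(** The second components lying over 0 form a submodule [K] of [N]. If [K] were all of [N], then
    [(0, v')] would be in the orbit with the principal eigenvalue of [(v, v')], hence in layer 0 and
    a multiple of [(v, v')]; its first component being 0, the multiple would be 0, contradicting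
    [v' <> 0]. *)
Lemma orbit_prod_graph u' : @Uorbit F prod_ops (v, v') (0, u') -> u' = 0.
Proof.
move=> U0u; have modP := prod_is_module modM modN.
have [cv v0 _ nv] := sv; have [cv' v'0 _ nv'] := sv'.
have [sP cP lP bP] := modP.
have carU p : @Uorbit F prod_ops (v, v') p -> car prod_ops p.
  by elim=> *; [split|exact: (sub0 sP)|exact: (subP sP)|exact: cP].
pose K : set N := [set u | @Uorbit F prod_ops (v, v') (0, u)].
have subK : is_submodule K.
  split.
  - by move=> u /carU[].
  - split; first exact: Uorbit_zero.
    move=> a u w Ku Kw.
    have := @Uorbit_lin _ prod_ops _ a _ _ Ku Kw.
    by rewrite /K /= /GRing.scale /= /GRing.add /= /scale_pair /add_pair /= scaler0 addr0.
  - move=> x u Ku; have := @Uorbit_act _ prod_ops _ x _ Ku.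
    by rewrite /K /=; case: modM => sM _ lM _; rewrite (linon0 sM (lM x)).
case: (irrN.2 K subK) => KE.
  by have : K u' by []; rewrite KE.
have Kv' : K v' by rewrite KE.
have [hv zv dv] := wv; have [hv' zv' dv'] := wv'.
have wP : @has_weight F prod_ops lambda (v, v').
  by split; apply: injective_projections.
have nP x : ghat_nplus x -> act prod_ops x (v, v') = 0.
  by move=> nx; rewrite /= nv ?nv'.
have [||k kE] := @orbit_eigen F prod_ops modP lambda (v, v') (conj cv cv') wP nP
  (lambda.1.1 + 4 * lambda.2) (0, v') Kv'.
- apply: injective_projections.
    case: modM => sM _ lM _.
    by rewrite /= !(linon0 sM (lM _)) !scaler0 addr0.
  by rewrite /= hv' dv' scalerA -scalerDl.
- by case.
have k0 : k = 0%N.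
  have /eqP : (2 * k)%:R = 0 :> F.
    by rewrite -[LHS](subKr (lambda.1.1 + 4 * lambda.2)) -kE subrr.
  by rewrite pnatr_eq0; lia.
rewrite k0 => L0.
have [c [c0 c1]] := @layer0_line F prod_ops modP lambda (v, v') (conj cv cv') wP _ _ L0 erefl.
have /eqP := esym c0; rewrite scaler_eq0 => /orP[/eqP cz|/eqP //].
by case: v'0; rewrite c1 cz scale0r.
Qed.
End ProductModule.

Lemma orbit_swap (F : numFieldType) (M N : ghat_ops F) (v : M) (v' : N) p :
  @Uorbit F (prod_ops M N) (v, v') p -> @Uorbit F (prod_ops N M) (v', v) (p.2, p.1).
Proof.
elim=> {p} [|||x p _ IH].
- exact: Uorbit_gen.
- exact: Uorbit_zero.
- move=> a p q _ IHp _ IHq; exact: (@Uorbit_lin _ (prod_ops N M) _ a _ _ IHp IHq).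
- exact: (@Uorbit_act _ (prod_ops N M) _ x _ IH).
Qed.

(* The submodule of [M x N] generated by both highest weight vectors is the
   graph of an isomorphism. *)
Lemma irreducible_highest_weight_unique (F : numFieldType) (lambda : weight F)
    (M N : ghat_ops F) :
  irreducible_highest_weight lambda M -> irreducible_highest_weight lambda N ->
  isomorphic M N.
Proof.
move=> [modM irrM [v [sv wv carM]]] [modN irrN [v' [sv' wv' carN]]].
pose P := prod_ops M N.
pose graph u u' := @Uorbit F P (v, v') (u, u').
have subM : subspace (car M) by case: modM.
have subN : subspace (car N) by case: modN.
have diff u1 u1' u2 u2' : graph u1 u1' -> graph u2 u2' -> graph (u1 - u2) (u1' - u2').
  move=> g1 g2; rewrite [u1 - _]addrC [u1' - _]addrC -!(scaleN1r _).
  exact: (@Uorbit_lin _ P _ (- 1) _ _ g2 g1).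
have fun_graph u u1 u2 : graph u u1 -> graph u u2 -> u1 = u2.
  move=> g1 g2; have := diff _ _ _ _ g1 g2; rewrite subrr.
  by move/(orbit_prod_graph modM modN irrN sv sv' wv wv')/eqP; rewrite subr_eq0 => /eqP.
have inj_graph u u1 u2 : graph u1 u -> graph u2 u -> u1 = u2.
  move=> g1 g2; have /orbit_swap := diff _ _ _ _ g1 g2; rewrite /= subrr.
  by move/(orbit_prod_graph modN modM irrM sv' sv wv' wv)/eqP; rewrite subr_eq0 => /eqP.
(* A total function is required: the value 0 is the default outside the carrier of [M]. *)
pose phi u := xget 0 [set u' | graph u u'].
have phiP u : car M u -> graph u (phi u).
  rewrite carM => /(orbit_prod_lift v')[u' gu].
  by rewrite /phi; case: xgetP => [w _ //|/(_ u')].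
have car_graph u u' : graph u u' -> car M u /\ car N u'.
  by rewrite carM carN => /orbit_prod.
exists phi; split.
- split.
  + by move=> u /phiP/car_graph[].
  + move=> u1 u2; rewrite !inE => /phiP g1 /phiP g2 e.
    by apply: inj_graph g1 _; rewrite e.
  + move=> u'; rewrite carN => /(@orbit_prod_lift _ N M _ v)[u /orbit_swap /= g].
    have [Cu _] := car_graph _ _ g.
    by exists u => //; apply: fun_graph (phiP _ Cu) g.
- move=> a u w Cu Cw; apply: fun_graph (phiP _ _) _; first exact: (subP subM).
  exact: (@Uorbit_lin _ P _ a _ _ (phiP _ Cu) (phiP _ Cw)).
- move=> x u Cu; apply: fun_graph (phiP _ _) _; first by case: modM => _ cM _ _; apply: cM.
  exact: (@Uorbit_act _ P _ x _ (phiP _ Cu)).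
Qed.

(** * Exponentials of series of operators *)

Lemma fsum_ord (V : nmodType) (f : nat -> V) K :
  (forall k, (K <= k)%N -> f k = 0) -> \sum_(k \in [set: nat]) f k = \sum_(k < K) f k.
Proof.
move=> fK; rewrite [RHS]fsbig_ord; apply/esym/fsbig_widen => // k [_ /= kK].
by apply: fK; rewrite leqNgt; apply/negP.
Qed.

Section SerExp.
Variables (F : numFieldType) (V : lmodType F) (A : nat -> V -> V).
Hypothesis linA : forall n, lin (A n).
Hypothesis A0 : forall v, A 0 v = 0.

Fixpoint spow (j k : nat) (v : V) : V :=
  if j is j'.+1 then \sum_(i < k.+1) A i (spow j' (k - i)%N v)
  else if k == 0%N then v else 0.

Definition sexp (k : nat) (v : V) : V :=
  \sum_(j < k.+1) (j`!%:R)^-1 *: spow j k v.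

Lemma spow_lin j k : lin (spow j k).
Proof.
elim: j k => [|j IH] k a u v /=; first by case: ifP; rewrite // scaler0 addr0.
apply: (@lin_bigsum _ _ _ _ _ _ (fun (i : 'I_k.+1) v => A i (spow j (k - i)%N v))) => i.
exact: lin_comp.
Qed.

Lemma sexp_lin k : lin (sexp k).
Proof.
apply: (@lin_bigsum _ _ _ _ _ _ (fun (j : 'I_k.+1) v => (j`!%:R)^-1 *: spow j k v)) => j.
exact/lin_scale/spow_lin.
Qed.

Lemma spow_gt j k v : (k < j)%N -> spow j k v = 0.
Proof.
elim: j k => // j IH k kj /=; apply: big1 => -[[|i] ik] _ /=; first exact: A0.
by rewrite IH ?(lin0 (linA _)) //; lia.
Qed.

Lemma sexpE n k v : (k <= n)%N -> sexp k v = \sum_(j < n.+1) (j`!%:R)^-1 *: spow j k v.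
Proof.
move=> kn; rewrite /sexp (big_ord_widen n.+1 (fun j => (j`!%:R)^-1 *: spow j k v)) //.
rewrite big_mkcond; apply: eq_bigr => j _; case: ltnP => // kj.
by rewrite spow_gt ?scaler0.
Qed.

Lemma sexp0 v : sexp 0 v = v.
Proof. by rewrite /sexp big_ord1 /= invr1 scale1r. Qed.

Lemma fact_inv j : (j.+1`!%:R)^-1 * j.+1%:R = (j`!%:R)^-1 :> F.
Proof.
by rewrite factS natrM invfM mulrAC mulVf ?mul1r // pnatr_eq0.
Qed.

Section Commutator.
Variables (D : V -> V) (m : nat) (c : F).
Hypothesis lD : lin D.
Hypothesis m_gt0 : (0 < m)%N.
Hypothesis comm_DA : forall n v, D (A n v) = A n (D v) + (if n == m then c else 0) *: v.

Lemma spow_comm j n v : D (spow j n v) = spow j n (D v) +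
  (if (m <= n)%N && (0 < j)%N then (j%:R * c) *: spow j.-1 (n - m)%N v else 0).
Proof.
elim: j n => [|j IH] n; first by rewrite andbF addr0 /=; case: ifP => // _; rewrite (lin0 lD).
rewrite /= (lin_sum lD).
under [LHS]eq_bigr => i _ do rewrite comm_DA IH (linD (linA i)) -addrA.
rewrite big_split /=; congr (_ + _); rewrite andbT big_split /=.
have -> : \sum_(i < n.+1) (if i == m :> nat then c else 0) *: spow j (n - i)%N v =
    if (m <= n)%N then c *: spow j (n - m)%N v else 0.
  case: leqP => [mn|nm].
    rewrite (bigD1 (Ordinal (mn : m < n.+1)%N)) //= eqxx big1 ?addr0 // => i.
    by rewrite -val_eqE /= => /negPf ->; rewrite scale0r.
  apply: big1 => i _; rewrite ltn_eqF ?scale0r //.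
  by apply: leq_trans nm; apply: ltn_ord.
case: j {IH} => [|j].
  rewrite big1 ?add0r => [|i _]; last by rewrite andbF (lin0 (linA _)).
  by case: ifP => //; rewrite mul1r.
case: (leqP m n) => [mn|nm]; last first.
  rewrite addr0 big1 // => i _; rewrite ifF ?(lin0 (linA _)) //.
  by rewrite andbT; apply/negbTE; lia.
rewrite -[j.+2%:R]natr1 mulrDl mul1r scalerDl; congr (_ + _).
rewrite [spow j.+1 (n - m) v]/= scaler_sumr.
rewrite (big_ord_widen n.+1 (fun i =>
  (j.+1%:R * c) *: A i (spow j (n - m - i)%N v))); last by lia.
rewrite [RHS]big_mkcond; apply: eq_bigr => i _ /=.
case: ifP => i1; case: ifP => i2 //; try lia.
  by rewrite (linZ (linA _)) subnAC.
by rewrite (lin0 (linA _)).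
Qed.

(** Since [D, A(s)] = c s^m is central, D acts on the exponential as a derivation: [D, exp A(s)] = c
    s^m exp A(s). *)
Lemma sexp_comm n v : D (sexp n v) = sexp n (D v) +
  (if (m <= n)%N then c *: sexp (n - m)%N v else 0).
Proof.
rewrite /sexp (lin_sum lD).
under eq_bigr => j _ do rewrite (linZ lD) spow_comm scalerDr.
rewrite big_split /=; congr (_ + _); case: leqP => mn; last first.
  by apply: big1 => j _; rewrite scaler0.
rewrite -/(sexp (n - m)%N v) big_ord_recl /= scaler0 add0r.
have n0 : n = n.-1.+1 by lia.
rewrite (@sexpE n.-1) ?scaler_sumr; last by lia.
rewrite [in LHS]n0; apply: eq_bigr => j _.
by rewrite /= /bump /= add1n !scalerA mulrA fact_inv [c * _]mulrC add0n (_ : n.-1.+1 - m = n - m)%N //; lia.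
Qed.
End Commutator.

Hypothesis comm_AA : forall i j v, A i (A j v) = A j (A i v).

Lemma spow_commA i j k v : A i (spow j k v) = spow j k (A i v).
Proof.
elim: j k => [|j IH] k /=; first by case: ifP => _; rewrite ?(lin0 (linA _)).
by rewrite (lin_sum (linA _)); apply: eq_bigr => l _; rewrite comm_AA IH.
Qed.

Lemma exchange_convolution (g : nat -> nat -> V) n :
  \sum_(i < n.+1) \sum_(l < (n - i).+1) g i l =
  \sum_(l < n.+1) \sum_(i < (n - l).+1) g i l.
Proof.
transitivity (\sum_(i < n.+1) \sum_(l < n.+1 | (i + l <= n)%N) g i l).
  apply: eq_bigr => i _.
  rewrite (big_ord_widen n.+1 (fun l => g i l)); last by lia.
  by apply: eq_bigl => l; have := ltn_ord i; have := ltn_ord l; lia.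
rewrite (exchange_big_dep predT) //=; apply: eq_bigr => l _.
rewrite (big_ord_widen n.+1 (fun i => g i l)); last by lia.
by apply: eq_bigl => i; have := ltn_ord i; have := ltn_ord l; lia.
Qed.

(** The coefficient of s^n in s (d/ds) A^(j+1) = (j+1) (s dA/ds) A^j. Summing over j with the
    factorials gives s E' = (s A') E for E = exp A(s), which is [sexp_newton]. *)
Lemma spow_newton j n v : n%:R *: spow j.+1 n v =
  j.+1%:R *: \sum_(i < n.+1) i%:R *: A i (spow j (n - i)%N v).
Proof.
elim: j n => [|j IH] n.
  rewrite scale1r scaler_sumr /=; apply: eq_bigr => i _.
  have := ltn_ord i; rewrite ltnS => i_n.
  case: eqP => [e|_]; last by rewrite !(lin0 (linA _)) !scaler0.
  by rewrite (_ : nat_of_ord i = n) //; lia.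
have step (i : 'I_n.+1) : n%:R *: A i (spow j.+1 (n - i)%N v) =
    i%:R *: A i (spow j.+1 (n - i)%N v) +
    j.+1%:R *: \sum_(l < (n - i).+1) l%:R *: A l (A i (spow j (n - l - i)%N v)).
  have -> : n%:R = i%:R + (n - i)%:R :> F.
    by rewrite -natrD subnKC // -ltnS ltn_ord.
  rewrite scalerDl; congr (_ + _).
  rewrite -(linZ (linA i)) IH (linZ (linA i)) (lin_sum (linA i)); congr (_ *: _).
  by apply: eq_bigr => l _; rewrite (linZ (linA i)) comm_AA subnAC.
rewrite [spow j.+2 n v]/= scaler_sumr (eq_bigr _ (fun i _ => step i)).
rewrite big_split /= -scaler_sumr -[j.+2%:R]natr1 scalerDl scale1r [RHS]addrC.
congr (_ + _); congr (_ *: _).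
rewrite (exchange_convolution (fun i l => l%:R *: A l (A i (spow j (n - l - i)%N v)))).
by apply: eq_bigr => l _; rewrite -scaler_sumr -(lin_sum (linA l)).
Qed.

Lemma sexp_newton n v :
  n%:R *: sexp n v = \sum_(i < n.+1) i%:R *: A i (sexp (n - i)%N v).
Proof.
rewrite /sexp scaler_sumr big_ord_recl /= scalerA mulrC -scalerA.
have -> : n%:R *: (if n == 0%N then v else 0) = 0.
  by case: eqP => [->|_]; rewrite ?scale0r ?scaler0.
rewrite scaler0 add0r.
under eq_bigr => j _.
  rewrite /bump /= add1n scalerA mulrC -scalerA spow_newton scalerA fact_inv scaler_sumr.
  over.
rewrite exchange_big /=; case: n => [|n].
  by rewrite !big_ord1 big_ord0 /= A0 scaler0.
apply: eq_bigr => -[[|i] /= i_n] _.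
  by rewrite scale0r big1 // => j _; rewrite scale0r scaler0.
rewrite -/(sexp (n.+1 - i.+1)%N v) (@sexpE n); last by lia.
rewrite (lin_sum (linA _)) scaler_sumr; apply: eq_bigr => j _.
by rewrite (linZ (linA _)) !scalerA mulrC.
Qed.

Lemma sexp_commuting (D : V -> V) : lin D -> (forall n v, D (A n v) = A n (D v)) ->
  forall n v, D (sexp n v) = sexp n (D v).
Proof.
move=> lD DA n v.
(* The case c = 0 of [sexp_comm]; choosing [m = n.+1] makes its extra term vanish at index [n]. *)
have DA' k u : D (A k u) = A k (D u) + (if k == n.+1 then 0 else 0) *: u.
  by rewrite if_same scale0r addr0.
by rewrite (@sexp_comm D n.+1 0) // ltnn addr0.
Qed.

Lemma sexp_unit v : (forall n, A n v = 0) -> forall n, (0 < n)%N -> sexp n v = 0.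
Proof.
move=> Av n n0; rewrite /sexp big1 // => -[[|j] jn] _ /=.
  by rewrite gtn_eqF ?scaler0.
rewrite big1 ?scaler0 // => i _; rewrite spow_commA Av.
by rewrite (lin0 (spow_lin _ _)).
Qed.
End SerExp.

(** * Vertex operators on Heisenberg modules *)

(* [M(1) (x) C[lat]] as seen by the Heisenberg algebra: [cur c n] is [gamma(n)] or
   [delta(n)], [chg c y] the value of its zero mode on the charge [y], [homog y d]
   the degree [d] part of charge [y], and [shf x] the multiplication by [e^x]. *)
Record heis_space (F : numFieldType) := HeisSpace {
  hs_vec :> lmodType F;
  hs_lat : zmodType;
  cur : bool -> int -> hs_vec -> hs_vec;
  chg : bool -> hs_lat -> F;
  vac : hs_lat -> hs_vec;
  homog : hs_lat -> int -> set hs_vec;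
  shf : hs_lat -> hs_vec -> hs_vec;
  chgD : forall c x y, chg c (x + y) = chg c x + chg c y;
  cur_lin : forall c n, lin (cur c n);
  cur_comm : forall c c' m n v, cur c m (cur c' n v) =
    cur c' n (cur c m v) + (if m + n == 0 then m%:~R * osc_form F c c' else 0) *: v;
  homog_sub : forall y d, subspace (homog y d);
  homog_lt0 : forall y d v, homog y d v -> d < 0 -> v = 0;
  homog_vac : forall y, homog y 0 (vac y);
  vac_neq0 : forall y, vac y != 0;
  cur_homog : forall c n y d v, homog y d v -> homog y (d - n) (cur c n v);
  cur0 : forall c y d v, homog y d v -> cur c 0 v = chg c y *: v;
  homog0 : forall y v, homog y 0 v -> exists a, v = a *: vac y;
  homog_kernel : forall y d v, homog y d v ->
    (forall c (p : nat), cur c p.+1 v = 0) -> d != 0 -> v = 0;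
  homog_span : forall P : set hs_vec, subspace P ->
    (forall y d v, homog y d v -> P v) -> forall v, P v;
  vac_span : forall P : set hs_vec, subspace P -> (forall y, P (vac y)) ->
    (forall c (p : nat) v, P v -> P (cur c (- p.+1%:Z) v)) -> forall v, P v;
  shf_lin : forall x, lin (shf x);
  shf_homog : forall x y d v, homog y d v -> homog (x + y) d (shf x v);
  shfD : forall x y v, shf x (shf y v) = shf (x + y) v;
  shf0 : forall v, shf 0 v = v;
  shf_vac : forall x y, shf x (vac y) = vac (x + y);
  cur_shf : forall c n x v, cur c n (shf x v) =
    shf x (cur c n v) + (if n == 0 then chg c x else 0) *: shf x v }.
Arguments cur {F h} c n v.
Arguments chg {F h} c y.
Arguments vac {F h} y.
Arguments homog {F h} y d.
Arguments shf {F h} x v.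

Section Fields.
Variables (F : numFieldType) (V : heis_space F).
Implicit Types (v u w : V) (x y z : hs_lat V) (c : bool).
Local Notation lat := (hs_lat V).

Lemma chg0 c : chg c (0 : lat) = 0.
Proof. by have := chgD c (0 : lat) 0; rewrite addr0 => /esym/eqP; rewrite -subr_eq0 addrK => /eqP. Qed.

Lemma chgN c x : chg c (- x) = - chg c x.
Proof. by apply/eqP; rewrite -addr_eq0 -chgD addNr chg0. Qed.

Definition graded x (B : int -> V -> V) : Prop :=
  (forall j, lin (B j)) /\
  (forall j y d v, homog y d v -> homog (x + y) (d + j) (B j v)).

Lemma graded_lin x B j : graded x B -> lin (B j). Proof. by case. Qed.
Lemma graded_homog x B j y d v : graded x B -> homog y d v ->
  homog (x + y) (d + j) (B j v).
Proof. by case=> _; apply. Qed.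
Lemma graded_lt0 x B j y d v : graded x B -> homog y d v -> d + j < 0 -> B j v = 0.
Proof. by move=> gB hv; apply: homog_lt0 (graded_homog j gB hv). Qed.

Lemma graded_bound x B v : graded x B ->
  exists K : nat, forall j : int, j + K%:Z < 0 -> B j v = 0.
Proof.
move=> gB; pose P v := exists K : nat, forall j : int, j + K%:Z < 0 -> B j v = 0.
apply: (@homog_span _ _ P) => [|y d u hu].
  split; first by exists 0%N => j _; apply: (lin0 (graded_lin j gB)).
  move=> a u1 u2 [K1 H1] [K2 H2]; exists (maxn K1 K2) => j jK.
  by rewrite (graded_lin j gB) H1 ?H2 ?scaler0 ?addr0 //; lia.
exists `|d|%N => j jd; apply: (graded_lt0 gB hu); lia.
Qed.

Lemma cur_bound v : exists K : nat, forall c (n : int), K%:Z < n -> cur c n v = 0.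
Proof.
pose P v := exists K : nat, forall c (n : int), K%:Z < n -> cur c n v = 0.
apply: (@homog_span _ _ P) => [|y d u hu].
  split; first by exists 0%N => c n _; apply: (lin0 (cur_lin c n)).
  move=> a u1 u2 [K1 H1] [K2 H2]; exists (maxn K1 K2) => c n nK.
  by rewrite cur_lin H1 ?H2 ?scaler0 ?addr0 //; lia.
by exists `|d|%N => c n nd; apply: (homog_lt0 (cur_homog c n hu)); lia.
Qed.

Lemma curC c c' m n v : m + n != 0 -> cur c m (cur c' n v) = cur c' n (cur c m v).
Proof. by move=> mn; rewrite cur_comm (negPf mn) scale0r addr0. Qed.

Lemma cur_vac c (n : int) y : 0 < n -> cur c n (vac y) = 0.
Proof. by move=> n0; apply: (homog_lt0 (cur_homog c n (homog_vac y))); lia. Qed.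

Lemma cur0_vac c y : cur c 0 (vac y) = chg c y *: vac y.
Proof. exact: cur0 (homog_vac y). Qed.

Lemma graded_vac_lt0 x B j y : graded x B -> j < 0 -> B j (vac y) = 0.
Proof. by move=> gB j0; apply: (graded_lt0 gB (homog_vac y)); rewrite add0r. Qed.

Section Vertex.
Variables (x : lat) (p q : F).
Hypothesis chgx : forall c, chg c x = p * osc_form F c false + q * osc_form F c true.

(* [x(n)], for [x = p gamma + q delta] *)
Definition xcur n v : V := p *: cur false n v + q *: cur true n v.

Lemma xcur_lin n : lin (xcur n).
Proof. by apply: lin_add; apply/lin_scale/cur_lin. Qed.

Lemma xcur_homog n y d v : homog y d v -> homog y (d - n) (xcur n v).
Proof.
by move=> hv; apply: (subD (homog_sub y (d - n)));
  apply: (subZ (homog_sub y (d - n))); apply: cur_homog.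
Qed.

Lemma cur_xcur c m n v : cur c m (xcur n v) =
  xcur n (cur c m v) + (if m + n == 0 then m%:~R * chg c x else 0) *: v.
Proof.
rewrite /xcur (linD (cur_lin c m)) !(linZ (cur_lin c m)) cur_comm [cur c m (cur true n v)]cur_comm.
rewrite !scalerDr addrACA; congr (_ + _); rewrite !scalerA -scalerDl chgx.
by congr (_ *: _); case: eqP => _; ring.
Qed.

Definition em_arg (n : nat) v : V := if n == 0%N then 0 else n%:R^-1 *: xcur (- n%:Z) v.
Definition ep_arg (n : nat) v : V := if n == 0%N then 0 else - (n%:R^-1 *: xcur n%:Z v).

Lemma em_arg_lin n : lin (em_arg n).
Proof.
by rewrite /em_arg; case: eqP => _; [exact: lin_zero|exact/lin_scale/xcur_lin].
Qed.
Lemma ep_arg_lin n : lin (ep_arg n).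
Proof.
rewrite /ep_arg; case: eqP => _; first exact: lin_zero.
by move=> a u v; rewrite xcur_lin scalerDr opprD scalerN !scalerA mulrC.
Qed.
Lemma em_arg0 v : em_arg 0 v = 0. Proof. by []. Qed.
Lemma ep_arg0 v : ep_arg 0 v = 0. Proof. by []. Qed.

Definition em := sexp em_arg.
Definition ep := sexp ep_arg.

Lemma em_lin n : lin (em n). Proof. exact: sexp_lin em_arg_lin n. Qed.
Lemma ep_lin n : lin (ep n). Proof. exact: sexp_lin ep_arg_lin n. Qed.
Lemma em0 v : em 0 v = v. Proof. exact: sexp0. Qed.
Lemma ep0 v : ep 0 v = v. Proof. exact: sexp0. Qed.

(** The sign [s] is 1 for creation series and - 1 for annihilation series. *)
Lemma sexp_homog (A : nat -> V -> V) (s : int) : (forall n, lin (A n)) ->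
  (forall n y d v, homog y d v -> homog y (d + s * n%:Z) (A n v)) ->
  forall n y d v, homog y d v -> homog y (d + s * n%:Z) (sexp A n v).
Proof.
move=> lA hA n y d v hv; apply: (sub_sum (homog_sub _ _)) => j _.
apply: (subZ (homog_sub _ _)).
move: (nat_of_ord j) => {}j; elim: j n => [|j IH] n /=.
  by case: eqP => [->|_]; [rewrite mulr0 addr0|exact: (sub0 (homog_sub _ _))].
apply: (sub_sum (homog_sub _ _)) => i _.
have := hA i _ _ _ (IH (n - i)%N).
by congr (homog _ _ _); have := ltn_ord i; rewrite ltnS => i_n; rewrite -addrA -mulrDr -PoszD subnK.
Qed.

Lemma em_homog n y d v : homog y d v -> homog y (d + n%:Z) (em n v).
Proof.
rewrite -[Posz n]mul1r; apply: sexp_homog => [|k z e u hu]; first exact: em_arg_lin.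
rewrite /em_arg mul1r; case: eqP => _; first exact: (sub0 (homog_sub _ _)).
apply: (subZ (homog_sub _ _)); have := xcur_homog (- k%:Z) hu.
by rewrite opprK.
Qed.

Lemma ep_homog n y d v : homog y d v -> homog y (d - n%:Z) (ep n v).
Proof.
rewrite -mulN1r; apply: sexp_homog => [|k z e u hu]; first exact: ep_arg_lin.
rewrite /ep_arg mulN1r; case: eqP => _; first exact: (sub0 (homog_sub _ _)).
by rewrite -scaleNr; apply: (subZ (homog_sub _ _)); apply: xcur_homog.
Qed.

Lemma ep_bound v : exists K : nat, forall n, (K < n)%N -> ep n v = 0.
Proof.
pose P v := exists K : nat, forall n, (K < n)%N -> ep n v = 0.
apply: (@homog_span _ _ P) => [|y d u hu].
  split; first by exists 0%N => n _; apply: (lin0 (ep_lin n)).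
  move=> a u1 u2 [K1 H1] [K2 H2]; exists (maxn K1 K2) => n nK.
  by rewrite ep_lin H1 ?H2 ?scaler0 ?addr0 //; lia.
by exists `|d|%N => n nd; apply: (homog_lt0 (ep_homog n hu)); lia.
Qed.

Definition emz (j : int) v : V := if j is Posz n then em n v else 0.

Lemma emz_lin j : lin (emz j).
Proof. by case: j => n; [exact: em_lin|exact: lin_zero]. Qed.

Lemma emz_lt0 j v : j < 0 -> emz j v = 0. Proof. by case: j. Qed.

Lemma emz_homog j y d v : homog y d v -> homog y (d + j) (emz j v).
Proof.
case: j => n hv; [exact: em_homog|exact: (sub0 (homog_sub _ _))].
Qed.

Lemma em_cur c (k : int) n v : cur c k (em n v) = em n (cur c k v) +
  (if 0 < k then chg c x *: emz (n%:Z - k) v else 0).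
Proof.
case: k => [[|k]|k] /=.
- rewrite addr0; apply: (sexp_commuting em_arg_lin em_arg0) => [|i u]; first exact: cur_lin.
  rewrite /em_arg; case: eqP => i0; first exact: (lin0 (cur_lin _ _)).
  rewrite (linZ (cur_lin _ _)) cur_xcur add0r oppr_eq0 (_ : (i%:Z == 0) = false) ?scale0r ?addr0 //.
  by case: i i0.
- have Dcomm i u : cur c k.+1 (em_arg i u) = em_arg i (cur c k.+1 u) +
    (if i == k.+1 then chg c x else 0) *: u.
    rewrite /em_arg; case: (eqVneq i 0%N) => [->|i0] /=.
      by rewrite (lin0 (cur_lin _ _)) scale0r addr0.
    rewrite (linZ (cur_lin _ _)) cur_xcur subr_eq0 eqz_nat eq_sym scalerDr; congr (_ + _).
    case: (eqVneq i k.+1) => [->|_]; last by rewrite !scale0r scaler0.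
    by rewrite scalerA mulrA mulVf ?mul1r // pnatr_eq0.
  rewrite /em (sexp_comm em_arg_lin em_arg0 (cur_lin _ _) _ Dcomm) //; congr (_ + _).
  case: (ltnP k n) => kn; last by rewrite /emz (_ : n%:Z - k.+1%:Z = Negz (k - n)%N) ?scaler0 //; lia.
  by rewrite subzn.
- rewrite addr0; apply: (sexp_commuting em_arg_lin em_arg0) => [|i u]; first exact: cur_lin.
  rewrite /em_arg; case: eqP => i0; first exact: (lin0 (cur_lin _ _)).
  rewrite (linZ (cur_lin _ _)) cur_xcur (_ : (_ + _ == 0) = false) ?scale0r ?addr0 //.
  by apply/eqP; lia.
Qed.

Lemma emz_cur c (k : int) j v : cur c k (emz j v) = emz j (cur c k v) +
  (if 0 < k then chg c x *: emz (j - k) v else 0).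
Proof.
case: j => [n|n] /=; first exact: em_cur.
rewrite (lin0 (cur_lin _ _)) add0r; case: ltP => // k0.
by rewrite /emz (_ : Negz n - k = Negz (n + `|k|)) ?scaler0 //; lia.
Qed.

Lemma ep_cur c (k : int) n v : cur c k (ep n v) = ep n (cur c k v) +
  (if (k < 0) && (`|k| <= n)%N then chg c x *: ep (n - `|k|)%N v else 0).
Proof.
case: (ltP k 0) => k0 /=.
  have [m kE m0] : exists2 m : nat, k = - m%:Z & (0 < m)%N by exists `|k|%N; lia.
  have Dcomm i u : cur c k (ep_arg i u) = ep_arg i (cur c k u) +
    (if i == m then chg c x else 0) *: u.
    rewrite /ep_arg; case: (eqVneq i 0%N) => [->|i0] /=.
      by rewrite (lin0 (cur_lin _ _)) (ltn_eqF m0) scale0r addr0.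
    rewrite -scaleN1r scalerA (linZ (cur_lin _ _)) cur_xcur scalerDr -scalerA scaleN1r.
    congr (_ + _); rewrite kE addrC subr_eq0 eqz_nat.
    case: (eqVneq i m) => [->|_]; last by rewrite !scale0r scaler0.
    rewrite scalerA mulrA mulN1r mulrNz mulrNN mulVf ?mul1r // pnatr_eq0; lia.
  rewrite /ep (sexp_comm ep_arg_lin ep_arg0 (cur_lin _ _) _ Dcomm) //; congr (_ + _).
  by rewrite kE abszN absz_nat.
rewrite addr0; apply: (sexp_commuting ep_arg_lin ep_arg0) => [|i u]; first exact: cur_lin.
rewrite /ep_arg; case: eqP => i0; first exact: (lin0 (cur_lin _ _)).
rewrite -scaleN1r scalerA (linZ (cur_lin _ _)) cur_xcur (_ : (_ + _ == 0) = false).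
  by rewrite scale0r addr0 -scalerA scaleN1r.
by apply/eqP; lia.
Qed.

End Vertex.

(* The coefficient of [z^(j + <x,y>)] in [Y(e^x, z)] on the charge [y].  Indexed
   by the degree shift [j], it no longer depends on [y]. *)
Definition vx_def x p q (j : int) v : V :=
  \sum_(i \in [set: nat]) emz p q (j + i%:Z) (ep p q i (shf x v)).

End Fields.

(* Locked, so that unification does not unfold vertex operators. *)
Fact vx_key : unit. Proof. exact: tt. Qed.
Definition vx {F V} := locked_with vx_key (@vx_def F V).
Lemma vx_unlock F V : @vx F V = @vx_def F V. Proof. exact: locked_withE. Qed.

Section VertexTheory.
Variables (F : numFieldType) (V : heis_space F).
Implicit Types (v u w : V) (y z : hs_lat V) (c : bool).
Variables (x : hs_lat V) (p q : F).
Hypothesis chgx : forall c, chg c x = p * osc_form F c false + q * osc_form F c true.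
Local Notation emz := (emz (V := V) p q).
Local Notation ep := (ep (V := V) p q).
Local Notation vx := (vx x p q).

Lemma vxE j v K : (forall i, (K <= i)%N -> ep i (shf x v) = 0) ->
  vx j v = \sum_(i < K) emz (j + i%:Z) (ep i (shf x v)).
Proof.
move=> vK; rewrite vx_unlock; apply: fsum_ord => k /vK ->; apply: (lin0 (emz_lin _ _ _)).
Qed.

(** The cutoff can be enlarged freely, so that several vertex operators are compared through sums of
    the same length. *)
Lemma vx_ev j v : exists K0, forall K, (K0 <= K)%N ->
  vx j v = \sum_(i < K) emz (j + i%:Z) (ep i (shf x v)).
Proof.
have [K HK] := ep_bound p q (shf x v); exists K.+1 => K' KK; apply: vxE => i iK.
by apply: HK; lia.
Qed.

Lemma vx_lin j : lin (vx j).
Proof.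
move=> a u v; have [K1 E1] := vx_ev j u; have [K2 E2] := vx_ev j v.
have [K3 E3] := vx_ev j (a *: u + v); pose K := (K1 + K2 + K3)%N.
rewrite (E1 K) ?(E2 K) ?(E3 K) /K; try lia; rewrite scaler_sumr -big_split.
by apply: eq_bigr => i _ /=; rewrite shf_lin ep_lin emz_lin.
Qed.

Lemma vx_homog j y d v : homog y d v -> homog (x + y) (d + j) (vx j v).
Proof.
move=> hv; have [K E] := vx_ev j v; rewrite (E K) //.
apply: (sub_sum (homog_sub _ _)) => i _.
have := emz_homog p q (j + i%:Z) (ep_homog p q i (shf_homog x hv)).
by congr (homog _ _ _); lia.
Qed.

Lemma vx_graded : graded x vx.
Proof. split; [exact: vx_lin|exact: vx_homog]. Qed.

(** This is [c(k), Y(e^x, z)] = <c,x> z^k Y(e^x, z). The right side comes from the annihilation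
    exponential for k < 0, from e^x itself for k = 0, and from the creation exponential for k >
    0. *)
Lemma vx_cur c k j v :
  cur c k (vx j v) = vx j (cur c k v) + chg c x *: vx (j - k) v.
Proof.
have [K1 E1] := vx_ev j v; have [K2 E2] := vx_ev j (cur c k v).
have [K3 E3] := vx_ev (j - k) v; have [K4 H4] := ep_bound p q (shf x v).
pose K := (K1 + K2 + K3 + K4 + `|k|).+1%N.
rewrite (E1 K) ?(E2 K); try (by rewrite /K; lia); rewrite (lin_sum (cur_lin c k)).
have step (i : nat) : cur c k (emz (j + i%:Z) (ep i (shf x v))) =
    emz (j + i%:Z) (ep i (shf x (cur c k v))) +
    ((if k == 0 then chg c x else 0) *: emz (j + i%:Z) (ep i (shf x v)) +
    ((if (k < 0) && (`|k| <= i)%N then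
        chg c x *: emz (j + i%:Z) (ep (i - `|k|)%N (shf x v)) else 0) +
     (if 0 < k then chg c x *: emz (j + i%:Z - k) (ep i (shf x v)) else 0))).
  rewrite (emz_cur chgx) (ep_cur chgx) cur_shf (linD (emz_lin _ _ _)) (linD (ep_lin _ _ _)) (linD (emz_lin _ _ _)).
  rewrite (linZ (ep_lin _ _ _)) (linZ (emz_lin _ _ _)) -!addrA; congr (_ + (_ + (_ + _))).
  by case: ifP => _; rewrite ?(linZ (emz_lin _ _ _)) ?(lin0 (emz_lin _ _ _)).
rewrite (eq_bigr _ (fun (i : 'I_K) _ => step i)) big_split /=; congr (_ + _).
rewrite !big_split /=; case: (ltgtP k 0) => k0 /=.
- rewrite [X in X + _]big1 ?add0r => [|i _]; last by rewrite scale0r.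
  rewrite [X in _ + X]big1 ?addr0 // (E3 (K - `|k|)%N); last by rewrite /K; lia.
  rewrite scaler_sumr.
  (* The terms with [i < |k|] are absent; shifting the index by [|k|] yields the sum for degree
     [j - k], with a cutoff shorter by [|k|]. *)
  pose G (i : nat) := if (`|k| <= i)%N then
    chg c x *: emz (j + i%:Z) (ep (i - `|k|)%N (shf x v)) else 0.
  rewrite -(big_mkord predT G) (big_cat_nat _ (n := `|k|%N)) //=; last by rewrite /K; lia.
  rewrite big_nat big1 ?add0r => [|i /andP[_ ik]]; last by rewrite /G leqNgt ik.
  rewrite -[in X in \sum_(X <= _ < _) _](add0n `|k|%N) big_addn big_mkord.
  apply: eq_bigr => i _; rewrite /G leq_addl addnK; congr (_ *: emz _ _); lia.
- rewrite [X in X + _]big1 ?add0r => [|i _]; last by rewrite scale0r.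
  rewrite [X in X + _]big1 ?add0r // (E3 K); last by rewrite /K; lia.
  by rewrite scaler_sumr; apply: eq_bigr => i _; congr (_ *: emz _ _); lia.
- rewrite [X in _ + (X + _)]big1 // [X in _ + (_ + X)]big1 // !addr0 -scaler_sumr k0 subr0.
  by rewrite (E1 K) // /K; lia.
Qed.

Lemma vx_vac j y : vx j (vac y) = emz j (vac (x + y)).
Proof.
rewrite (@vxE _ _ 1%N) ?big_ord1 ?ep0 ?addr0 ?shf_vac // => i i0.
by apply: (homog_lt0 (ep_homog p q i (homog_vac _))); lia.
Qed.

Lemma vx0_vac y : vx 0 (vac y) = vac (x + y).
Proof. by rewrite vx_vac /= em0. Qed.
End VertexTheory.

(** * Normal ordered products with a current *)

Section NormalProductDef.
Variables (F : numFieldType) (V : heis_space F).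
Implicit Types (v u w : V) (x y z : hs_lat V) (c : bool).
Local Notation lat := (hs_lat V).

(* Two-parameter families with the commutation relations of a commutator of
   two fields vanish as soon as their degree zero parts kill the vacua. *)
Lemma two_param_zero x (X : int -> int -> V -> V) (c1 c2 : bool -> F) :
  (forall i j, lin (X i j)) ->
  (forall (i j : int) y d v, homog y d v -> homog (x + y) (d + (i + j)) (X i j v)) ->
  (forall c (k i j : int) v, k != 0 -> cur c k (X i j v) =
     X i j (cur c k v) + (c1 c *: X (i - k) j v + c2 c *: X i (j - k) v)) ->
  (forall i y, X i (- i) (vac y) = 0) ->
  forall i j v, X i j v = 0.
Proof.
move=> lX hX cX X0.
(* Induction on the degree i + j: a positive mode of a current lowers it, so by induction all of
   these modes kill the vector, which is then zero because its degree is not. *)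
have Xvac i j y : X i j (vac y) = 0.
  have [n] := ubnP (absz (i + j)); elim: n i j => // n IHn i j ijn.
  have hXv := hX i j _ _ _ (homog_vac y); rewrite add0r in hXv.
  have [lt0|ge0] := ltP (i + j) 0; first exact: homog_lt0 hXv lt0.
  have [ij0|ij0] := eqVneq (i + j) 0.
    by rewrite (_ : j = - i) ?X0 //; lia.
  apply: (homog_kernel hXv) => // c k.
  rewrite cX // cur_vac // (lin0 (lX _ _)) add0r.
  have small i' j' : i' + j' = i + j - k.+1%:Z -> X i' j' (vac y) = 0.
    move=> e; have [lt0'|ge0'] := ltP (i' + j') 0; last by apply: IHn; lia.
    by apply: homog_lt0 (hX i' j' _ _ _ (homog_vac y)) _; rewrite add0r.
  by rewrite !small ?scaler0 ?addr0 //; lia.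
move=> i j v; move: i j.
(* From vacua to all vectors: commuting with a creation operator only produces members of the family
   applied to a vector already treated. *)
apply: (@vac_span _ _ [set v | forall i j, X i j v = 0]) => //= [|c k u IH i j].
  split=> [i j|a u w hu hw i j] /=; first exact: lin0.
  by rewrite lX hu hw scaler0 addr0.
apply/eqP; have := cX c (- k.+1%:Z) i j u isT.
rewrite !IH (lin0 (cur_lin _ _)) !scaler0 !addr0 => /esym/eqP.
by [].
Qed.

(* The degree [j] part of the normal ordered product of [sum_k w(k) c(k)] and [B]. *)
Definition np_def c (w : int -> F) (B : int -> V -> V) (j : int) v : V :=
  \sum_(k \in [set: nat]) w (- k.+1%:Z) *: cur c (- k.+1%:Z) (B (j - k.+1%:Z) v) +
  \sum_(k \in [set: nat]) w k%:Z *: B (j + k%:Z) (cur c k%:Z v).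

End NormalProductDef.

Fact np_key : unit. Proof. exact: tt. Qed.
Definition np {F V} := locked_with np_key (@np_def F V).
Lemma np_unlock F V : @np F V = @np_def F V. Proof. exact: locked_withE. Qed.

Section NP.
Variables (F : numFieldType) (V : heis_space F).
Implicit Types (v u : V) (x y z : hs_lat V).
Variables (c : bool) (w : int -> F).
Local Notation np := (np c w).

Definition np_trunc B j v K : V :=
  \sum_(k < K) w (- k.+1%:Z) *: cur c (- k.+1%:Z) (B (j - k.+1%:Z) v) +
  \sum_(k < K) w k%:Z *: B (j + k%:Z) (cur c k%:Z v).

Lemma npE (B : int -> V -> V) j v K : (forall n, lin (B n)) ->
  (forall k : nat, (K <= k)%N -> B (j - k.+1%:Z) v = 0) ->
  (forall k : nat, (K <= k)%N -> cur c k%:Z v = 0) ->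
  np B j v = np_trunc B j v K.
Proof.
move=> lB BK cK; rewrite np_unlock /np_def /np_trunc !(@fsum_ord _ _ K) // => k kK.
  by rewrite cK // (lin0 (lB _)) scaler0.
by rewrite BK // (lin0 (cur_lin _ _)) scaler0.
Qed.

Lemma np_ev x B j v : graded x B ->
  exists K0, forall K, (K0 <= K)%N -> np B j v = np_trunc B j v K.
Proof.
move=> gB; have [K1 H1] := graded_bound v gB; have [K2 H2] := cur_bound v.
exists (K1 + K2 + `|j|).+1 => K KK; apply: npE => [|k kK|k kK].
- by move=> n; apply: graded_lin gB.
- by apply: H1; lia.
- by apply: H2; lia.
Qed.

Lemma np_trunc_lin x B j K : graded x B -> lin (np_trunc B j ^~ K).
Proof.
move=> gB a u v; rewrite /np_trunc scalerDr addrACA.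
congr (_ + _); rewrite scaler_sumr -big_split; apply: eq_bigr => k _ /=.
  by rewrite (graded_lin _ gB) cur_lin scalerDr !scalerA mulrC.
by rewrite cur_lin (graded_lin _ gB) scalerDr !scalerA mulrC.
Qed.

Lemma np_lin x B j : graded x B -> lin (np B j).
Proof.
move=> gB a u v; have [K1 E1] := np_ev j u gB; have [K2 E2] := np_ev j v gB.
have [K3 E3] := np_ev j (a *: u + v) gB; pose K := (K1 + K2 + K3)%N.
by rewrite (E1 K) ?(E2 K) ?(E3 K) /K; try lia; apply: np_trunc_lin gB _ _ _.
Qed.

Lemma np_graded x B : graded x B -> graded x (np B).
Proof.
move=> gB; split=> [j|j y d v hv]; first exact: np_lin gB.
have [K E] := np_ev j v gB; rewrite (E K) //.
have sxy := homog_sub (x + y) (d + j); apply: (subD sxy); apply: (sub_sum sxy) => k _;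
  apply: (subZ sxy).
- have := cur_homog c (- k.+1%:Z) (graded_homog (j - k.+1%:Z) gB hv).
  by congr (homog _ _ _); lia.
- have := graded_homog (j + k%:Z) gB (cur_homog c k%:Z hv).
  by congr (homog _ _ _); lia.
Qed.

Lemma np_linear x x' B B' a b j v : graded x B -> graded x' B' ->
  np (fun j v => a *: B j v + b *: B' j v) j v = a *: np B j v + b *: np B' j v.
Proof.
move=> gB gB'; have [K1 H1] := graded_bound v gB; have [K2 H2] := cur_bound v.
have [K3 H3] := graded_bound v gB'.
pose K := (K1 + K2 + K3 + `|j|).+1.
have cK (k : nat) : (K <= k)%N -> cur c k%:Z v = 0 by move=> kK; apply: H2; lia.
have BK (k : nat) : (K <= k)%N -> B (j - k.+1%:Z) v = 0 by move=> kK; apply: H1; lia.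
have B'K (k : nat) : (K <= k)%N -> B' (j - k.+1%:Z) v = 0 by move=> kK; apply: H3; lia.
rewrite (npE (fun n => graded_lin n gB) BK cK) (npE (fun n => graded_lin n gB') B'K cK).
rewrite (@npE _ _ _ K) //; first last.
- by move=> k kK; rewrite BK ?B'K ?scaler0 ?addr0.
- by move=> n; apply: lin_add; apply: lin_scale; [apply: graded_lin gB|apply: graded_lin gB'].
rewrite /np_trunc !scalerDr addrACA.
congr (_ + _); rewrite !scaler_sumr -big_split; apply: eq_bigr => k _ /=.
  rewrite (linD (cur_lin _ _)) !(linZ (cur_lin _ _)) scalerDr !scalerA.
  by rewrite ![w _ * _]mulrC.
by rewrite scalerDr !scalerA ![w _ * _]mulrC.
Qed.

(** [C] is the commutator of the current with [B]. The last term is the contraction of the two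
    currents, picked up by the creation half when k > 0 and by the annihilation half when k < 0. *)
Lemma np_cur x x' B C c' k j v : graded x B -> graded x' C ->
  (forall j v, cur c' k (B j v) = B j (cur c' k v) + C (j - k) v) ->
  cur c' k (np B j v) = np B j (cur c' k v) +
    (np C (j - k) v + (k%:~R * osc_form F c' c * w (- k)) *: B (j - k) v).
Proof.
move=> gB gC BC.
have [K1 E1] := np_ev j v gB; have [K2 E2] := np_ev j (cur c' k v) gB.
have [K3 E3] := np_ev (j - k) v gC.
pose K := (K1 + K2 + K3 + `|k|).+1%N.
rewrite (E1 K) ?(E2 K) ?(E3 K) /K; try lia; rewrite -/K /np_trunc.
rewrite (linD (cur_lin _ _)) !(lin_sum (cur_lin _ _)).
have step1 (n : nat) :
    cur c' k (w (- n.+1%:Z) *: cur c (- n.+1%:Z) (B (j - n.+1%:Z) v)) =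
    w (- n.+1%:Z) *: cur c (- n.+1%:Z) (B (j - n.+1%:Z) (cur c' k v)) +
    (w (- n.+1%:Z) *: cur c (- n.+1%:Z) (C (j - k - n.+1%:Z) v) +
     (if k == n.+1%:Z then (k%:~R * osc_form F c' c * w (- k)) else 0) *: B (j - k) v).
  rewrite (linZ (cur_lin _ _)) cur_comm BC (linD (cur_lin _ _)) !scalerDr -!addrA.
  congr (_ + (_ + _)); first by congr (_ *: cur _ _ (C _ _)); lia.
  rewrite subr_eq0; case: eqP => [->|_]; last by rewrite !scale0r scaler0.
  by rewrite scalerA mulrC.
have step2 (n : nat) :
    cur c' k (w n%:Z *: B (j + n%:Z) (cur c n%:Z v)) =
    w n%:Z *: B (j + n%:Z) (cur c n%:Z (cur c' k v)) +
    (w n%:Z *: C (j - k + n%:Z) (cur c n%:Z v) +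
     (if k == - n%:Z then (k%:~R * osc_form F c' c * w (- k)) else 0) *: B (j - k) v).
  rewrite (linZ (cur_lin _ _)) BC cur_comm (linD (graded_lin _ gB)).
  rewrite (linZ (graded_lin _ gB)) !scalerDr -!addrA; congr (_ + _); rewrite addrC.
  congr (_ + _); first by congr (_ *: C _ _); lia.
  rewrite addr_eq0; case: eqP => [->|_]; last by rewrite !scale0r scaler0.
  by rewrite opprK scalerA mulrC.
rewrite (eq_bigr _ (fun (n : 'I_K) _ => step1 n)) big_split /=.
rewrite [X in _ + X](eq_bigr _ (fun (n : 'I_K) _ => step2 n)) [X in _ + X]big_split /=.
rewrite !big_split /= addrACA; congr (_ + _); rewrite addrACA; congr (_ + _).
rewrite -!scaler_suml -scalerDl; congr (_ *: _).
case: (ltgtP k 0) => k0.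
- rewrite big1 ?add0r => [|i _]; last by rewrite ifF //; apply/eqP; lia.
  have kK : (`|k| < K)%N by rewrite /K; lia.
  rewrite (bigD1 (Ordinal kK)) //= ifT ?big1 ?addr0 //; last by apply/eqP; lia.
  by move=> i; rewrite -val_eqE /= => ik; rewrite ifF //; apply/eqP; move/eqP: ik; lia.
- rewrite [X in _ + X]big1 ?addr0 => [|i _]; last by rewrite ifF //; apply/eqP; lia.
  have kK : (`|k|.-1 < K)%N by rewrite /K; lia.
  rewrite (bigD1 (Ordinal kK)) //= ifT ?big1 ?addr0 //; last by apply/eqP; lia.
  by move=> i; rewrite -val_eqE /= => ik; rewrite ifF //; apply/eqP; move/eqP: ik; lia.
- by rewrite !k0 !mul0r !big1 ?addr0 // => i _; rewrite if_same.
Qed.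

(** In total degree zero the creation half would act on vectors of negative degree, so only
    annihilation modes remain. In the mirror statement [np_vac] the annihilation half retains only
    its zero mode. *)
Lemma np_lower x B (i : nat) y u : graded x B -> homog y i%:Z u ->
  np B (- i%:Z) u = \sum_(k < i.+1) w k%:Z *: B (k%:Z - i%:Z) (cur c k%:Z u).
Proof.
move=> gB hu; rewrite (@npE _ _ _ i.+1) => [|n|k ik|k ik].
- rewrite /np_trunc big1 ?add0r => [|k _].
    by apply: eq_bigr => k _; rewrite addrC.
  by rewrite (graded_lt0 gB hu) ?(lin0 (cur_lin _ _)) ?scaler0 //; lia.
- exact: graded_lin gB.
- by apply: (graded_lt0 gB hu); lia.
- by apply: (homog_lt0 (cur_homog c k%:Z hu)); lia.
Qed.

Lemma np_vac x B (i : nat) y : graded x B -> np B i%:Z (vac y) =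
  \sum_(k < i) w (- k.+1%:Z) *: cur c (- k.+1%:Z) (B (i%:Z - k.+1%:Z) (vac y)) +
  (w 0 * chg c y) *: B i%:Z (vac y).
Proof.
move=> gB; rewrite (@npE _ _ _ i.+1) => [|n|k ik|k ik].
- rewrite /np_trunc big_ord_recr /= (graded_vac_lt0 _ gB) ?(lin0 (cur_lin _ _)); last by lia.
  rewrite scaler0 addr0; congr (_ + _).
  rewrite big_ord_recl big1 /= => [|k _].
    by rewrite !addr0 cur0_vac (linZ (graded_lin _ gB)) scalerA.
  by rewrite cur_vac // (lin0 (graded_lin _ gB)) scaler0.
- exact: graded_lin gB.
- by apply: (graded_vac_lt0 _ gB); lia.
- by apply: cur_vac; lia.
Qed.

End NP.

(** * Recovering the currents from the modes of e^x *)

Section Span.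
Variables (F : numFieldType) (V : heis_space F).
Implicit Types (v u w : V) (y z : hs_lat V).
Variables (x : hs_lat V) (p q : F).
Hypothesis chgx : forall c, chg c x = p * osc_form F c false + q * osc_form F c true.
Local Notation X := (xcur (V := V) p q).
Local Notation E := (vx x p q).

Lemma xcur_shf n y v : n != 0 -> X n (shf y v) = shf y (X n v).
Proof.
move=> n0; rewrite /xcur !cur_shf (negPf n0) !scale0r !addr0.
by rewrite (linD (shf_lin y)) !(linZ (shf_lin y)).
Qed.

Lemma em_shf n y v : shf y (em p q n v) = em p q n (shf y v).
Proof.
apply: (sexp_commuting (em_arg_lin p q) (fun u => erefl) (shf_lin y)) => i u.
rewrite /em_arg; case: eqP => i0; first exact: (lin0 (shf_lin y)).
by rewrite (linZ (shf_lin y)) xcur_shf //; lia.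
Qed.

Lemma xcurC m n v : m + n != 0 -> X m (X n v) = X n (X m v).
Proof.
move=> mn; rewrite {1}/xcur !(cur_xcur chgx) (negPf mn) !scale0r !addr0.
by rewrite [X m v]/xcur xcur_lin (linZ (xcur_lin _ _ _)).
Qed.

Lemma em_argC i j v : em_arg p q i (em_arg p q j v) = em_arg p q j (em_arg p q i v).
Proof.
rewrite /em_arg; case: (eqVneq i 0%N) => [_|i0]; case: (eqVneq j 0%N) => [_|j0] //;
  rewrite ?(lin0 (xcur_lin _ _ _)) ?scaler0 //.
rewrite !(linZ (xcur_lin _ _ _)) xcurC; last by lia.
by rewrite !scalerA mulrC.
Qed.

Lemma ep_argC i j v : ep_arg p q i (ep_arg p q j v) = ep_arg p q j (ep_arg p q i v).
Proof.
rewrite /ep_arg; case: (eqVneq i 0%N) => [_|i0]; case: (eqVneq j 0%N) => [_|j0] //;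
  rewrite ?(lin0 (xcur_lin _ _ _)) ?scaler0 ?oppr0 //.
rewrite !(linN (xcur_lin _ _ _)) !(linZ (xcur_lin _ _ _)) xcurC; last by lia.
by rewrite !scalerN !scalerA mulrC.
Qed.

(** [E (- i.+1)] applied to [v] is [ep] of index [i.+1] on e^x v plus images of [ep] of higher
    index, so descending induction kills every [ep] of positive index. Newton's identity then
    reduces to x(n) e^x v = 0, and x(n) commutes with e^x for n nonzero. *)
Lemma vx_descent v : (forall i : nat, E (- i.+1%:Z) v = 0) ->
  forall n : nat, X n.+1 v = 0.
Proof.
move=> Ev; have [K HK] := ep_bound p q (shf x v).
(* [m] bounds how far [i] may lie below the index [K] beyond which [ep] vanishes. *)
have epv m i : (0 < i)%N -> (K < i + m)%N -> ep p q i (shf x v) = 0.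
  elim: m i => [|m IHm] [//|i] _ im; first by apply: HK; rewrite addn0 in im.
  have := Ev i; have [K0 E0] := vx_ev x p q (- i.+1%:Z) v.
  rewrite (E0 (K0 + i.+2)%N) ?leq_addr //.
  have ik : (i.+1 < K0 + i.+2)%N by lia.
  rewrite (bigD1 (Ordinal ik)) //= addNr /= em0 big1 ?addr0 // => k.
  rewrite -val_eqE /= => ki; have [lt|ge] := ltnP k i.+1.
    by rewrite emz_lt0 //; lia.
  by rewrite IHm ?(lin0 (emz_lin _ _ _)) //; lia.
move=> n.
have := sexp_newton (ep_arg_lin p q) (fun u => erefl) ep_argC n.+1 (shf x v).
rewrite -[sexp _ n.+1 _]/(ep p q n.+1 (shf x v)) (epv K.+1) //; last by lia.
rewrite scaler0 big_ord_recr /= subnn big1 ?add0r => [|i _]; last first.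
  have := ltn_ord i; rewrite -[sexp _ _ _]/(ep p q (n.+1 - i) (shf x v)) => i_n.
  by rewrite (epv K.+1) ?(lin0 (ep_arg_lin _ _ _)) ?scaler0 //; lia.
rewrite sexp0 /ep_arg /= => /esym/eqP.
rewrite scaler_eq0 pnatr_eq0 oppr_eq0 scaler_eq0 invr_eq0 pnatr_eq0 /= => /eqP.
rewrite xcur_shf // => /(congr1 (shf (- x))).
by rewrite (lin0 (shf_lin _)) shfD addNr shf0.
Qed.

Hypothesis isox : p * chg false x + q * chg true x = 0.
Hypothesis p0 : p != 0.

Lemma xcur_em (n : int) m v : X n (em p q m v) = em p q m (X n v).
Proof.
rewrite {1}/xcur !(em_cur chgx) !scalerDr addrACA.
rewrite [in RHS]/xcur em_lin (linZ (em_lin _ _ _)).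
case: ifP => _; last by rewrite !scaler0 !addr0.
by rewrite !scalerA -scalerDl isox scale0r addr0.
Qed.

(** Isotropy of x makes all [ep] of positive index vanish on this span; there a mode of e^x is just
    the creation part [em] after e^x. *)
Inductive em_span : set V :=
  | em_span_vac y : em_span (vac y)
  | em_span_zero : em_span 0
  | em_span_lin (a : F) u w : em_span u -> em_span w -> em_span (a *: u + w)
  | em_span_em n u : em_span u -> em_span (em p q n u).

Lemma em_span_sub : subspace em_span.
Proof. by split; [exact: em_span_zero|exact: em_span_lin]. Qed.

Lemma em_span_xcur u : em_span u -> forall n : nat, X n.+1 u = 0.
Proof.
elim=> [y||a v w _ Hv _ Hw|m v _ Hv] n.
- by rewrite /xcur !cur_vac // !scaler0 addr0.
- exact: (lin0 (xcur_lin _ _ _)).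
- by rewrite xcur_lin Hv Hw scaler0 addr0.
- by rewrite xcur_em Hv (lin0 (em_lin _ _ _)).
Qed.

Lemma em_span_shf y u : em_span u -> em_span (shf y u).
Proof.
elim=> [z||a v w _ Hv _ Hw|m v _ Hv].
- by rewrite shf_vac; apply: em_span_vac.
- by rewrite (lin0 (shf_lin _)); apply: em_span_zero.
- by rewrite shf_lin; apply: em_span_lin.
- by rewrite em_shf; apply: em_span_em.
Qed.

Lemma em_span_ep u n : em_span u -> (0 < n)%N -> ep p q n u = 0.
Proof.
move=> su; apply: (sexp_unit (ep_arg_lin p q)) => [|[|k]] //; last first.
  by rewrite /ep_arg /= em_span_xcur // scaler0 oppr0.
exact: ep_argC.
Qed.

Lemma em_span_vx n u : em_span u -> em p q n (shf x u) = E n%:Z u.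
Proof.
move=> su; rewrite (@vxE _ _ _ _ _ _ _ 1%N) ?big_ord1 ?addr0 ?ep0 // => i i0.
by apply: em_span_ep => //; apply: em_span_shf.
Qed.

(** Newton's identity, solved for its top term, expresses x(-n-1) through [em] and the earlier
    creation modes of x. *)
Lemma em_span_creation u n : em_span u -> em_span (X (- n.+1%:Z) u).
Proof.
have [m] := ubnP n; elim: m n u => // m IHm n u nm su.
have sS := em_span_sub.
have := sexp_newton (em_arg_lin p q) (fun u => erefl) em_argC n.+1 u.
rewrite big_ord_recr /= subnn sexp0 {2}/em_arg /= scalerA divff ?pnatr_eq0 // scale1r.
set S := \sum_(i < n.+1) _ => E0.
have -> : X (- n.+1%:Z) u = n.+1%:R *: em p q n.+1 u - S.
  by rewrite /em E0 [S + _]addrC addrK.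
apply: (subB sS); first by apply: (subZ sS); apply: em_span_em.
apply: (sub_sum sS) => -[[|i] /= i_n] _; first by rewrite scale0r; apply: em_span_zero.
apply: (subZ sS); rewrite /em_arg /=; apply: (subZ sS); apply: IHm; first by lia.
exact: em_span_em.
Qed.

(** Up to a shift of charge, [em] is a mode of e^x on [em_span]; it yields the x(-k), and gamma(-k)
    is a combination of x(-k) and delta(-k). So modes of e^x and creation operators of delta suffice
    to reach everything from vacua, which replaces the induction over both currents for [f,f]. *)
Lemma vx_span (Z : set V) : subspace Z -> (forall y, Z (vac y)) ->
  (forall (k : nat) v, Z v -> Z (cur true (- k.+1%:Z) v)) ->
  (forall j v, Z v -> Z (E j v)) -> forall v, Z v.
Proof.
move=> sZ Zvac Zd ZE.
have em_Z u : em_span u -> forall y, Z (shf y u).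
  elim=> [z||a v w _ Hv _ Hw|m v sv Hv] y.
  - by rewrite shf_vac.
  - by rewrite (lin0 (shf_lin _)); apply: (sub0 sZ).
  - by rewrite shf_lin; apply: (subP sZ).
  - rewrite em_shf -[y](subrK x) addrC -shfD em_span_vx; first exact: ZE.
    exact: em_span_shf.
(* The smallest subspace containing [em_span] and stable under the delta(-k), given as an
   intersection so that stability under x(-k) can be tested on generators. *)
pose W v := forall P : set V, subspace P -> (forall u, em_span u -> P u) ->
  (forall (k : nat) v, P v -> P (cur true (- k.+1%:Z) v)) -> P v.
suff all_W v : W v.
  by move=> v; apply: (all_W v Z) => // u /em_Z /(_ 0); rewrite shf0.
have sW : subspace W.
  split=> [P sP _ _|a u w Wu Ww P sP P1 P2]; first exact: (sub0 sP).
  by apply: (subP sP); [exact (Wu P sP P1 P2)|exact (Ww P sP P1 P2)].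
have Wd (k : nat) u : W u -> W (cur true (- k.+1%:Z) u).
  by move=> Wu P sP P1 P2; exact (P2 k u (Wu P sP P1 P2)).
have WX (k : nat) u : W u -> W (X (- k.+1%:Z) u).
  apply: (_ : subspace [set u | W (X (- k.+1%:Z) u)] -> _) => [sWX Wu|].
    apply: (Wu [set u | W (X (- k.+1%:Z) u)]) => // [w sw P _ P1 _|n w /= Ww].
      exact/P1/em_span_creation.
    rewrite -[X _ _](_ : cur true (- n.+1%:Z) (X (- k.+1%:Z) w) = _); first exact: Wd.
    by rewrite (cur_xcur chgx) (_ : (_ + _ == 0) = false) ?scale0r ?addr0 //; apply/eqP; lia.
  split=> /= [|a u1 u2 W1 W2]; first by rewrite (lin0 (xcur_lin _ _ _)); apply: (sub0 sW).
  by rewrite xcur_lin; apply: (subP sW).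
apply: (vac_span sW) => [y P _ P1 _|[] k u Wu].
- exact/P1/em_span_vac.
- exact: Wd.
have -> : cur false (- k.+1%:Z) u =
    p^-1 *: (X (- k.+1%:Z) u - q *: cur true (- k.+1%:Z) u).
  by rewrite /xcur addrK scalerA mulVf // scale1r.
by apply: (subZ sW); apply: (subB sW); [apply: WX|apply: (subZ sW); apply: Wd].
Qed.

End Span.

Lemma addr_comm3 (V : zmodType) (a b c a' b' c' : V) :
  a + b + c - (a' + b' + c') = (a - a') + ((b - b') + (c - c')).
Proof. by rewrite !opprD addrACA (addrACA a) -addrA. Qed.

(** * Vertex operators of orthogonal charges *)

Section VertexCommute.
Variables (F : numFieldType) (V : heis_space F).
Variables (x x' : hs_lat V) (p q p' q' : F).
Hypothesis chgx : forall c, chg c x = p * osc_form F c false + q * osc_form F c true.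
Hypothesis chgx' : forall c, chg c x' = p' * osc_form F c false + q' * osc_form F c true.
Hypothesis orth : p * chg false x' + q * chg true x' = 0.

Lemma xcur_ep (n : int) m (v : V) : xcur p q n (ep p' q' m v) = ep p' q' m (xcur p q n v).
Proof.
rewrite {1}/xcur !(ep_cur chgx') !scalerDr addrACA.
rewrite [in RHS]/xcur ep_lin (linZ (ep_lin _ _ _)).
case: ifP => _; last by rewrite !scaler0 !addr0.
by rewrite !scalerA -scalerDl orth scale0r addr0.
Qed.

Lemma ep_em m n (v : V) : ep p' q' m (em p q n v) = em p q n (ep p' q' m v).
Proof.
apply: (sexp_commuting (em_arg_lin p q) (fun u => erefl) (ep_lin p' q' m)) => i u.
rewrite /em_arg; case: eqP => _; first exact: (lin0 (ep_lin _ _ _)).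
by rewrite (linZ (ep_lin _ _ _)) xcur_ep.
Qed.

(** Orthogonality lets the annihilation exponential of x' pass the creation exponential of x and
    reach a vacuum. Only its index 0 term could survive, and that one meets a creation coefficient
    of negative index. *)
Lemma vx_vx_lower (i : nat) y : (0 < i)%N ->
  vx x' p' q' (- i%:Z) (vx x p q i%:Z (vac y)) = 0.
Proof.
move=> i0; have [K E] := vx_ev x' p' q' (- i%:Z) (vx x p q i%:Z (vac y)).
rewrite (E K) //; apply: big1 => -[[|k] /= _] _; first by rewrite emz_lt0 //; lia.
rewrite vx_vac /= em_shf // shf_vac ep_em -[k.+1]/(k.+1) (_ : ep _ _ _ _ = 0).
  by rewrite (lin0 (em_lin _ _ _)) (lin0 (emz_lin _ _ _)).
by apply: (homog_lt0 (ep_homog _ _ k.+1 (homog_vac _))); lia.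
Qed.
End VertexCommute.

(** For orthogonal charges the factor (z - w)^<x,x'> is 1, so both orders agree. On vacua one of the
    two products has a factor of negative degree acting first, and the other is [vx_vx_lower]. *)
Lemma vx_commute (F : numFieldType) (V : heis_space F) (x x' : hs_lat V) (p q p' q' : F) :
  (forall c, chg c x = p * osc_form F c false + q * osc_form F c true) ->
  (forall c, chg c x' = p' * osc_form F c false + q' * osc_form F c true) ->
  p * chg false x' + q * chg true x' = 0 ->
  forall i j v, vx x p q i (vx x' p' q' j v) = vx x' p' q' j (vx x p q i v).
Proof.
move=> chgx chgx' orth i j v; apply/eqP; rewrite -subr_eq0; apply/eqP; move: i j v.
have orth' : p' * chg false x + q' * chg true x = 0.
  by rewrite -orth !chgx !chgx' !osc_form_values; ring.
pose X i j (v : V) := vx x p q i (vx x' p' q' j v) - vx x' p' q' j (vx x p q i v).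
have gx := vx_graded x p q; have gx' := vx_graded x' p' q'.
apply: (@two_param_zero _ _ (x + x') X (chg ^~ x) (chg ^~ x')) => [i j|i j y d v hv|c k i j v _|i y].
- by apply: lin_sub; apply: lin_comp; apply: vx_lin.
- apply: (subB (homog_sub _ _)).
    have := vx_homog x p q i (vx_homog x' p' q' j hv).
    by congr (homog _ _ _); rewrite ?addrA // -!addrA [j + i]addrC.
  have := vx_homog x' p' q' j (vx_homog x p q i hv).
  by congr (homog _ _ _); rewrite -?addrA // addrCA.
- rewrite /X (linB (cur_lin _ _)) !(vx_cur chgx) !(vx_cur chgx').
  rewrite !(linD (vx_lin _ _ _ _)) !(linZ (vx_lin _ _ _ _)) ?(vx_cur chgx) ?(vx_cur chgx').
  rewrite ?(linD (vx_lin _ _ _ _)) ?(linZ (vx_lin _ _ _ _)) !scalerBr.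
  rewrite [X in _ - X]addrAC addr_comm3; congr (_ + _); exact: addrC.
- rewrite /X; case: i => [[|i]|i].
  + by rewrite oppr0 !vx0_vac addrCA subrr.
  + by rewrite (graded_vac_lt0 _ gx') // (lin0 (vx_lin _ _ _ _)) (vx_vx_lower x chgx' orth) // subr0.
  + rewrite NegzE opprK (graded_vac_lt0 _ gx) // (lin0 (vx_lin _ _ _ _)).
    by rewrite (vx_vx_lower x' chgx orth') // subr0.
Qed.

(** * Commutation relations of the fields of e and f *)

Section Fields.
Variables (F : numFieldType) (V : heis_space F) (x : hs_lat V).

(* The fields of [e^x], [e^-x], [gamma(-1) e^-x], [gamma(-1)^2 e^-x],
   [gamma(-2) e^-x] and [f]. *)
Definition fld_a := vx x 3 (- 3).
Definition fld_b := vx (- x) (- 3) 3.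
Definition fld_p := np false (fun=> 1) fld_b.
Definition fld_r := np false (fun=> 1) fld_p.
Definition fld_s := np false (fun k => - (k + 1)%:~R) fld_b.
Definition fld_f_def (j : int) (v : V) : V := - 4 *: fld_r j v + (2 / 3) *: fld_s j v.
End Fields.

Fact fld_key : unit. Proof. exact: tt. Qed.
Definition fld_f {F V} := locked_with fld_key (@fld_f_def F V).
Lemma fld_fE F V x j v :
  @fld_f F V x j v = - 4 *: fld_r x j v + (2 / 3) *: fld_s x j v.
Proof. by rewrite /fld_f locked_withE. Qed.

Section Relations.
Variables (F : numFieldType) (V : heis_space F) (x : hs_lat V).
Hypothesis chgx : forall c, chg c x = 1 / 2.
Local Notation a := (fld_a x).
Local Notation b := (fld_b x).
Local Notation p := (fld_p x).
Local Notation r := (fld_r x).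
Local Notation s := (fld_s x).
Local Notation f := (fld_f x).
Local Notation lat := (hs_lat V).
Implicit Types (v u w : V) (y z : lat) (c : bool) (i j k : int) (m n : nat).

(** The element x is known here only through its charges: those of 3 (gamma - delta) are 3/6 and
    (-3)(-1/6), both equal to 1/2. *)
Lemma dir_x c : chg c x = 3 * osc_form F c false + (- 3) * osc_form F c true.
Proof. by rewrite chgx; case: c; rewrite !osc_form_values; field. Qed.
Lemma dir_opp_x c : chg c (- x) = (- 3) * osc_form F c false + 3 * osc_form F c true.
Proof. by rewrite chgN chgx; case: c; rewrite !osc_form_values; field. Qed.

Lemma graded_a : graded x a. Proof. exact: vx_graded. Qed.
Lemma graded_b : graded (- x) b. Proof. exact: vx_graded. Qed.
Lemma graded_p : graded (- x) p. Proof. exact/np_graded/graded_b. Qed.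
Lemma graded_r : graded (- x) r. Proof. exact/np_graded/graded_p. Qed.
Lemma graded_s : graded (- x) s. Proof. exact/np_graded/graded_b. Qed.

Lemma graded_linear z (B B' : int -> V -> V) a1 a2 : graded z B -> graded z B' ->
  graded z (fun j v => a1 *: B j v + a2 *: B' j v).
Proof.
move=> gB gB'; split=> [j|j y d v hv].
  by apply: lin_add; apply: lin_scale; [apply: graded_lin gB|apply: graded_lin gB'].
by apply: (subD (homog_sub _ _)); apply: (subZ (homog_sub _ _));
  [apply: graded_homog gB _|apply: graded_homog gB' _].
Qed.

Lemma graded_f : graded (- x) f.
Proof.
have [lrs hrs] := graded_linear (- 4) (2 / 3) graded_r graded_s.
split=> [j a1 u v|j y d v hv]; rewrite ?fld_fE; first exact: lrs.
exact: hrs.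
Qed.

Lemma lin_a j : lin (a j). Proof. exact: graded_lin graded_a. Qed.
Lemma lin_b j : lin (b j). Proof. exact: graded_lin graded_b. Qed.
Lemma lin_p j : lin (p j). Proof. exact: graded_lin graded_p. Qed.
Lemma lin_f j : lin (f j). Proof. exact: graded_lin graded_f. Qed.

Lemma a_cur c k j v : cur c k (a j v) = a j (cur c k v) + (1 / 2) *: a (j - k) v.
Proof. by rewrite /fld_a (vx_cur dir_x) chgx. Qed.

Lemma b_cur c k j v : cur c k (b j v) = b j (cur c k v) + (- (1 / 2)) *: b (j - k) v.
Proof. by rewrite /fld_b (vx_cur dir_opp_x) chgN chgx. Qed.

Let kap c k : F := k%:~R * osc_form F c false.

Lemma p_cur c k j v : cur c k (p j v) = p j (cur c k v) +
  (- (1 / 2) *: p (j - k) v + kap c k *: b (j - k) v).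
Proof.
(* A zero second term gives [C] the shape required by [np_linear]. *)
pose C j v := - (1 / 2) *: b j v + 0 *: b j v.
have gC : graded (- x) C by apply: graded_linear; exact: graded_b.
rewrite /fld_p (np_cur _ _ _ _ graded_b gC) => [|j' v']; last by rewrite b_cur /C scale0r addr0.
rewrite (np_linear _ _ _ _ _ _ graded_b graded_b) -/(kap c k) mulr1; congr (_ + _).
lmod (hs_vec V).
Qed.

Lemma r_cur c k j v : cur c k (r j v) = r j (cur c k v) +
  (- (1 / 2) *: r (j - k) v + (2 * kap c k) *: p (j - k) v).
Proof.
pose C j v := - (1 / 2) *: p j v + kap c k *: b j v.
have gC : graded (- x) C by apply: graded_linear; [exact: graded_p|exact: graded_b].
rewrite /fld_r (np_cur _ _ _ _ graded_p gC) => [|j' v']; last by rewrite p_cur.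
rewrite (np_linear _ _ _ _ _ _ graded_p graded_b) -/(kap c k) mulr1; congr (_ + _).
rewrite -[np _ _ b _ _]/(p (j - k) v); lmod (hs_vec V).
Qed.

Lemma s_cur c k j v : cur c k (s j v) = s j (cur c k v) +
  (- (1 / 2) *: s (j - k) v + (kap c k * (k - 1)%:~R) *: b (j - k) v).
Proof.
pose C j v := - (1 / 2) *: b j v + 0 *: b j v.
have gC : graded (- x) C by apply: graded_linear; exact: graded_b.
rewrite /fld_s (np_cur _ _ _ _ graded_b gC) => [|j' v']; last by rewrite b_cur /C scale0r addr0.
rewrite (np_linear _ _ _ _ _ _ graded_b graded_b) -/(kap c k); congr (_ + _).
lmod (hs_vec V).
Qed.

Lemma f_cur c k j v : cur c k (f j v) = f j (cur c k v) +
  (- (1 / 2) *: f (j - k) v + ((- 8 * kap c k) *: p (j - k) v +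
   (2 / 3 * kap c k * (k - 1)%:~R) *: b (j - k) v)).
Proof.
rewrite !fld_fE (linD (cur_lin _ _)) !(linZ (cur_lin _ _)) r_cur s_cur.
lmod (hs_vec V).
Qed.

Lemma f_gamma k j v : cur false k (f j v) = f j (cur false k v) +
  (- (1 / 2) *: f (j - k) v + (- (4 / 3) * k%:~R) *: p (j - k) v +
   (1 / 9 * k%:~R * (k - 1)%:~R) *: b (j - k) v).
Proof. rewrite f_cur /kap osc_form_values; lmod (hs_vec V). Qed.

(** As delta is orthogonal to gamma, only the exponential in f contributes. The [p] and [b] terms of
    [f_gamma] are the contractions of gamma(k) inside [r] and [s]. *)
Lemma f_delta k j v : cur true k (f j v) = f j (cur true k v) - (1 / 2) *: f (j - k) v.
Proof. rewrite f_cur /kap osc_form_values; lmod (hs_vec V). Qed.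

Lemma p_gamma k j v : cur false k (p j v) = p j (cur false k v) +
  (- (1 / 2) *: p (j - k) v + (1 / 6 * k%:~R) *: b (j - k) v).
Proof. rewrite p_cur /kap osc_form_values; lmod (hs_vec V). Qed.

Lemma abC i j v : a i (b j v) = b j (a i v).
Proof.
by apply: (vx_commute dir_x dir_opp_x); rewrite !chgN !chgx; ring.
Qed.
Lemma aaC i j v : a i (a j v) = a j (a i v).
Proof. by apply: (vx_commute dir_x dir_x); rewrite !chgx; ring. Qed.
Lemma bbC i j v : b i (b j v) = b j (b i v).
Proof. by apply: (vx_commute dir_opp_x dir_opp_x); rewrite !chgN !chgx; ring. Qed.

Local Notation g y := (chg false y).

Lemma a0_vac y : a 0 (vac y) = vac (x + y). Proof. exact: vx0_vac. Qed.
Lemma b0_vac y : b 0 (vac y) = vac (- x + y). Proof. exact: vx0_vac. Qed.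
Lemma g_add y : g (x + y) = 1 / 2 + g y. Proof. by rewrite chgD chgx. Qed.
Lemma g_sub y : g (- x + y) = g y - 1 / 2. Proof. by rewrite chgD chgN chgx addrC. Qed.

Lemma p0_vac y : p 0 (vac y) = g y *: vac (- x + y).
Proof. by rewrite /fld_p (np_vac _ _ 0 y graded_b) big_ord0 add0r mul1r b0_vac. Qed.

Lemma sum_quadratic n (G : nat -> F) (e0 e1 e2 : F) :
  (forall k : nat, (k < n)%N -> G k = e0 + e1 * k%:R + e2 * k%:R ^+ 2) ->
  \sum_(k < n) G k = e0 * n%:R + e1 * (n%:R * (n%:R - 1) / 2) +
    e2 * (n%:R * (n%:R - 1) * (2 * n%:R - 1) / 6).
Proof.
elim: n => [|n IHn] Gk; first by rewrite big_ord0; field.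
rewrite big_ord_recr /= IHn => [|k kn]; last by apply: Gk; rewrite ltnS ltnW.
by rewrite Gk // -[n.+1%:R]natr1; by field.
Qed.

Lemma sum_head n (G : nat -> F) :
  \sum_(k < n.+1) G k = G 0%N + \sum_(k < n) G k.+1.
Proof. by rewrite big_ord_recl; congr (_ + _); apply: eq_bigr. Qed.

(** In the sums below the two end terms are special: at index 0 a zero mode may contribute the
    charge, and at the last index the remaining product has index 0. *)
Lemma sum_ends n (G : nat -> F) :
  \sum_(k < n.+2) G k = G 0%N + \sum_(k < n) G k.+1 + G n.+1.
Proof.
by rewrite sum_head big_ord_recr /= addrA.
Qed.

(** For a product of total degree zero with the normal product on the left, [np_lower] leaves a
    finite sum of scalars, one for each annihilation mode. [raise_vac] treats the normal product on
    the right. *)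
Lemma lower_vac c (w : int -> F) (B U : int -> V -> V) z z' n y y' (G : nat -> F) :
  graded z B -> graded z' U ->
  (forall k : nat, (k <= n)%N ->
    w k%:Z *: B (- (n - k)%N%:Z) (cur c k%:Z (U n%:Z (vac y))) = G k *: vac y') ->
  np c w B (- n%:Z) (U n%:Z (vac y)) = (\sum_(k < n.+1) G k) *: vac y'.
Proof.
move=> gB gU BU.
have hU := graded_homog n%:Z gU (homog_vac y); rewrite add0r in hU.
rewrite (np_lower _ _ gB hU) scaler_suml; apply: eq_bigr => k _.
have kn : (k <= n)%N by rewrite -ltnS.
by rewrite -BU //; congr (_ *: B _ _); lia.
Qed.

Lemma raise_vac c (w : int -> F) (B O : int -> V -> V) z z' n y y' (G : nat -> F) :
  graded z B -> graded z' O ->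
  (forall k : nat, (k <= n)%N -> (0 < k)%N ->
    w (- k%:Z) *: O (- n%:Z) (cur c (- k%:Z) (B (n - k)%N%:Z (vac y))) = G k *: vac y') ->
  (w 0 * chg c y) *: O (- n%:Z) (B n%:Z (vac y)) = G 0%N *: vac y' ->
  O (- n%:Z) (np c w B n%:Z (vac y)) = (\sum_(k < n.+1) G k) *: vac y'.
Proof.
move=> gB gO OB OB0; rewrite (np_vac _ _ _ _ gB) (linD (graded_lin _ gO)).
rewrite (linZ (graded_lin _ gO)) OB0 sum_head scalerDl addrC; congr (_ + _).
rewrite (lin_sum (graded_lin _ gO)) scaler_suml; apply: eq_bigr => k _.
rewrite (linZ (graded_lin _ gO)) -OB ?ltn_ord //.
by congr (_ *: O _ (cur _ _ (B _ _))); have := ltn_ord k; lia.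
Qed.

(* In a product of degree zero, a creation operator can be commuted to the left, where it
   acts on a vector of negative degree. *)
Lemma lower_creation c (O U : int -> V -> V) z z' (n k : nat) y (R : V) :
  graded z O -> graded z' U -> (k <= n)%N -> (0 < k)%N ->
  cur c (- k%:Z) (O (- n%:Z) (U (n - k)%N%:Z (vac y))) =
    O (- n%:Z) (cur c (- k%:Z) (U (n - k)%N%:Z (vac y))) + R ->
  O (- n%:Z) (cur c (- k%:Z) (U (n - k)%N%:Z (vac y))) = - R.
Proof.
move=> gO gU kn k0.
have hU := graded_homog (n - k)%N%:Z gU (homog_vac y); rewrite add0r in hU.
rewrite (graded_lt0 gO hU) ?(lin0 (cur_lin _ _)); last by lia.
by move/esym/eqP; rewrite addr_eq0 => /eqP.
Qed.

Lemma ba_vac n y : b (- n%:Z) (a n%:Z (vac y)) = (n == 0%N)%:R *: vac y.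
Proof.
case: n => [|n]; first by rewrite oppr0 a0_vac b0_vac addKr scale1r.
rewrite -abC (graded_vac_lt0 _ graded_b) ?(lin0 (lin_a _)) ?scale0r //.
Qed.

Lemma ab_vac n y : a (- n%:Z) (b n%:Z (vac y)) = (n == 0%N)%:R *: vac y.
Proof.
case: n => [|n]; first by rewrite oppr0 b0_vac a0_vac addNKr scale1r.
rewrite abC (graded_vac_lt0 _ graded_a) ?(lin0 (lin_b _)) ?scale0r //.
Qed.

Lemma bb_vac n y : b (- n%:Z) (b n%:Z (vac y)) = (n == 0%N)%:R *: vac (- x + (- x + y)).
Proof.
case: n => [|n]; first by rewrite oppr0 !b0_vac scale1r.
rewrite bbC (graded_vac_lt0 _ graded_b) ?(lin0 (lin_b _)) ?scale0r //.
Qed.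

Lemma a_gamma_vac (n k : nat) y : (k <= n)%N -> cur false k%:Z (a n%:Z (vac y)) =
  (if k == 0%N then g y + 1 / 2 else 1 / 2) *: a (n - k)%N%:Z (vac y).
Proof.
move=> kn; rewrite a_cur; case: k kn => [|k] kn.
  by rewrite cur0_vac (linZ (lin_a _)) subzn // subn0 -scalerDl.
by rewrite cur_vac // (lin0 (lin_a _)) add0r subzn.
Qed.

Lemma b_gamma_vac (n k : nat) y : (k <= n)%N -> cur false k%:Z (b n%:Z (vac y)) =
  (if k == 0%N then g y - 1 / 2 else - (1 / 2)) *: b (n - k)%N%:Z (vac y).
Proof.
move=> kn; rewrite b_cur; case: k kn => [|k] kn.
  by rewrite cur0_vac (linZ (lin_b _)) subzn // subn0 -scalerDl.
by rewrite cur_vac // (lin0 (lin_b _)) add0r subzn.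
Qed.

Lemma f_gamma_vac (n k : nat) y : (k <= n)%N -> cur false k%:Z (f n%:Z (vac y)) =
  (if k == 0%N then g y - 1 / 2 else - (1 / 2)) *: f (n - k)%N%:Z (vac y) +
  ((- (4 / 3) * k%:R) *: p (n - k)%N%:Z (vac y) +
   (1 / 9 * k%:R * (k%:R - 1)) *: b (n - k)%N%:Z (vac y)).
Proof.
move=> kn; rewrite f_gamma subzn // intrB /= -!pmulrn; case: k kn => [|k] kn.
  rewrite cur0_vac (linZ (lin_f _)) subn0 /=; lmod (hs_vec V).
rewrite cur_vac // (lin0 (lin_f _)) /=; lmod (hs_vec V).
Qed.

Lemma p_gamma_vac (n k : nat) y : (k <= n)%N -> cur false k%:Z (p n%:Z (vac y)) =
  (if k == 0%N then g y - 1 / 2 else - (1 / 2)) *: p (n - k)%N%:Z (vac y) +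
  (1 / 6 * k%:R) *: b (n - k)%N%:Z (vac y).
Proof.
move=> kn; rewrite p_gamma subzn // -!pmulrn; case: k kn => [|k] kn.
  rewrite cur0_vac (linZ (lin_p _)) subn0 /=; lmod (hs_vec V).
rewrite cur_vac // (lin0 (lin_p _)) /=; lmod (hs_vec V).
Qed.

Lemma pa_vac n y : p (- n%:Z) (a n%:Z (vac y)) =
  (if n == 0%N then g y + 1 / 2 else 1 / 2) *: vac y.
Proof.
pose G (k : nat) : F := (if k == 0%N then g y + 1 / 2 else 1 / 2) * (n - k == 0)%N%:R.
rewrite {1}/fld_p (lower_vac (y' := y) (G := G) graded_b graded_a); last first.
  by move=> k kn; rewrite a_gamma_vac // (linZ (lin_b _)) ba_vac scale1r scalerA.
congr (_ *: _); rewrite big_ord_recr /= /G subnn mulr1 big1 ?add0r // => k _.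
by rewrite subn_eq0 leqNgt ltn_ord mulr0.
Qed.

Lemma ap_vac n y : a (- n%:Z) (p n%:Z (vac y)) =
  (if n == 0%N then g y else - (1 / 2)) *: vac y.
Proof.
pose G (k : nat) : F := if k == 0%N then g y * (n == 0%N)%:R else - (1 / 2) * (n - k == 0)%N%:R.
rewrite {1}/fld_p (raise_vac (G := G) (y' := y) graded_b graded_a); first last.
- by rewrite /= mul1r ab_vac scalerA.
- move=> k kn k0.
  rewrite (lower_creation (R := (1 / 2) *: a (- (n - k)%N%:Z) (b (n - k)%N%:Z (vac y)))
    graded_a graded_b kn k0).
    by rewrite ab_vac scale1r !scalerA /G (gtn_eqF k0) -scaleNr mulNr.
  by rewrite a_cur; congr (_ + _ *: a _ _); lia.
congr (_ *: _); case: n @G => [|n] G; first by rewrite big_ord1 /G mulr1.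
rewrite (sum_ends n G) /G /= mulr0 add0r subnn mulr1 big1 ?add0r // => k _.
by rewrite subSS subn_eq0 leqNgt ltn_ord mulr0.
Qed.

(* [e^x] and [gamma e^-x] form a beta-gamma system up to normalization. *)
Lemma apC i j v : a i (p j v) = p j (a i v) - (if i + j == 0 then 1 / 2 else 0) *: v.
Proof.
apply/eqP; rewrite -subr_eq0 opprB; apply/eqP.
pose X i j v := a i (p j v) + ((if i + j == 0 then 1 / 2 else 0) *: v - p j (a i v)).
apply: (@two_param_zero _ _ 0 X (fun=> 1 / 2) (fun=> - (1 / 2))) => {i j v} [i j|i j y d v hv|c k i j v _|i y].
- apply: lin_add; first exact: lin_comp (lin_a _) (lin_p _).
  by apply: lin_sub; [apply/lin_scale/lin_id|exact: lin_comp (lin_p _) (lin_a _)].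
- apply: (subD (homog_sub _ _)); last apply: (subB (homog_sub _ _)).
  + have := graded_homog i graded_a (graded_homog j graded_p hv).
    by rewrite addNKr add0r -addrA [j + i]addrC.
  + rewrite add0r; case: eqP => [->|_]; rewrite ?scale0r; last exact: (sub0 (homog_sub _ _)).
    by rewrite addr0; apply: (subZ (homog_sub _ _)).
  + have := graded_homog j graded_p (graded_homog i graded_a hv).
    by rewrite addKr add0r -addrA.
- rewrite /X !(linD (cur_lin _ _)) (linN (cur_lin _ _)) (linZ (cur_lin _ _)).
  rewrite !a_cur !p_cur !(linD (lin_a _)) !(linZ (lin_a _)) a_cur !(linD (lin_p _)) !(linZ (lin_p _)).
  rewrite abC [i - k + j]addrAC [i + (j - k)]addrA.
  lmod (hs_vec V).
- rewrite /X; case: i => [[|n]|n].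
  + rewrite oppr0 !p0_vac a0_vac (linZ (lin_a _)) a0_vac p0_vac addNKr addKr g_add.
    rewrite addr0 eqxx; lmod (hs_vec V).
  + rewrite pa_vac (graded_vac_lt0 _ graded_p) // (lin0 (lin_a _)) subrr eqxx /=.
    lmod (hs_vec V).
  + rewrite NegzE opprK ap_vac (graded_vac_lt0 _ graded_a) // (lin0 (lin_p _)) addNr eqxx /=.
    lmod (hs_vec V).
Qed.

Lemma f0_vac y : f 0 (vac y) = (- 4 * g y ^+ 2 - 2 / 3 * g y) *: vac (- x + y).
Proof.
rewrite fld_fE /fld_r /fld_s (np_vac _ _ 0 y graded_p) (np_vac _ _ 0 y graded_b).
rewrite !big_ord0 !add0r p0_vac b0_vac; lmod (hs_vec V).
Qed.

Lemma fa_vac n y : f (- n.+1%:Z) (a n.+1%:Z (vac y)) =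
  (- 4 * (g y + 1 / 2 + n%:R / 4) - (n%:R + 2) / 3) *: vac y.
Proof.
pose Gr (k : nat) : F := (if k == 0%N then g y + 1 / 2 else 1 / 2) *
   (if (n.+1 - k == 0)%N then g y + 1 / 2 else 1 / 2).
pose Gs (k : nat) : F := - (k%:R + 1) * (if k == 0%N then g y + 1 / 2 else 1 / 2) *
   (n.+1 - k == 0)%N%:R.
rewrite fld_fE {1}/fld_r (lower_vac (G := Gr) (y' := y) graded_p graded_a); last first.
  by move=> k kn; rewrite a_gamma_vac // (linZ (lin_p _)) pa_vac scale1r scalerA.
rewrite {1}/fld_s (lower_vac (G := Gs) (y' := y) graded_b graded_a); last first.
  move=> k kn; rewrite a_gamma_vac // (linZ (lin_b _)) ba_vac !scalerA intrD.
  by rewrite -pmulrn.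
rewrite (sum_ends n Gr) (sum_ends n Gs) (@sum_quadratic n (fun k : nat => Gr k.+1) (1 / 4) 0 0) => [|k kn].
  rewrite [X in _ + _ *: ((_ + X + _) *: _)]big1 => [|k _].
    rewrite /Gr /Gs /= subnn /= -natr1; lmod (hs_vec V).
  by rewrite /Gs subSS subn_eq0 leqNgt ltn_ord mulr0.
by rewrite /Gr subSS subn_eq0 leqNgt kn /=; field.
Qed.

Lemma af_vac n y : a (- n.+1%:Z) (f n.+1%:Z (vac y)) =
  (4 * g y - 4 / 3 * n%:R) *: vac y.
Proof.
pose Gr (k : nat) : F := if k == 0%N then - (1 / 2) * g y else
   - (1 / 2) * (if (n.+1 - k == 0)%N then g y else - (1 / 2)).
pose Gs (k : nat) : F := if k == 0%N then 0 else - (1 / 2) * (k%:R - 1) * (n.+1 - k == 0)%N%:R.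
rewrite fld_fE (linD (lin_a _)) !(linZ (lin_a _)).
rewrite {1}/fld_r (raise_vac (G := Gr) (y' := y) graded_p graded_a); first last.
- by rewrite ap_vac /= scalerA /Gr mul1r mulrC.
- move=> k kn k0.
  rewrite (lower_creation (R := (1 / 2) *: a (- (n.+1 - k)%N%:Z) (p (n.+1 - k)%N%:Z (vac y)))
    graded_a graded_p kn k0).
    by rewrite ap_vac scale1r !scalerA /Gr (gtn_eqF k0) -scaleNr mulNr.
  by rewrite a_cur; congr (_ + _ *: a _ _); lia.
rewrite {1}/fld_s (raise_vac (G := Gs) (y' := y) graded_b graded_a); first last.
- by rewrite ab_vac /= /Gs !scale0r scaler0.
- move=> k kn k0.
  rewrite (lower_creation (R := (1 / 2) *: a (- (n.+1 - k)%N%:Z) (b (n.+1 - k)%N%:Z (vac y)))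
    graded_a graded_b kn k0).
    rewrite ab_vac scalerN !scalerA -scaleNr /Gs (gtn_eqF k0); congr (_ *: _).
    by rewrite intrD mulrNz -pmulrn; ring.
  by rewrite a_cur; congr (_ + _ *: a _ _); lia.
rewrite (sum_ends n Gr) (sum_ends n Gs) (@sum_quadratic n (fun k : nat => Gr k.+1) (1 / 4) 0 0) => [|k kn].
  rewrite [X in _ + _ *: ((_ + X + _) *: _)]big1 => [|k _].
    rewrite /Gr /Gs /= subnn /= -natr1; lmod (hs_vec V).
  by rewrite /Gs subSS subn_eq0 leqNgt ltn_ord mulr0.
by rewrite /Gr subSS subn_eq0 leqNgt kn /=; field.
Qed.

(** The diagonal part uses gamma(0) although h is 4 delta, because the degree index [j] of f carries
    part of the charge; [commutes_ef] makes the conversion. *)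
Definition af_comm i j v : V :=
  if i + j == 0 then 4 *: cur false 0 v + (4 / 3 * (1 - j%:~R)) *: v
  else 4 *: cur true (- (i + j)) v.

Lemma af_comm_lin i j : lin (af_comm i j).
Proof.
rewrite /af_comm; case: eqP => _; last exact/lin_scale/cur_lin.
by apply: lin_add; [exact/lin_scale/cur_lin|exact/lin_scale/lin_id].
Qed.

(** The last term is what the [p] term of [f_gamma], with coefficient - 4/3 k, contributes to the
    commutator through [a,p] = - 1/2. *)
Lemma af_comm_cur c k i j v : k != 0 -> cur c k (af_comm i j v) = af_comm i j (cur c k v) +
  ((1 / 2) *: af_comm (i - k) j v - (1 / 2) *: af_comm i (j - k) v) +
  (if ~~ c && (i + j == k) then 2 / 3 * k%:~R else 0) *: v.
Proof.
move=> k0; rewrite /af_comm [i - k + j]addrAC [i + (j - k)]addrA.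
have [ij|ij] := eqVneq (i + j) 0.
  rewrite ij sub0r oppr_eq0 (negPf k0) opprK eq_sym (negPf k0) andbF.
  rewrite (linD (cur_lin _ _)) !(linZ (cur_lin _ _)) curC ?addr0 //.
  lmod (hs_vec V).
rewrite subr_eq0 (linZ (cur_lin _ _)) cur_comm subr_eq0 [k == _]eq_sym.
have [->|ijk] := eqVneq (i + j) k.
  rewrite intrB; case: c; rewrite osc_form_values /=; lmod (hs_vec V).
rewrite andbF; lmod (hs_vec V).
Qed.

(** The extra terms of [f_gamma] enter only through [a,b] = 0 and the scalar [a,p]. They cancel
    against the last term of [af_comm_cur], so the difference of both sides satisfies the relations
    of [two_param_zero]. *)
Lemma afC i j v : a i (f j v) = f j (a i v) + af_comm i j v.
Proof.
apply/eqP; rewrite -subr_eq0 opprD addrA; apply/eqP.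
pose X i j v := a i (f j v) - f j (a i v) - af_comm i j v.
apply: (@two_param_zero _ _ 0 X (fun=> 1 / 2) (fun=> - (1 / 2))) => {i j v} [i j|i j y d v hv|c k i j v k0|i y].
- apply: lin_sub; last exact: af_comm_lin.
  by apply: lin_sub; [exact: lin_comp (lin_a _) (lin_f _)|exact: lin_comp (lin_f _) (lin_a _)].
- apply: (subB (homog_sub _ _)); first apply: (subB (homog_sub _ _)).
  + have := graded_homog i graded_a (graded_homog j graded_f hv).
    by rewrite addNKr add0r -addrA [j + i]addrC.
  + have := graded_homog j graded_f (graded_homog i graded_a hv).
    by rewrite addKr add0r -addrA.
  + rewrite add0r /af_comm; case: eqP => [->|_].
      rewrite addr0; apply: (subD (homog_sub _ _)); apply: (subZ (homog_sub _ _)) => //.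
      by have := cur_homog false 0 hv; rewrite subr0.
    apply: (subZ (homog_sub _ _)); have := cur_homog true (- (i + j)) hv.
    by rewrite opprK.
- rewrite /X !(linB (cur_lin _ _)) af_comm_cur // !a_cur !f_cur.
  rewrite !(linD (lin_a _)) !(linZ (lin_a _)) a_cur !(linD (lin_f _)) !(linZ (lin_f _)).
  rewrite abC apC [i + (j - k)]addrA subr_eq0 /kap.
  case: c => /=; rewrite osc_form_values; first by lmod (hs_vec V).
  case: eqP => _; lmod (hs_vec V).
- rewrite /X /af_comm addrN eqxx; case: i => [[|n]|n].
  + rewrite oppr0 !f0_vac a0_vac (linZ (lin_a _)) a0_vac f0_vac addNKr addKr g_add.
    rewrite cur0_vac; lmod (hs_vec V).
  + rewrite fa_vac (graded_vac_lt0 _ graded_f) // (lin0 (lin_a _)) cur0_vac.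
    rewrite mulrNz -pmulrn -natr1; lmod (hs_vec V).
  + rewrite NegzE opprK af_vac (graded_vac_lt0 _ graded_a) // (lin0 (lin_f _)) cur0_vac.
    rewrite -pmulrn -natr1; lmod (hs_vec V).
Qed.

Local Notation vac2 y := (vac (- x + (- x + y))).

Lemma bp_vac n y : b (- n%:Z) (p n%:Z (vac y)) =
  (if n == 0%N then g y else 1 / 2) *: vac2 y.
Proof.
case: n => [|n]; first by rewrite oppr0 p0_vac (linZ (lin_b _)) b0_vac.
pose G (k : nat) : F := if k == 0%N then 0 else 1 / 2 * (n.+1 - k == 0)%N%:R.
rewrite {1}/fld_p (raise_vac (G := G) (y' := - x + (- x + y)) graded_b graded_b); first last.
- by rewrite bb_vac /G /= !scale0r scaler0.
- move=> k kn k0.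
  rewrite (lower_creation (R := - (1 / 2) *: b (- (n.+1 - k)%N%:Z) (b (n.+1 - k)%N%:Z (vac y)))
    graded_b graded_b kn k0).
    rewrite bb_vac scale1r !scalerA /G (gtn_eqF k0); lmod (hs_vec V).
  by rewrite b_cur; congr (_ + _ *: b _ _); lia.
congr (_ *: _); rewrite (sum_ends n G) /G /= subnn mulr1 big1 ?add0r // => k _.
by rewrite subSS subn_eq0 leqNgt ltn_ord mulr0.
Qed.

Lemma pb_vac n y : p (- n%:Z) (b n%:Z (vac y)) =
  (if n == 0%N then g y - 1 / 2 else - (1 / 2)) *: vac2 y.
Proof.
pose G (k : nat) : F := (if k == 0%N then g y - 1 / 2 else - (1 / 2)) * (n - k == 0)%N%:R.
rewrite {1}/fld_p (lower_vac (y' := - x + (- x + y)) (G := G) graded_b graded_b); last first.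
  by move=> k kn; rewrite b_gamma_vac // (linZ (lin_b _)) bb_vac scale1r scalerA.
congr (_ *: _); rewrite big_ord_recr /= /G subnn mulr1 big1 ?add0r // => k _.
by rewrite subn_eq0 leqNgt ltn_ord mulr0.
Qed.

Lemma pp_vac n y : p (- n%:Z) (p n%:Z (vac y)) =
  (if n == 0%N then (g y - 1 / 2) * g y else - (n%:R / 12)) *: vac2 y.
Proof.
case: n => [|n].
  by rewrite oppr0 p0_vac (linZ (lin_p _)) p0_vac g_sub scalerA mulrC.
pose G (k : nat) : F := (if k == 0%N then g y - 1 / 2 else - (1 / 2)) *
    (if (n.+1 - k == 0)%N then g y else 1 / 2) + 1 / 6 * k%:R * (n.+1 - k == 0)%N%:R.
rewrite {1}/fld_p (lower_vac (y' := - x + (- x + y)) (G := G) graded_b graded_p); last first.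
  move=> k kn; rewrite p_gamma_vac // (linD (lin_b _)) !(linZ (lin_b _)) bp_vac bb_vac /G.
  lmod (hs_vec V).
rewrite (sum_ends n G) (@sum_quadratic n (fun k : nat => G k.+1) (- (1 / 4)) 0 0) => [|k kn].
  congr (_ *: _); rewrite /G /= subnn ?subn0 /= -[n.+1%:R]natr1; by field.
by rewrite /G subSS subn_eq0 leqNgt kn /=; field.
Qed.

Lemma bf_vac n y : b (- n%:Z) (f n%:Z (vac y)) =
  (if n == 0%N then - 4 * g y ^+ 2 - 2 / 3 * g y
   else - 4 * g y - 2 / 3 * (n%:R - 1)) *: vac2 y.
Proof.
case: n => [|n]; first by rewrite oppr0 f0_vac (linZ (lin_b _)) b0_vac.
pose Gr (k : nat) : F := if k == 0%N then 1 / 2 * g y else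
   1 / 2 * (if (n.+1 - k == 0)%N then g y else 1 / 2).
pose Gs (k : nat) : F := if k == 0%N then 0 else 1 / 2 * (k%:R - 1) * (n.+1 - k == 0)%N%:R.
rewrite fld_fE (linD (lin_b _)) !(linZ (lin_b _)).
rewrite {1}/fld_r (raise_vac (G := Gr) (y' := - x + (- x + y)) graded_p graded_b); first last.
- by rewrite bp_vac /= scalerA /Gr mul1r mulrC.
- move=> k kn k0.
  rewrite (lower_creation (R := - (1 / 2) *: b (- (n.+1 - k)%N%:Z) (p (n.+1 - k)%N%:Z (vac y)))
    graded_b graded_p kn k0).
    rewrite bp_vac scale1r !scalerA /Gr (gtn_eqF k0); lmod (hs_vec V).
  by rewrite b_cur; congr (_ + _ *: b _ _); lia.
rewrite {1}/fld_s (raise_vac (G := Gs) (y' := - x + (- x + y)) graded_b graded_b); first last.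
- by rewrite bb_vac /= /Gs !scale0r scaler0.
- move=> k kn k0.
  rewrite (lower_creation (R := - (1 / 2) *: b (- (n.+1 - k)%N%:Z) (b (n.+1 - k)%N%:Z (vac y)))
    graded_b graded_b kn k0).
    rewrite bb_vac scalerN !scalerA -scaleNr /Gs (gtn_eqF k0); congr (_ *: _).
    by rewrite intrD mulrNz -pmulrn; ring.
  by rewrite b_cur; congr (_ + _ *: b _ _); lia.
rewrite (sum_ends n Gr) (sum_ends n Gs) (@sum_quadratic n (fun k : nat => Gr k.+1) (1 / 4) 0 0) => [|k kn].
  rewrite [X in _ + _ *: ((_ + X + _) *: _)]big1 => [|k _].
    rewrite /Gr /Gs /= subnn /= -natr1; lmod (hs_vec V).
  by rewrite /Gs subSS subn_eq0 leqNgt ltn_ord mulr0.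
by rewrite /Gr subSS subn_eq0 leqNgt kn /=; field.
Qed.

(** The three summands are the contributions of the annihilation modes gamma(0), of gamma(k) with 0
    < k < N, and of gamma(N). *)
Definition pf_value (h N : F) : F :=
  (h - 1 / 2) * (- 4 * h - 2 / 3 * (N - 1)) +
  ((2 * h + (N - 2) / 3 - 2 / 3) * (N - 1) - (N - 1) * (N - 2) / 2) +
  (2 * h ^+ 2 + h / 3 - 4 / 3 * N * h + N * (N - 1) / 9).

Lemma pf_vac n y : p (- n%:Z) (f n%:Z (vac y)) =
  (if n == 0%N then (g y - 1 / 2) * (- 4 * g y ^+ 2 - 2 / 3 * g y)
   else pf_value (g y) n%:R) *: vac2 y.
Proof.
case: n => [|n].
  by rewrite oppr0 f0_vac (linZ (lin_p _)) p0_vac g_sub scalerA mulrC.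
pose G (k : nat) : F := (if k == 0%N then g y - 1 / 2 else - (1 / 2)) *
    (if (n.+1 - k == 0)%N then - 4 * g y ^+ 2 - 2 / 3 * g y
     else - 4 * g y - 2 / 3 * ((n.+1 - k)%:R - 1)) +
  (- (4 / 3) * k%:R * (if (n.+1 - k == 0)%N then g y else 1 / 2) +
   1 / 9 * k%:R * (k%:R - 1) * (n.+1 - k == 0)%N%:R).
rewrite {1}/fld_p (lower_vac (y' := - x + (- x + y)) (G := G) graded_b graded_f); last first.
  move=> k kn; rewrite f_gamma_vac // !(linD (lin_b _)) !(linZ (lin_b _)).
  rewrite bf_vac bp_vac bb_vac /G; lmod (hs_vec V).
rewrite (sum_ends n G) (@sum_quadratic n (fun k : nat => G k.+1)
  (2 * g y + (n%:R - 1) / 3 - 2 / 3) (- 1) 0) => [|k kn].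
  congr (_ *: _); rewrite /G /pf_value /= subnn ?subn0 /= -[n.+1%:R]natr1; by field.
rewrite /G subSS subn_eq0 leqNgt kn /= natrB ?(ltnW kn) // -[k.+1%:R]natr1; by field.
Qed.

(** A cancellation between the [r] and [s] parts of f, identically in n and in the charge; it
    depends on the ratio of the coefficients - 4 and 2/3. *)
Lemma ff_vac n y : f (- n.+1%:Z) (f n.+1%:Z (vac y)) = 0.
Proof.
pose Gr (k : nat) : F := (if k == 0%N then g y - 1 / 2 else - (1 / 2)) *
    (if (n.+1 - k == 0)%N then (g y - 1 / 2) * (- 4 * g y ^+ 2 - 2 / 3 * g y)
     else pf_value (g y) (n.+1 - k)%:R) +
  (- (4 / 3) * k%:R * (if (n.+1 - k == 0)%N then (g y - 1 / 2) * g y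
     else - ((n.+1 - k)%:R / 12)) +
   1 / 9 * k%:R * (k%:R - 1) * (if (n.+1 - k == 0)%N then g y - 1 / 2 else - (1 / 2))).
pose Gs (k : nat) : F := - (k%:R + 1) * ((if k == 0%N then g y - 1 / 2 else - (1 / 2)) *
    (if (n.+1 - k == 0)%N then - 4 * g y ^+ 2 - 2 / 3 * g y
     else - 4 * g y - 2 / 3 * ((n.+1 - k)%:R - 1)) +
  (- (4 / 3) * k%:R * (if (n.+1 - k == 0)%N then g y else 1 / 2) +
   1 / 9 * k%:R * (k%:R - 1) * (n.+1 - k == 0)%N%:R)).
rewrite fld_fE {1}/fld_r (lower_vac (G := Gr) (y' := - x + (- x + y)) graded_p graded_f); last first.
  move=> k kn; rewrite f_gamma_vac // !(linD (lin_p _)) !(linZ (lin_p _)).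
  rewrite pf_vac pp_vac pb_vac /Gr; lmod (hs_vec V).
rewrite {1}/fld_s (lower_vac (G := Gs) (y' := - x + (- x + y)) graded_b graded_f); last first.
  move=> k kn; rewrite f_gamma_vac // !(linD (lin_b _)) !(linZ (lin_b _)).
  rewrite bf_vac bp_vac bb_vac /Gs intrD -pmulrn; lmod (hs_vec V).
rewrite (sum_ends n Gr) (sum_ends n Gs).
pose N : F := n%:R; pose h := g y.
(* [Mr K] and [Ms K] are the middle terms [Gr K.+1] and [Gs K.+1], as polynomials of degree 2 in
   [K]. *)
pose Mr (K : F) := - (1 / 2) * pf_value h (N - K) +
  (- (4 / 3) * (K + 1) * (- ((N - K) / 12)) - 1 / 18 * (K + 1) * K).
pose Ms (K : F) := - (K + 2) * (- (1 / 2) * (- 4 * h - 2 / 3 * (N - K - 1)) -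
  4 / 3 * (K + 1) * (1 / 2)).
(* The coefficients of a quadratic polynomial, recovered from its values at 0, 1 and 2. *)
pose e2 (M : F -> F) := (M 2 - 2 * M 1 + M 0) / 2.
pose e1 (M : F -> F) := M 1 - M 0 - e2 M.
rewrite (@sum_quadratic n (fun k : nat => Gr k.+1) (Mr 0) (e1 Mr) (e2 Mr)); last first.
  move=> k kn; rewrite /Gr subSS subn_eq0 leqNgt kn /= natrB ?(ltnW kn) // -[k.+1%:R]natr1.
  by rewrite /e1 /e2 /Mr /pf_value -/N -/h; field.
rewrite (@sum_quadratic n (fun k : nat => Gs k.+1) (Ms 0) (e1 Ms) (e2 Ms)); last first.
  move=> k kn; rewrite /Gs subSS subn_eq0 leqNgt kn /= natrB ?(ltnW kn) // -[k.+1%:R]natr1.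
  by rewrite /e1 /e2 /Ms -/N -/h; field.
rewrite !scalerA -scalerDl [X in X *: _](_ : _ = 0) ?scale0r //.
rewrite /Gr /Gs /e1 /e2 /Mr /Ms /pf_value /= subnn subn0 /= -[n.+1%:R]natr1 -/N -/h.
by field.
Qed.

(* [e^x] and [delta] determine the commutator of [f] with itself, up to its
   degree zero part. *)
Lemma ffC i j v : f i (f j v) = f j (f i v).
Proof.
pose T i j v := f i (f j v) - f j (f i v).
suff T0 v' : forall i j, T i j v' = 0 by apply/eqP; rewrite -subr_eq0; apply/eqP/T0.
have linT i' j' : lin (T i' j').
  by apply: lin_sub; apply: lin_comp; apply: lin_f.
have Td k i' j' u : cur true k (T i' j' u) = T i' j' (cur true k u) -
    (1 / 2) *: T (i' - k) j' u - (1 / 2) *: T i' (j' - k) u.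
  rewrite /T (linB (cur_lin _ _)) !f_delta !(linB (lin_f _)) !(linZ (lin_f _)).
  lmod (hs_vec V).
(* The extra term depends on [i'] and [j'] only through their sum, so it cancels in [T]. *)
have af_f k i' j' u : f j' (af_comm k i' u) = af_comm k i' (f j' u) + 2 *: f (j' + (k + i')) u.
  rewrite /af_comm; case: eqP => [->|_].
    rewrite (linD (lin_f _)) !(linZ (lin_f _)) f_gamma ?subr0 ?addr0 !mulr0z.
    lmod (hs_vec V).
  by rewrite (linZ (lin_f _)) f_delta opprK; lmod (hs_vec V).
have Ta k i' j' u : a k (T i' j' u) = T i' j' (a k u).
  rewrite /T (linB (lin_a _)) !afC !(linD (lin_f _)) !af_f.
  have -> : i' + (k + j') = j' + (k + i') by lia.
  lmod (hs_vec V).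
have Thom i' j' y d u : homog y d u -> homog (- x + (- x + y)) (d + (i' + j')) (T i' j' u).
  move=> hu; apply: (subB (homog_sub _ _)).
    have := graded_homog i' graded_f (graded_homog j' graded_f hu).
    by rewrite -addrA [j' + i']addrC.
  have := graded_homog j' graded_f (graded_homog i' graded_f hu).
  by rewrite -addrA.
have Tvac y : forall i' j', T i' j' (vac y) = 0.
  move=> i' j'; have [m] := ubnP (absz (i' + j')); elim: m i' j' => // m IHm i' j' ijm.
  have hT := Thom i' j' _ _ _ (homog_vac y); rewrite add0r in hT.
  have [lt0|ge0] := ltP (i' + j') 0; first exact: homog_lt0 hT lt0.
  have [ij0|ij0] := eqVneq (i' + j') 0.
    have -> : j' = - i' by lia.
    case: i' {hT ijm ge0 ij0} => [[|n]|n].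
    - by rewrite /T oppr0 subrr.
    - by rewrite /T ff_vac (graded_vac_lt0 _ graded_f) // (lin0 (lin_f _)) subr0.
    - by rewrite /T NegzE opprK ff_vac (graded_vac_lt0 _ graded_f) // (lin0 (lin_f _)) subr0.
  have Td0 (k : nat) : cur true k.+1 (T i' j' (vac y)) = 0.
    have small i2 j2 : i2 + j2 = i' + j' - k.+1%:Z -> T i2 j2 (vac y) = 0.
      move=> e; have [lt0'|ge0'] := ltP (i2 + j2) 0; last by apply: IHm; lia.
      by apply: homog_lt0 (Thom i2 j2 _ _ _ (homog_vac y)) _; rewrite add0r.
    by rewrite Td cur_vac // (lin0 (linT _ _)) !small ?scaler0 ?subr0 //; lia.
  apply: (homog_kernel hT) => // -[] k; first exact: Td0.
  suff : xcur (V := V) 3 (- 3) k.+1 (T i' j' (vac y)) = 0.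
    rewrite /xcur Td0 scaler0 addr0 => /eqP.
    by rewrite scaler_eq0 pnatr_eq0 => /eqP.
  apply: (vx_descent dir_x) => n; rewrite -/(a (- n.+1%:Z) _) Ta.
  by rewrite (graded_vac_lt0 _ graded_a) // (lin0 (linT _ _)).
move: v'; apply: (@vx_span _ _ x 3 (- 3) dir_x _ _ [set v | forall i j, T i j v = 0]).
- by rewrite !chgx; ring.
- by rewrite pnatr_eq0.
- split=> [i' j'|c0 u w hu hw i' j'] /=; first exact: (lin0 (linT _ _)).
  by rewrite linT hu hw scaler0 addr0.
- exact: Tvac.
- move=> k u Tu i' j' /=.
  have := Td (- k.+1%:Z) i' j' u; rewrite !Tu (lin0 (cur_lin _ _)) !scaler0 !subr0.
  by move/esym.
- by move=> k u Tu i' j' /=; rewrite -Ta Tu (lin0 (lin_a _)).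
Qed.
End Relations.

(** * The action of the affine algebra *)

Section AffineAction.
Variables (F : numFieldType) (V : heis_space F) (x : hs_lat V).
Hypothesis chgx : forall c, chg c x = 1 / 2.
(** [N y] stands for <x,y>, [wt y] for the L(0)-eigenvalue of e^y, and [C] for the part with charges
    in [L]. The relations below are all that is retained of the concrete lattice, which keeps
    multisets and rational exponents out of the argument. *)
Variables (L : set (hs_lat V)) (N : hs_lat V -> int) (wt : hs_lat V -> F).
Hypothesis Lx : forall y, L y -> L (x + y).
Hypothesis LNx : forall y, L y -> L (- x + y).
Hypothesis Nx : forall y, L y -> N (x + y) = N y.
Hypothesis chg_delta : forall y, L y -> chg true y = chg false y - (N y)%:~R / 3.
Hypothesis wtx : forall y, L y -> wt (x + y) = wt y + (N y)%:~R + 1.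
Variables (C : set V) (ac : ghat -> V -> V) (kappa : F).
Hypothesis subC : subspace C.
Hypothesis C_homog : forall y d v, L y -> homog y d v -> C v.
Hypothesis C_span : forall P : set V, subspace P ->
  (forall y d v, L y -> homog y d v -> P v) -> forall v, C v -> P v.
Hypothesis ac_lin : forall X a u v, C u -> C v -> ac X (a *: u + v) = a *: ac X u + ac X v.
Hypothesis ac_e : forall n y d v, L y -> homog y d v ->
  ac (Loop sl2e n) v = fld_a x (- n - 1 - N y) v.
Hypothesis ac_f : forall n y d v, L y -> homog y d v ->
  ac (Loop sl2f n) v = fld_f x (1 + N y - n) v.
Hypothesis ac_h : forall n y d v, L y -> homog y d v ->
  ac (Loop sl2h n) v = 4 *: cur true n v.
Hypothesis ac_c : forall v, C v -> ac Cen v = - (4 / 3) *: v.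
Hypothesis ac_d : forall y d v, L y -> homog y d v ->
  ac Der v = (kappa - d%:~R - wt y) *: v.
Local Notation a := (fld_a x).
Local Notation f := (fld_f x).
Let M : ghat_ops F := @GhatOps F V C ac.

Lemma NNx y : L y -> N (- x + y) = N y.
Proof. by move=> Ly; rewrite -(Nx (LNx Ly)) addNKr. Qed.

Lemma wtNx y : L y -> wt (- x + y) = wt y - (N y)%:~R - 1.
Proof.
by move=> Ly; have := wtx (LNx Ly); rewrite addNKr NNx // => ->; ring.
Qed.

Lemma ac_homog X y d v : L y -> homog y d v ->
  exists y' d', [/\ L y', homog y' d' (ac X v) &
    exists j, y' = y + x *~ j].
Proof.
move=> Ly hv; case: X => [[] n| |].
- exists (x + y), (d + (- n - 1 - N y)); rewrite (ac_e _ Ly hv); split; first exact: Lx.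
    exact: (graded_homog _ (graded_a x) hv).
  by exists 1; rewrite addrC.
- exists (- x + y), (d + (1 + N y - n)); rewrite (ac_f _ Ly hv); split; first exact: LNx.
    exact: (graded_homog _ (graded_f x) hv).
  by exists (- 1); rewrite addrC mulrNz.
- exists y, (d - n); rewrite (ac_h _ Ly hv); split=> //; last by exists 0; rewrite addr0.
  by apply: (subZ (homog_sub _ _)); apply: cur_homog.
- exists y, d; rewrite (ac_c (C_homog Ly hv)); split=> //; last by exists 0; rewrite addr0.
  exact: (subZ (homog_sub _ _)).
- exists y, d; rewrite (ac_d Ly hv); split=> //; last by exists 0; rewrite addr0.
  exact: (subZ (homog_sub _ _)).
Qed.

Lemma ac_C X v : C v -> C (ac X v).
Proof.
(* The conjunction carries [C v] along, because [ac] is linear only on [C] and [C_span] requires a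
   subspace. *)
move=> Cv; apply: (proj2 (_ : C v /\ C (ac X v))).
apply: (@C_span [set v | C v /\ C (ac X v)]) Cv => [|y d u Ly hu].
  split; first by split; [exact: (sub0 subC)|rewrite (linon0 subC (ac_lin X)); exact: (sub0 subC)].
  move=> k u w [Cu Cau] [Cw Caw]; split; first exact: (subP subC).
  by rewrite ac_lin //; apply: (subP subC).
split; first exact: C_homog hu.
by have [y' [d' [Ly' hau _]]] := ac_homog X Ly hu; apply: C_homog hau.
Qed.

Let acZ X k v : C v -> ac X (k *: v) = k *: ac X v.
Proof. exact: (linonZ subC (ac_lin X)). Qed.
Let ac0 X : ac X 0 = 0. Proof. exact: (linon0 subC (ac_lin X)). Qed.

Let br X Y v : V := \sum_(p <- ghat_bracket F X Y) p.1 *: ac p.2 v.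

Lemma br_lin X Y k u v : C u -> C v -> br X Y (k *: u + v) = k *: br X Y u + br X Y v.
Proof.
move=> Cu Cv; rewrite /br scaler_sumr -big_split; apply: eq_bigr => q _ /=.
by rewrite ac_lin // scalerDr !scalerA mulrC.
Qed.

Lemma br_loop s1 s2 n m v : br (Loop s1 n) (Loop s2 m) v =
  \sum_(q <- sl2_bracket F s1 s2) q.1 *: ac (Loop q.2 (n + m)) v +
  (if n + m == 0 then (n%:~R * sl2_form F s1 s2) *: ac Cen v else 0).
Proof.
rewrite /br /= big_cat big_map /=; congr (_ + _).
by case: ifP => _; rewrite ?big_seq1 ?big_nil.
Qed.

(** Antisymmetry halves the number of pairs of generators whose bracket has to be checked. *)
Lemma br_anti X Y v : br Y X v = - br X Y v.
Proof.
case: X Y => [s1 n| |] [s2 m| |]; rewrite ?br_loop /br /= ?big_seq1 ?big_nil ?oppr0 //=;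
  rewrite -?scaleNr ?opprK //.
rewrite opprD [n + m]addrC; congr (_ + _); last first.
  case: eqP => mn; rewrite ?oppr0 // -scaleNr; congr (_ *: _).
  have -> : n = - m by lia.
  by case: s1; case: s2; rewrite /= mulrNz; ring.
by case: s1; case: s2; rewrite /= ?big_seq1 ?big_nil ?oppr0 -?scaleNr ?opprK.
Qed.

Definition commutes X Y v := ac X (ac Y v) - ac Y (ac X v) = br X Y v.

Lemma commutes_sym X Y v : commutes X Y v -> commutes Y X v.
Proof. by rewrite /commutes => E; rewrite br_anti -E opprB. Qed.

Section Homogeneous.
Variables (y : hs_lat V) (d : int) (v : V).
Hypotheses (Ly : L y) (hv : homog y d v).
Let Cv : C v. Proof. exact: C_homog hv. Qed.

Let ha j : homog (x + y) (d + j) (a j v).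
Proof. exact: (graded_homog _ (graded_a x) hv). Qed.
Let hf j : homog (- x + y) (d + j) (f j v).
Proof. exact: (graded_homog _ (graded_f x) hv). Qed.
Let h4 n : homog y (d - n) (4 *: cur true n v).
Proof. exact: (subZ (homog_sub _ _) _ (cur_homog _ _ hv)). Qed.

Lemma commutes_ee n m : commutes (Loop sl2e n) (Loop sl2e m) v.
Proof.
rewrite /commutes br_loop /= big_nil add0r !(ac_e _ Ly hv).
rewrite !(ac_e _ (Lx Ly) (ha _)) Nx // (aaC chgx) subrr.
by case: ifP => //; rewrite mulr0 scale0r.
Qed.

Lemma commutes_ff n m : commutes (Loop sl2f n) (Loop sl2f m) v.
Proof.
rewrite /commutes br_loop /= big_nil add0r !(ac_f _ Ly hv).
rewrite !(ac_f _ (LNx Ly) (hf _)) NNx // (ffC chgx) subrr.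
by case: ifP => //; rewrite mulr0 scale0r.
Qed.

(** The level appears here: 16 <delta,delta> = - 8/3 is (h,h) = 2 times - 4/3. *)
Lemma commutes_hh n m : commutes (Loop sl2h n) (Loop sl2h m) v.
Proof.
rewrite /commutes br_loop /= big_nil add0r !(ac_h _ Ly hv) !(ac_h _ Ly (h4 _)).
rewrite !(linZ (cur_lin _ _)) (cur_comm true true n m) osc_form_values ac_c //.
case: ifP => _; lmod (hs_vec V).
Qed.

Lemma commutes_he n m : commutes (Loop sl2h n) (Loop sl2e m) v.
Proof.
rewrite /commutes br_loop /= big_seq1 /= mulr0 scale0r if_same addr0.
rewrite (ac_h _ Ly hv) !(ac_e _ Ly hv) (ac_e _ Ly (h4 _)) (ac_h _ (Lx Ly) (ha _)).
rewrite (a_cur chgx) (linZ (lin_a _ _)).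
have -> : - m - 1 - N y - n = - (n + m) - 1 - N y by lia.
lmod (hs_vec V).
Qed.

Lemma commutes_hf n m : commutes (Loop sl2h n) (Loop sl2f m) v.
Proof.
rewrite /commutes br_loop /= big_seq1 /= mulr0 scale0r if_same addr0.
rewrite (ac_h _ Ly hv) !(ac_f _ Ly hv) (ac_f _ Ly (h4 _)) (ac_h _ (LNx Ly) (hf _)).
rewrite (f_delta chgx) (linZ (lin_f _ _)).
have -> : 1 + N y - m - n = 1 + N y - (n + m) by lia.
lmod (hs_vec V).
Qed.

(** With j = 1 + N y - m, the diagonal value 4 gamma(0) + 4/3 (1 - j) equals 4 (gamma(0) - N y / 3)
    + 4/3 m, which is h(0) + n c because m = - n. *)
Lemma commutes_ef n m : commutes (Loop sl2e n) (Loop sl2f m) v.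
Proof.
rewrite /commutes br_loop /= big_seq1 /= mulr1 scale1r.
rewrite (ac_e _ Ly hv) !(ac_f _ Ly hv) (ac_e _ (LNx Ly) (hf _)) (ac_f _ (Lx Ly) (ha _)).
rewrite Nx // NNx // (afC chgx) (ac_h _ Ly hv) ac_c // /af_comm.
have -> : - n - 1 - N y + (1 + N y - m) = - (n + m) by lia.
rewrite oppr_eq0 opprK; case: eqP => [nm|_]; last by lmod (hs_vec V).
rewrite nm !(cur0 _ hv) chg_delta // (_ : m = - n); last by lia.
rewrite opprK intrD intrD; lmod (hs_vec V).
Qed.

Lemma commutes_d s n : commutes Der (Loop s n) v.
Proof.
rewrite /commutes /br /= big_seq1 (ac_d Ly hv) acZ //.
case: s => /=.
- rewrite !(ac_e _ Ly hv) (ac_d (Lx Ly) (ha _)) wtx // !intrD !mulrNz; lmod (hs_vec V).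
- rewrite !(ac_f _ Ly hv) (ac_d (LNx Ly) (hf _)) wtNx // !intrD !mulrNz; lmod (hs_vec V).
- rewrite !(ac_h _ Ly hv) (ac_d Ly (h4 _)) !intrD !mulrNz; lmod (hs_vec V).
Qed.

Lemma commutes_all X Y : commutes X Y v.
Proof.
have cen Z : commutes Cen Z v.
  rewrite /commutes /br; have -> : ghat_bracket F Cen Z = [::] by case: Z.
  by rewrite big_nil !ac_c ?acZ ?subrr //; apply: ac_C.
have dd : commutes Der Der v by rewrite /commutes /br big_nil subrr.
case: X Y => [s1 n| |] [s2 m| |] //; do ?[exact: commutes_d | exact/commutes_sym/cen |
  exact/commutes_sym/commutes_d].
case: s1; case: s2; do ?[exact: commutes_ee | exact: commutes_ff | exact: commutes_hh |
  exact: commutes_he | exact: commutes_hf | exact: commutes_ef];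
  apply: commutes_sym; do ?[exact: commutes_he | exact: commutes_hf | exact: commutes_ef].
Qed.
End Homogeneous.

Lemma affine_module : is_module M.
Proof.
split; [exact: subC|exact: ac_C|exact: ac_lin|].
move=> X Y v Cv; apply: (proj2 (_ : C v /\ commutes X Y v)).
apply: (@C_span [set v | C v /\ commutes X Y v]) Cv => [|y d u Ly hu]; last first.
  by split; [exact: C_homog hu|exact: (commutes_all Ly hu)].
split.
  split; first exact: (sub0 subC).
  by rewrite /commutes !ac0 subrr /br big1 // => q _; rewrite ac0 scaler0.
move=> k u w [Cu Eu] [Cw Ew]; split; first exact: (subP subC).
rewrite /commutes !ac_lin ?br_lin //; do ?exact: ac_C.
by rewrite -Eu -Ew opprD addrACA -scalerBr.
Qed.

(** * Irreducibility of the module generated by a vacuum *)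

Section HighestWeightVector.
Variable y0 : hs_lat V.
Hypothesis Ly0 : L y0.
Hypothesis Ny0 : 0 <= N y0.
Hypothesis g_y0 : chg false y0 = 0 \/ chg false y0 = - (1 / 6).
Hypothesis f_y0 : forall n, 0 < n -> ac (Loop sl2f n) (vac y0) = 0.
Let v0 : V := vac y0.
Let Cv0 : C v0. Proof. exact: C_homog Ly0 (homog_vac _). Qed.
Definition hw : weight F := (4 * chg true y0, - (4 / 3), kappa - wt y0).

Lemma hw_weight : @has_weight F M hw v0.
Proof.
split=> /=; first by rewrite (ac_h _ Ly0 (homog_vac _)) cur0_vac scalerA.
  by rewrite ac_c.
by rewrite (ac_d Ly0 (homog_vac _)) subr0.
Qed.

Lemma hw_nplus X : ghat_nplus X -> ac X v0 = 0.
Proof.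
case: X => [[] n| |] //= n0; last 1 first.
- by rewrite (ac_h _ Ly0 (homog_vac _)) cur_vac // scaler0.
- by rewrite (ac_e _ Ly0 (homog_vac _)) (graded_vac_lt0 _ (graded_a x)) //; lia.
- exact: f_y0.
Qed.

Lemma hw_singular : @singular F M v0.
Proof.
split; [exact: Cv0|exact/eqP/vac_neq0|by exists hw; exact: hw_weight|exact: hw_nplus].
Qed.

Definition chain (n : int) := y0 + x *~ n.

Lemma chain_add n m : chain n + x *~ m = chain (n + m).
Proof. by rewrite /chain mulrzDr addrA. Qed.
Lemma chain_up n : x + chain n = chain (n + 1).
Proof. by rewrite addrC -chain_add. Qed.
Lemma chain_down n : - x + chain n = chain (n - 1).
Proof. by rewrite addrC -chain_add. Qed.

Lemma chain_LN n : [/\ L (chain n), N (chain n) = N y0,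
  wt (chain n) = wt y0 + n%:~R * ((N y0)%:~R + 1) &
  forall c, chg c (chain n) = chg c y0 + n%:~R / 2].
Proof.
have chain0 : chain 0 = y0 by rewrite /chain addr0.
case: n => n; elim: n => [|n [Ln Nn Wn cn]].
- by rewrite chain0; split=> // [|c]; rewrite ?mul0r addr0.
- rewrite (_ : n.+1%:Z = n%:Z + 1) -?chain_up; last by lia.
  split=> [||| c]; rewrite ?Nx ?wtx //; first exact: Lx.
    by rewrite Wn Nn intrD; ring.
  by rewrite chgD chgx cn intrD; field.
- rewrite (_ : Negz 0 = 0 - 1) // -chain_down chain0; split=> [||| c].
  + exact: LNx.
  + exact: NNx.
  + by rewrite wtNx // intrB; ring.
  + by rewrite chgD chgN chgx intrB; field.
- rewrite (_ : Negz n.+1 = Negz n - 1) -?chain_down; last by lia.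
  split=> [||| c]; rewrite ?NNx ?wtNx //; first exact: LNx.
    by rewrite Wn Nn intrB; ring.
  by rewrite chgD chgN chgx cn intrB; field.
Qed.

(** The indices (charge in the chain, degree) are kept distinct because [eigen_split] needs distinct
    pairs of eigenvalues of h(0) and d. *)
Definition graded_sum v := exists (s : seq (int * int)) (u : int * int -> V),
  [/\ uniq s, forall k, homog (chain k.1) k.2 (u k) & v = \sum_(k <- s) u k].

Lemma graded_sum_homog n d v : homog (chain n) d v -> graded_sum v.
Proof.
move=> hv; exists [:: (n, d)], (fun k => if k == (n, d) then v else 0); split=> //.
  by move=> k; case: eqP => [->|_] //; apply: (sub0 (homog_sub _ _)).
by rewrite big_seq1 eqxx.
Qed.

Lemma graded_sum_sub : subspace graded_sum.
Proof.
split; first by exists [::], (fun=> 0); split=> // [k|]; rewrite ?big_nil //;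
  apply: (sub0 (homog_sub _ _)).
move=> e v1 v2 [s1 [u1 [U1 h1 ->]]] [s2 [u2 [U2 h2 ->]]].
pose s := undup (s1 ++ s2).
have sumE s' (u : int * int -> V) : uniq s' -> {subset s' <= s1 ++ s2} ->
    \sum_(k <- s) (if k \in s' then u k else 0) = \sum_(k <- s') u k.
  move=> Us' sub; rewrite -big_mkcond -big_filter; apply: perm_big; apply: uniq_perm => //.
    by rewrite filter_uniq ?undup_uniq.
  move=> k; rewrite mem_filter mem_undup /=.
  by case: (boolP (k \in s')) => // /sub ->.
exists s, (fun k => e *: (if k \in s1 then u1 k else 0) + (if k \in s2 then u2 k else 0)).
split; first exact: undup_uniq.
  move=> k; apply: (subP (homog_sub _ _)); case: ifP => _ //; exact: (sub0 (homog_sub _ _)).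
by rewrite big_split -scaler_sumr /= !sumE // => k ks; rewrite mem_cat ks ?orbT.
Qed.

Lemma orbit_graded_sum v : @Uorbit F M v0 v -> C v /\ graded_sum v.
Proof.
elim=> {v} [||e u w _ [Cu su] _ [Cw sw]|X u _ [Cu [s [w [Us hw ->]]]]].
- split; first exact: Cv0.
  by apply: (@graded_sum_homog 0 0); rewrite /chain addr0; apply: homog_vac.
- by split; [exact: (sub0 subC)|exact: (sub0 graded_sum_sub)].
- by split; [exact: (subP subC)|exact: (subP graded_sum_sub)].
have Cw k : C (w k) by have [Lk _ _ _] := chain_LN k.1; apply: C_homog (hw k).
split; first by apply: ac_C; apply: (sub_sum subC).
rewrite /= (_ : ac X _ = \sum_(k <- s) ac X (w k)); last first.
  elim: s {Us} => [|k s IHs]; first by rewrite !big_nil ac0.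
  by rewrite !big_cons (linonD (ac_lin X)) ?IHs //; apply: (sub_sum subC).
apply: (sub_sum graded_sum_sub) => k _.
have [Lk _ _ _] := chain_LN k.1.
have [y' [d' [_ h' [j yE]]]] := ac_homog X Lk (hw k).
by apply: (@graded_sum_homog (k.1 + j) d'); rewrite -chain_add -yE.
Qed.

Section Submodule.
Variable W : set V.
Hypothesis subW : subspace W.
Hypothesis W_orbit : forall v, W v -> @Uorbit F M v0 v.
Hypothesis W_ac : forall X v, W v -> W (ac X v).

(** Descent on the degree: while some positive mode of delta or negative mode of e^x does not kill
    the vector, its image is nonzero, of smaller degree, and still in [W]. *)
Lemma submodule_vacuum n d w : W w -> homog (chain n) d w -> w <> 0 ->
  exists m, W (vac (chain m)).
Proof.
have [D] := ubnP `|d|%N; elim: D n d w => // D IHD n d w dD Ww hw w0.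
have [Ln Nn _ _] := chain_LN n.
have d_ge0 : 0 <= d by rewrite leNgt; apply/negP => /(homog_lt0 hw).
have [dz|d_neq0] := eqVneq d 0.
  exists n; move: hw; rewrite dz => /homog0[e we]; apply: (sub_Zunit subW (a := e)).
    by apply/eqP => e0; apply: w0; rewrite we e0 scale0r.
  by rewrite -we.
have [[k kw]|nocur] := pselect (exists k : nat, cur true k.+1 w <> 0).
  have hk := cur_homog true k.+1 hw.
  have [d0|d0] := ltP (d - k.+1%:Z) 0; first by case: kw; apply: homog_lt0 hk d0.
  apply: (IHD n (d - k.+1%:Z) (cur true k.+1 w)) => //; first by lia.
  apply: (sub_Zunit subW (a := 4)); first by rewrite pnatr_eq0.
  by rewrite -(ac_h _ Ln hw); apply: W_ac.
have [[i iw]|noa] := pselect (exists i : nat, a (- i.+1%:Z) w <> 0).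
  have hi := graded_homog (- i.+1%:Z) (graded_a x) hw; rewrite chain_up in hi.
  have [d0|d0] := ltP (d - i.+1%:Z) 0; first by case: iw; apply: homog_lt0 hi d0.
  apply: (IHD _ _ _ _ _ hi) => //; first by lia.
  (* The mode of e whose degree shift on this chain is exactly - i - 1. *)
  have := W_ac (Loop sl2e (i%:Z - N y0)) Ww; rewrite (ac_e _ Ln hw) Nn.
  by congr (W (a _ _)); lia.
case: w0; apply: (homog_kernel hw) => // c k.
have cur0w : cur true k.+1 w = 0 by apply: contrapT => kw; apply: nocur; exists k.
case: c => //.
have : xcur (V := V) 3 (- 3) k.+1 w = 0.
  apply: (vx_descent (dir_x chgx)) => i; rewrite -/(a (- i.+1%:Z) _).
  by apply: contrapT => iw; apply: noa; exists i.
rewrite /xcur cur0w scaler0 addr0 => /eqP.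
by rewrite scaler_eq0 pnatr_eq0 => /eqP.
Qed.

(** [vac (chain n)] has the [principal_op] eigenvalue of layer n (2 N y0 + 1), and [orbit_eigen]
    only allows layers of nonnegative index. *)
Lemma submodule_chain_ge0 n : W (vac (chain n)) -> 0 <= n.
Proof.
move=> /W_orbit Un; have [Ln Nn wn cn] := chain_LN n.
have [||k muE _] := @orbit_eigen F M affine_module hw v0 Cv0 hw_weight hw_nplus
  (4 * chg true (chain n) + 4 * (kappa - wt (chain n))) _ Un.
- rewrite /principal_op /= (ac_h _ Ln (homog_vac _)) (ac_d Ln (homog_vac _)).
  by rewrite cur0_vac subr0 !scalerA -scalerDl.
- exact/eqP/vac_neq0.
have : (n * (2 * N y0 + 1))%:~R = k%:~R :> F.
  move: muE; rewrite wn cn /hw /= natrM !(intrM, intrD) -pmulrn => muE.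
  apply: (mulfI (_ : 2 != 0 :> F)); first by rewrite pnatr_eq0.
  apply/eqP; rewrite -subr_eq0; apply/eqP.
  rewrite -[RHS](subrr (4 * chg true y0 + 4 * (kappa - wt y0) - 2 * k%:R)) -{2}muE.
  by field.
by move/intr_inj => nk; nia.
Qed.

Lemma submodule_top (n : nat) : W (vac (chain n)) -> W v0.
Proof.
elim: n => [|n IHn]; first by rewrite /chain addr0.
have [Ln Nn _ cn] := chain_LN n.+1.
move=> /(W_ac (Loop sl2f (1 + N y0))); rewrite (ac_f _ Ln (homog_vac _)) Nn subrr.
rewrite f0_vac chain_down (_ : n.+1%:Z - 1 = n); last by lia.
move=> Wn; apply/IHn/(sub_Zunit subW _ Wn).
(* The charge is m/6 with m positive, namely 3 (n + 1) or 3 n + 2 according to [g_y0]. So neither it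
   nor its sum with 1/6 vanishes, and these are the factors of f_0. *)
have [m [m0 gE]] : exists m : nat, (0 < m)%N /\
    (chg false (chain n.+1) = m%:R / 6 /\ chg false (chain n.+1) + 1 / 6 = (m + 1)%:R / 6).
  rewrite cn -pmulrn; case: g_y0 => ->.
    by exists (3 * n.+1)%N; split=> //; rewrite natrD natrM; split; field.
  exists (3 * n + 2)%N; split; first by lia.
  by rewrite natrD natrD natrM -natr1; split; field.
case: gE => g1 g2.
rewrite (_ : _ - _ = - 4 * (chg false (chain n.+1) * (chg false (chain n.+1) + 1 / 6))).
  by rewrite g2 g1 !mulf_neq0 ?oppr_eq0 ?invr_eq0 ?pnatr_eq0 //; lia.
by field.
Qed.

Lemma submodule_full w : W w -> w <> 0 -> W v0.
Proof.
move=> Ww w0; have [Cw [s [u [Us hu wE]]]] := orbit_graded_sum (W_orbit Ww).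
have Cu k : C (u k) by have [Lk _ _ _] := chain_LN k.1; apply: C_homog (hu k).
pose wi i := u (nth (0, 0) s i).
(* h(0) determines the position in the chain, and d then determines the degree. *)
pose op (t : bool) := ac (if t then Loop sl2h 0 else Der).
pose mu (t : bool) i : F := let k := nth (0, 0) s i in
  if t then 4 * chg true (chain k.1) else kappa - k.2%:~R - wt (chain k.1).
have W_comp i : (i < size s)%N -> W (wi i).
  apply: (@eigen_split _ _ C W bool op mu (size s) wi) => //.
  - by move=> t e u1 u2; apply: ac_lin.
  - by move=> t u1; apply: W_ac.
  - move=> i1 i2 i1s i2s mu12; apply/eqP; rewrite -(nth_uniq (0, 0) i1s i2s Us); apply/eqP.
    have [Nk1 Nk2] := (chain_LN (nth (0, 0) s i1).1, chain_LN (nth (0, 0) s i2).1).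
    case: Nk1 Nk2 => _ _ w1 c1 [_ _ w2 c2].
    have e1 : (nth (0, 0) s i1).1 = (nth (0, 0) s i2).1.
      have := mu12 true; rewrite /mu c1 c2 => /(mulfI (_ : 4 != 0 :> F)).
      rewrite pnatr_eq0 => /(_ isT) /addrI /(mulIf (_ : 2^-1 != 0 :> F)).
      by rewrite invr_eq0 pnatr_eq0 => /(_ isT) /intr_inj.
    have e2 : (nth (0, 0) s i1).2 = (nth (0, 0) s i2).2.
      have := mu12 false; rewrite /mu e1 => /addIr /addrI /oppr_inj.
      exact: intr_inj.
    by rewrite [LHS]surjective_pairing e1 e2 -surjective_pairing.
  - move=> j js; split; first exact: Cu.
    have [Lk _ _ _] := chain_LN (nth (0, 0) s j).1.
    case; rewrite /op /mu /wi.
      by rewrite (ac_h _ Lk (hu _)) (cur0 _ (hu _)) scalerA.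
    by rewrite (ac_d Lk (hu _)).
  - by have := wE; rewrite (big_nth (0, 0)) big_mkord => <-.
have [i is_ wi0] : exists2 i, (i < size s)%N & wi i <> 0.
  apply: contrapT => no_i; case: w0; rewrite wE (big_nth (0, 0)) big_mkord big1 // => i _.
  by apply: contrapT => ui; apply: no_i; exists i.
have [m Wm] := submodule_vacuum (W_comp i is_) (hu _) wi0.
have := submodule_chain_ge0 Wm; case: m Wm => // m Wm _; exact: submodule_top Wm.
Qed.
End Submodule.

Theorem hw_irreducible : irreducible_highest_weight hw (@Usub F M v0).
Proof.
have modM := affine_module.
split; first exact: Usub_module.
- split; first by exists v0; [exact: Uorbit_gen|exact/eqP/vac_neq0].
  move=> W [W_sub subW W_act].
  have [[w Ww w0]|noW] := pselect (exists2 w, W w & w <> 0).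
    right; apply/seteqP; split=> // u Uu; have Wv0 := submodule_full subW W_sub W_act Ww w0.
    elim: Uu => {u} [||e u u' _ Wu _ Wu'|X u _ Wu] //.
    - exact: (sub0 subW).
    - exact: (subP subW).
    - exact: W_act.
  left; apply/seteqP; split=> [w Ww|w ->]; last exact: (sub0 subW).
  by apply: contrapT => w0; apply: noW; exists w.
- exists v0; split; [|exact: hw_weight|by rewrite Usub_orbit].
  by have [_ v0_neq0 ? ?] := hw_singular; split=> //; exact: Uorbit_gen.
Qed.

Theorem hw_isomorphic : isomorphic_to_L hw (@Usub F M v0).
Proof.
split=> [|M' irrM']; first exact: hw_irreducible.
exact: irreducible_highest_weight_unique hw_irreducible irrM'.
Qed.
End HighestWeightVector.
End AffineAction.

(** * The field of the vacuum and the degree operator *)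

Section IdentityField.
Variables (F : numFieldType) (V : heis_space F).
Implicit Types (v u : V) (y : hs_lat V) (c : bool).

Definition fld_id (j : int) v : V := if j == 0 then v else 0.

Lemma graded_id : graded 0 fld_id.
Proof.
split=> [j|j y d v hv].
  rewrite /fld_id; case: (j == 0); [exact: lin_id|exact: lin_zero].
rewrite /fld_id; have [->|_] := eqVneq j 0; first by rewrite add0r addr0.
exact: (sub0 (homog_sub _ _)).
Qed.

Lemma np_defE c w (B : int -> V -> V) j v : np c w B j v = np_def c w B j v.
Proof. by rewrite np_unlock. Qed.

Lemma np_id c w n v : np c w fld_id (- n) v = w n *: cur c n v.
Proof.
have [K E] := np_ev c w (- n) v graded_id.
have idN j u : j != 0 -> fld_id j u = 0 by rewrite /fld_id => /negPf ->.
have id0 u : fld_id 0 u = u by [].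
rewrite (E (K + `|n|).+1); last by lia.
have: (`|n| < (K + `|n|).+1)%N by lia.
move: (K + `|n|).+1 => m {E}; rewrite /np_trunc; case: n => n nm.
- rewrite big1 ?add0r => [|k _]; last first.
    by rewrite idN ?(lin0 (cur_lin _ _)) ?scaler0 //; apply/eqP; lia.
  rewrite (bigD1 (Ordinal nm)) //= addNr id0 big1 ?addr0 // => k kn.
  rewrite idN ?scaler0 //; apply/eqP => e; move: kn; rewrite -val_eqE /= => /eqP; lia.
- have {}nm : (n < m)%N by lia.
  rewrite [X in _ + X]big1 ?addr0 => [|k _]; last first.
    by rewrite idN ?scaler0 //; apply/eqP; lia.
  rewrite (bigD1 (Ordinal nm)) //= NegzE opprK subrr id0 big1 ?addr0 // => k kn.
  rewrite idN ?(lin0 (cur_lin _ _)) ?scaler0 //; apply/eqP => e; move: kn.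
  by rewrite -val_eqE /= => /eqP; lia.
Qed.

Lemma vx_id j v : vx 0 0 0 j v = fld_id j v.
Proof.
have A0 (A : nat -> V -> V) : (forall n u, A n u = 0) ->
    forall n u, (0 < n)%N -> sexp A n u = 0.
  move=> A0 n u n0; apply: sexp_unit => // [k a1 v1 v2|i k u'].
    by rewrite !A0 scaler0 addr0.
  by rewrite !A0.
have ep00 n u : (0 < n)%N -> ep (V := V) 0 0 n u = 0.
  apply: A0 => i u'; rewrite /ep_arg /xcur !scale0r addr0 scaler0 oppr0.
  by case: ifP.
have em00 n u : (0 < n)%N -> em (V := V) 0 0 n u = 0.
  apply: A0 => i u'; rewrite /em_arg /xcur !scale0r addr0 scaler0.
  by case: ifP.
rewrite (@vxE _ _ _ _ _ _ _ 1%N) => [|i i0]; last exact: ep00.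
rewrite big_ord1 /= addr0 ep0 shf0 /fld_id /emz.
by case: j => [[|j]|j] //=; [rewrite em0|rewrite em00].
Qed.

Definition cur_field c (j : int) v : V := cur c (- j) v.

Lemma graded_cur_field c : graded 0 (cur_field c).
Proof.
split=> [j|j y d v hv]; first exact: cur_lin.
by rewrite add0r; have := cur_homog c (- j) hv; rewrite opprK.
Qed.

Lemma np_cur_field c j v : np c (fun=> 1) fld_id j v = cur_field c j v.
Proof. by rewrite -{1}[j]opprK np_id scale1r. Qed.

(** The zero mode, in the degree indexing, of the normally ordered square of a current. *)
Definition np2 c v : V := np c (fun=> 1) (cur_field c) 0 v.

Lemma np2_cur c' k c v : cur c' k (np2 c v) = np2 c (cur c' k v) +
  (2 * k%:~R * osc_form F c' c) *: cur c k v.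
Proof.
pose e : F := k%:~R * osc_form F c' c.
pose B j v : V := e *: fld_id j v + 0 *: fld_id j v.
have gB : graded 0 B by apply: graded_linear; exact: graded_id.
rewrite /np2 (np_cur _ _ _ _ (graded_cur_field c) gB) => [|j u].
  rewrite (np_linear _ _ _ _ _ _ graded_id graded_id) sub0r np_id /cur_field opprK.
  by congr (_ + _); rewrite /e; lmod (hs_vec V).
rewrite /cur_field cur_comm /B /fld_id -[j - k]opprB oppr_eq0; congr (_ + _).
case: (k - j == 0); last by rewrite !scaler0 scale0r addr0.
by rewrite scale0r addr0.
Qed.

Lemma np2_homog c y d v : homog y d v -> homog y d (np2 c v).
Proof.
move=> hv; have := graded_homog 0 (np_graded c (fun=> 1) (graded_cur_field c)) hv.
by rewrite add0r addr0.
Qed.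

Lemma np2_lin c : lin (np2 c).
Proof. exact: graded_lin (np_graded c (fun=> 1) (graded_cur_field c)). Qed.

Lemma np2_vac c y : np2 c (vac y) = chg c y ^+ 2 *: vac y.
Proof.
rewrite /np2 (np_vac _ _ 0 y (graded_cur_field c)) big_ord0 add0r /cur_field oppr0.
by rewrite cur0_vac scalerA mul1r.
Qed.

(** Commuting c(k) past the left side adds k, because 6 <gamma,gamma> = - 6 <delta,delta> = 1. By
    induction on the degree, the difference of the two sides is therefore killed by all positive
    modes. *)
Lemma np2_degree y d v : homog y d v -> 3 *: np2 false v - 3 *: np2 true v =
  (d%:~R + 3 * chg false y ^+ 2 - 3 * chg true y ^+ 2) *: v.
Proof.
have [D] := ubnP `|d|%N; elim: D d v => // D IHD d v dD hv.
apply/eqP; rewrite -subr_eq0; apply/eqP.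
pose k0 : F := d%:~R + 3 * chg false y ^+ 2 - 3 * chg true y ^+ 2.
pose u := 3 *: np2 false v - 3 *: np2 true v - k0 *: v; change (u = 0).
have hu : homog y d u.
  apply: (subB (homog_sub _ _)); last exact: (subZ (homog_sub _ _)).
  by apply: (subB (homog_sub _ _)); apply: (subZ (homog_sub _ _)); apply: np2_homog.
have [d0|d0] := ltP d 0; first exact: homog_lt0 hu d0.
have [dz|dn] := eqVneq d 0.
  move: hv @u {hu}; rewrite dz => /homog0[e ->].
  by rewrite !(linZ (np2_lin _)) !np2_vac /k0 dz; lmod (hs_vec V).
apply: (homog_kernel hu) => // c k; rewrite /u.
have hk := cur_homog c k.+1 hv.
have E : 3 *: np2 false (cur c k.+1 v) - 3 *: np2 true (cur c k.+1 v) =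
    ((d - k.+1%:Z)%:~R + 3 * chg false y ^+ 2 - 3 * chg true y ^+ 2) *: cur c k.+1 v.
  have [lt0|ge0] := ltP (d - k.+1%:Z) 0; last by apply: IHD => //; lia.
  by rewrite (homog_lt0 hk lt0) !(lin0 (np2_lin _)) !scaler0 subr0.
rewrite !(linB (cur_lin _ _)) !(linZ (cur_lin _ _)) !np2_cur.
have -> : 3 *: (np2 false (cur c k.+1 v) + (2 * k.+1%:~R * osc_form F c false) *: cur false k.+1 v) -
    3 *: (np2 true (cur c k.+1 v) + (2 * k.+1%:~R * osc_form F c true) *: cur true k.+1 v) =
    (3 *: np2 false (cur c k.+1 v) - 3 *: np2 true (cur c k.+1 v)) + k.+1%:R *: cur c k.+1 v.
  by case: c {hk E}; rewrite !osc_form_values -pmulrn; lmod (hs_vec V).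
rewrite E /k0 intrB -pmulrn; lmod (hs_vec V).
Qed.

(** The Schur polynomial of degree 2 in the x(-k), needed to expand the screening operator [Q] in
    f. *)
Lemma em2 (x : hs_lat V) (p q : F) v :
  (forall c, chg c x = p * osc_form F c false + q * osc_form F c true) ->
  em p q 2 v = 2^-1 *: (xcur p q (- 1) (xcur p q (- 1) v) + xcur p q (- 2) v).
Proof.
move=> chgx.
have newton := sexp_newton (em_arg_lin p q) (fun u => erefl) (em_argC chgx).
have em1 u : em p q 1 u = xcur p q (- 1) u.
  have := newton 1%N u; rewrite !big_ord_recl big_ord0 /= scale0r add0r addr0 !scale1r.
  by rewrite sexp0 /em => ->; rewrite /em_arg /= invr1 scale1r.
have := newton 2 v; rewrite !big_ord_recl big_ord0 /= scale0r add0r addr0 scale1r.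
rewrite sexp0 -[sexp _ _ v]/(em p q 2 v) -[sexp _ _ v]/(em p q 1 v) em1 => e2.
rewrite -[em p q 2 v](scalerK (_ : 2 != 0)) ?pnatr_eq0 // e2 /em_arg /=.
by congr (_ *: (_ + _)); rewrite ?invr1 ?scale1r // scalerA divff ?scale1r // pnatr_eq0.
Qed.

(** The zero mode terms and p_0 carry the charge, which is 0; the remaining creation term of [s] has
    weight - (k + 1), which vanishes at k = - 1. *)
Lemma f1_vac (x : hs_lat V) y : chg false y = 0 -> fld_f x 1 (vac y) = 0.
Proof.
move=> g0; rewrite fld_fE /fld_r /fld_s (np_vac _ _ 1 y (graded_p x)) (np_vac _ _ 1 y (graded_b x)).
rewrite !big_ord1 g0 subrr p0_vac g0 scale0r (lin0 (cur_lin _ _)) addNr oppr0.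
lmod (hs_vec V).
Qed.
End IdentityField.

(** * The Fock space of the lattice *)

Definition mset_deg (m : {mset osc}%mset) : nat := \sum_(o <- enum_mset m) o.2.+1.

Lemma mset_deg0 : mset_deg mset0 = 0%N.
Proof. by rewrite /mset_deg enum_mset0 big_nil. Qed.

Lemma mset_degD1 o m : mset_deg (msetD [mset o]%mset m) = (o.2.+1 + mset_deg m)%N.
Proof.
rewrite /mset_deg.
transitivity (\sum_(o' <- o :: enum_mset m) o'.2.+1)%N; last by rewrite big_cons.
apply: perm_big.
by apply/allP => x _ /=; rewrite !count_mem_mset mset1DE [o == x]eq_sym.
Qed.

Lemma mset_degB1 o m : o \in m ->
  mset_deg m = (o.2.+1 + mset_deg (msetB m [mset o]%mset))%N.
Proof. by move=> om; rewrite -mset_degD1 msetB1K. Qed.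

Lemma mset_neq0_mem (m : {mset osc}%mset) : m != mset0 -> exists o, o \in m.
Proof.
move=> m0; case E : (enum_mset m) => [|o s]; last first.
  by exists o; change (o \in enum_mset m); rewrite E mem_head.
case/eqP: m0; apply/msetP => o; rewrite mset0E; apply/eqP; rewrite mset_eq0.
by change (o \notin enum_mset m); rewrite E.
Qed.

Lemma mset_deg_eq0 m : mset_deg m = 0%N -> m = mset0.
Proof.
by move=> m0; apply/eqP/contraT => /mset_neq0_mem[o /mset_degB1]; rewrite m0.
Qed.

Lemma mset_ind (P : {mset osc}%mset -> Prop) : P mset0 ->
  (forall o m, P m -> P (msetD [mset o]%mset m)) -> forall m, P m.
Proof.
move=> P0 PD m; have [n] := ubnP (mset_deg m); elim: n m => // n IHn m mn.
have [->//|/mset_neq0_mem[o om]] := eqVneq m mset0.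
rewrite -(msetB1K om); apply/PD/IHn.
by move: mn; rewrite (mset_degB1 om); lia.
Qed.

Section Fock.
Variable F : numFieldType.
Local Notation V := (Vlat F).
Implicit Types (v u : V) (x y : lat) (c : bool).

Lemma extend_linw (f : state -> V) v (d : {fset state}) :
  (msupp v `<=` d)%fset -> extend_lin f v = \sum_(k <- d) v@_k *: f k.
Proof.
move=> sub; rewrite /extend_lin (big_fset_incl _ sub) // => k _ kv.
by rewrite mcoeff_outdom ?scale0r.
Qed.

Lemma extend_lin_is_lin (f : state -> V) : lin (extend_lin f).
Proof.
move=> a u v; pose d := (msupp u `|` msupp v)%fset.
have du : (msupp u `<=` d)%fset by exact: fsubsetUl.
have dv : (msupp v `<=` d)%fset by exact: fsubsetUr.
have duv : (msupp (a *: u + v) `<=` d)%fset.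
  by apply: (fsubset_trans (msuppD_le _ _)); apply: fsetSU; apply: msuppZ_le.
rewrite (extend_linw _ duv) (extend_linw _ du) (extend_linw _ dv).
rewrite scaler_sumr -big_split; apply: eq_bigr => k _ /=.
by rewrite mcoeffD mcoeffZ scalerDl scalerA.
Qed.

Lemma extend_lin_basis (f : state -> V) m y : extend_lin f (basis F m y) = f (m, y).
Proof. by rewrite /extend_lin /basis msuppU oner_eq0 big_seq_fset1 mcoeffUU scale1r. Qed.

Lemma basis_decomp v : v = \sum_(k <- msupp v) v@_k *: basis F k.1 k.2.
Proof.
rewrite [LHS]monalgE; apply: eq_bigr => -[m y] _.
apply/malgP => k; rewrite [RHS]mcoeffZ /basis [in RHS]mcoeffU mcoeffU.
by rewrite mulr_natr.
Qed.

Lemma basis_ind (P : set V) : subspace P -> forall v,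
  (forall k, k \in msupp v -> P (basis F k.1 k.2)) -> P v.
Proof.
move=> sP v Pb; rewrite [v]basis_decomp big_seq.
by apply: (sub_sum sP) => k /Pb; apply: (subZ sP).
Qed.

Lemma eq_lin_basis (f g : V -> V) v : lin f -> lin g ->
  (forall k, k \in msupp v -> f (basis F k.1 k.2) = g (basis F k.1 k.2)) -> f v = g v.
Proof.
move=> lf lg; apply: (@basis_ind [set v | f v = g v]); split=> /= [|a u w].
  by rewrite !lin0.
by rewrite lf lg => -> ->.
Qed.

Lemma heis_lin c n : lin (@heis F c n).
Proof. exact: extend_lin_is_lin. Qed.

Definition charge c y : F := (if c then - y.2%:~R else y.1%:~R) / 6.

Lemma ratr_lat_form c y : ratr (lat_form (osc_vec c) y) = charge c y.
Proof.
rewrite /lat_form /charge fmorph_div rmorphB !rmorphM /= !ratr_int ratr_nat.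
by case: c => /=; rewrite ?mul0r ?mul1r ?sub0r ?subr0.
Qed.

Lemma chargeD c x y : charge c (x + y) = charge c x + charge c y.
Proof. by rewrite /charge; case: c; rewrite -mulrDl ?intrD ?opprD. Qed.

Lemma charge_osc c c' : charge c (osc_vec c') = osc_form F c c'.
Proof. by rewrite /charge /osc_form; case: c; case: c' => /=; rewrite ?oppr0 ?mul0r ?mulNr. Qed.

Lemma osc_form_neq0 c : osc_form F c c != 0.
Proof.
by rewrite /osc_form eqxx; case: c; rewrite ?oppr_eq0 mul1r invr_eq0 pnatr_eq0.
Qed.

Lemma heis_neg c p m y :
  heis c (Negz p) (basis F m y) = basis F (msetD [mset (c, p)]%mset m) y.
Proof. by rewrite /heis extend_lin_basis. Qed.

Lemma heis0 c m y : heis c (Posz 0) (basis F m y) = charge c y *: basis F m y.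
Proof. by rewrite /heis extend_lin_basis ratr_lat_form ?charge_osc. Qed.

Lemma heis_pos c p m y : heis c (Posz p.+1) (basis F m y) =
  (p.+1%:R * osc_form F c c * (m (c, p))%:R) *: basis F (msetB m [mset (c, p)]%mset) y.
Proof. by rewrite /heis extend_lin_basis ratr_lat_form ?charge_osc. Qed.

(** Annihilation read on coefficients: the coefficient of the monomial with one more factor is
    recovered up to a scalar that is nonzero in characteristic 0. This yields [heis_kernel]. *)
Lemma heis_coef c p m y v : (heis c (Posz p.+1) v)@_(m, y) =
  p.+1%:R * osc_form F c c * (m (c, p)).+1%:R * v@_(msetD [mset (c, p)]%mset m, y).
Proof.
pose S := [set v : V | (heis c (Posz p.+1) v)@_(m, y) =
  p.+1%:R * osc_form F c c * (m (c, p)).+1%:R * v@_(msetD [mset (c, p)]%mset m, y)].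
apply: (@basis_ind S) => [|[m' y'] _]; rewrite /S.
  split=> /= [|a u w Eu Ew]; first by rewrite (lin0 (heis_lin _ _)) !mcoeff0 mulr0.
  rewrite (heis_lin _ _) [LHS]mcoeffD [(_ *: _)@_ _]mcoeffZ Eu Ew.
  by rewrite mcoeffD mcoeffZ; ring.
rewrite /= heis_pos [LHS]mcoeffZ /basis ![(mkmalgU _ _)@_ _]mcoeffU !xpair_eqE.
case: (eqVneq y' y) => _; last by rewrite !andbF !mulr0.
rewrite !andbT; have [->|ne] := eqVneq m' (msetD [mset (c, p)]%mset m).
  by rewrite msetD1K eqxx mset1DE eqxx.
have [m'p|/mset_eq0P ->] := boolP ((c, p) \in (m' : {mset osc}%mset)); last by rewrite !mulr0 mul0r.
case: eqP => [e|_]; last by rewrite !mulr0.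
by case/eqP: ne; rewrite -e msetB1K.
Qed.

Lemma heis_kernel v : (forall c p, heis c (Posz p.+1) v = 0) ->
  forall k, k \in msupp v -> k.1 = mset0.
Proof.
move=> kv [m y] kin /=; apply/eqP/contraT => /mset_neq0_mem[[c p] om].
move: kin; rewrite -mcoeff_neq0 => /eqP[].
have := heis_coef c p (msetB m [mset (c, p)]%mset) y v.
rewrite kv mcoeff0 msetB1K // => /esym/eqP.
rewrite mulf_eq0 => /orP[|/eqP //].
rewrite (negPf (_ : _ * _ != 0)) //.
apply: mulf_neq0; last by rewrite pnatr_eq0.
by apply: mulf_neq0; [rewrite pnatr_eq0|exact: osc_form_neq0].
Qed.

Definition hom y (d : int) : set V :=
  [set v | forall k, k \in msupp v -> k.2 = y /\ (mset_deg k.1)%:Z = d].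

Lemma hom_sub y d : subspace (hom y d).
Proof.
split=> [k|a u v hu hv k]; first by rewrite msupp0.
move=> /(fsubsetP (msuppD_le _ _)); rewrite inE => /orP[|]; last exact: hv.
by move=> /(fsubsetP (msuppZ_le _ _))/hu.
Qed.

Lemma hom_basis m y : hom y (mset_deg m)%:Z (basis F m y).
Proof. by move=> k; rewrite /basis msuppU oner_eq0 inE => /eqP ->. Qed.

Lemma support_nil v : (forall k, k \notin msupp v) -> v = 0.
Proof.
by move=> kv; rewrite [v]basis_decomp big_seq big1 // => k kin; have := kv k; rewrite kin.
Qed.

Lemma hom_lt0 y d v : hom y d v -> d < 0 -> v = 0.
Proof.
by move=> hv d0; apply: support_nil => k; apply/negP => /hv[_]; lia.
Qed.

Lemma hom_kernel y d v : hom y d v -> (forall c p, heis c (Posz p.+1) v = 0) ->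
  d != 0 -> v = 0.
Proof.
move=> hv /heis_kernel kv /eqP d0; apply: support_nil => k; apply/negP => kin.
by have [_] := hv k kin; rewrite kv ?mset_deg0 // => /esym.
Qed.

Lemma hom0_line y v : hom y 0 v -> exists a, v = a *: evec F y.
Proof.
move=> hv; exists v@_(mset0, y); rewrite [LHS]basis_decomp.
have vk k : k \in msupp v -> k = (mset0, y).
  by case: k => m y' /hv[/= -> []] /mset_deg_eq0 ->.
have [kin|kin] := boolP ((mset0, y) \in msupp v).
  rewrite (_ : msupp v = [fset (mset0, y)]%fset) ?big_seq_fset1 //.
  by apply/fsetP => k; rewrite in_fset1; apply/idP/eqP => [/vk|->].
rewrite mcoeff_outdom // scale0r big_seq big1 // => k /[dup] /vk ->.
by rewrite (negPf kin).
Qed.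

Lemma lin_hom f y d y' d' v : lin f -> hom y d v ->
  (forall m, (mset_deg m)%:Z = d -> hom y' d' (f (basis F m y))) -> hom y' d' (f v).
Proof.
move=> lf hv fb; apply: (@basis_ind [set v | hom y' d' (f v)]) => [|[m z] /hv /= [-> /fb] //].
split=> /= [|a u w hu hw]; first by rewrite (lin0 lf); exact: (sub0 (hom_sub _ _)).
by rewrite lf; apply: (subP (hom_sub _ _)).
Qed.

Lemma heis_hom c n y d v : hom y d v -> hom y (d - n) (heis c n v).
Proof.
move=> hv; apply: (lin_hom (heis_lin c n) hv) => m <-.
case: n => [[|p]|p].
- by rewrite heis0 subr0; apply: (subZ (hom_sub _ _)); apply: hom_basis.
- rewrite heis_pos; have [pm|/mset_eq0P ->] := boolP ((c, p) \in m).
    apply: (subZ (hom_sub _ _)); rewrite (mset_degB1 pm) /=.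
    by rewrite (_ : _ - _ = (mset_deg (msetB m [mset (c, p)]%mset))%:Z); [exact: hom_basis|rewrite PoszD addrC addKr].
  by rewrite mulr0 scale0r; exact: (sub0 (hom_sub _ _)).
- rewrite heis_neg (_ : _ - _ = (mset_deg (msetD [mset (c, p)]%mset m))%:Z).
    exact: hom_basis.
  by rewrite mset_degD1 /=; lia.
Qed.

Lemma fock_ind (P : set V) : subspace P -> (forall y, P (evec F y)) ->
  (forall c p v, P v -> P (heis c (Negz p) v)) -> forall v, P v.
Proof.
move=> sP Pe Ph v; apply: (basis_ind sP) => -[m y] _ /=.
by elim/mset_ind: m => [|[c p] m IH]; [exact: Pe|rewrite -heis_neg; apply: Ph].
Qed.

Lemma hom_ind (P : set V) y d v : subspace P -> hom y d v ->
  (forall m, (mset_deg m)%:Z = d -> P (basis F m y)) -> P v.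
Proof.
by move=> sP hv Pb; apply: (basis_ind sP) => -[m z] /hv /= [-> /Pb].
Qed.

Definition shift x : V -> V := extend_lin (fun k => basis F k.1 (x + k.2)).

Lemma shift_lin x : lin (shift x). Proof. exact: extend_lin_is_lin. Qed.
Lemma shift_basis x m y : shift x (basis F m y) = basis F m (x + y).
Proof. by rewrite /shift extend_lin_basis. Qed.
Lemma shift_evec x y : shift x (evec F y) = evec F (x + y).
Proof. exact: shift_basis. Qed.
Lemma shift_hom x y d v : hom y d v -> hom (x + y) d (shift x v).
Proof.
move=> hv; apply: (lin_hom (shift_lin x) hv) => m <-.
by rewrite shift_basis; apply: hom_basis.
Qed.
Lemma shiftD x y v : shift x (shift y v) = shift (x + y) v.
Proof.
apply: (@eq_lin_basis (fun v => shift x (shift y v))) => [||[m z] _].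
- exact: lin_comp (shift_lin _) (shift_lin _).
- exact: shift_lin.
- by rewrite !shift_basis addrA.
Qed.
Lemma shift0 v : shift 0 v = v.
Proof.
apply: (@eq_lin_basis _ id) => [||[m z] _]; [exact: shift_lin|by []|].
by rewrite shift_basis add0r.
Qed.

Lemma heis_shift c n x v : heis c n (shift x v) =
  shift x (heis c n v) + (if n == 0 then charge c x else 0) *: shift x v.
Proof.
pose g v := shift x (heis c n v) + (if n == 0 then charge c x else 0) *: shift x v.
apply: (@eq_lin_basis (fun v => heis c n (shift x v)) g) => [||[m z] _]; rewrite /g /=.
- exact: lin_comp (heis_lin _ _) (shift_lin _).
- apply: lin_add; first exact: lin_comp (shift_lin _) (heis_lin _ _).
  exact/lin_scale/shift_lin.
- clear g; case: n => [[|p]|p]; rewrite /= ?scale0r ?addr0 !shift_basis.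
  + rewrite [LHS](heis0 c m (x + z)) chargeD scalerDl [LHS]addrC.
    by congr (_ + _); rewrite heis0 (linZ (shift_lin x)) shift_basis.
  + by rewrite [LHS](heis_pos c p m (x + z)) heis_pos (linZ (shift_lin x)) shift_basis.
  + by rewrite [LHS](heis_neg c p m (x + z)) heis_neg shift_basis.
Qed.

Lemma heis_pos_neg c c' p q v :
  heis c (Posz p.+1) (heis c' (Negz q) v) - heis c' (Negz q) (heis c (Posz p.+1) v) =
  (if p == q then p.+1%:R * osc_form F c c' else 0) *: v.
Proof.
apply: (@eq_lin_basis (fun v => heis c (Posz p.+1) (heis c' (Negz q) v) -
  heis c' (Negz q) (heis c (Posz p.+1) v)) (fun v => _ *: v)) => [||[m y] _] {v} /=.
- by apply: lin_sub; apply: lin_comp; apply: heis_lin.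
- exact/lin_scale/lin_id.
have -> : heis c (Posz p.+1) (heis c' (Negz q) (basis F m y)) =
    heis c (Posz p.+1) (basis F (msetD [mset (c', q)]%mset m) y).
  by congr (heis _ _ _); exact: heis_neg.
have -> : heis c' (Negz q) (heis c (Posz p.+1) (basis F m y)) =
    (p.+1%:R * osc_form F c c * (m (c, p))%:R) *:
      basis F (msetD [mset (c', q)]%mset (msetB m [mset (c, p)]%mset)) y.
  rewrite -[X in _ *: X]heis_neg -(linZ (heis_lin c' (Negz q))).
  by congr (heis _ _ _); exact: heis_pos.
rewrite heis_pos mset1DE.
have [[<- <-]|ne] := eqVneq (c, p) (c', q).
  rewrite ?eqxx msetD1K; have [pm|/mset_eq0P ->] := boolP ((c, p) \in (m : {mset osc}%mset)).
    rewrite msetB1K // -scalerBl; congr (_ *: _).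
    by rewrite natrD mulrDr mulr1 addrK.
  by rewrite addn0 mulr0 scale0r subr0 mulr1.
rewrite ?(negPf ne) add0n.
rewrite (_ : msetB _ _ = msetD [mset (c', q)]%mset (msetB m [mset (c, p)]%mset)).
  rewrite subrr /osc_form; case: eqP => [pq|]; last by rewrite scale0r.
  by case: (eqVneq c c') ne => [->|_]; rewrite ?pq ?eqxx ?mulr0 ?scale0r.
apply/msetP => o; rewrite !(mset1DE, msetB1E).
by case: (eqVneq o (c, p)) => [->|_]; rewrite ?(negPf ne) ?subn0.
Qed.

Lemma heis_comm c c' (m n : int) v :
  heis c m (heis c' n v) =
  heis c' n (heis c m v) + (if m + n == 0 then m%:~R * osc_form F c c' else 0) *: v.
Proof.
(* Modes of equal sign commute, zero modes counting for both signs; the mixed case is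
   [heis_pos_neg]. *)
suff comm0 (m' n' : int) (w : V) c1 c2 : (0 <= m' /\ 0 <= n') \/ (m' <= 0 /\ n' <= 0) ->
    heis c1 m' (heis c2 n' w) = heis c2 n' (heis c1 m' w).
  have [mn|] := pselect ((0 <= m /\ 0 <= n) \/ (m <= 0 /\ n <= 0)).
    rewrite comm0 // [X in X *: _](_ : _ = 0) ?scale0r ?addr0 //.
    by case: eqP => // mn0; rewrite (_ : m = 0) ?mul0r //; lia.
  case: m n => [[|p]|p] [[|q]|q]; try lia; move=> _.
    have /eqP := heis_pos_neg c c' p q v; rewrite subr_eq addrC => /eqP ->.
    by congr (_ + _ *: _); have [->|pq] := eqVneq p q; case: eqP => //; lia.
  have /eqP := heis_pos_neg c' c q p v; rewrite subr_eq addrC => /eqP ->.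
  rewrite -addrA -scalerDl [X in X *: _](_ : _ = 0) ?scale0r ?addr0 //.
  have -> : osc_form F c' c = osc_form F c c' by rewrite /osc_form; case: c; case: c'.
  have [->|pq] := eqVneq q p; case: eqP => e; rewrite ?addr0 //; try lia.
  by rewrite -mulrDl NegzE mulrNz subrr mul0r.
move=> mn.
apply: (@eq_lin_basis (fun w => heis c1 m' (heis c2 n' w))
  (fun w => heis c2 n' (heis c1 m' w)) w) => [||[ms y] _] /=; try by
  apply: lin_comp; apply: heis_lin.
case: m' n' mn => [[|p]|p] [[|q]|q] mn; try lia.
- rewrite [X in _ = heis c2 _ X]heis0 [X in heis c1 _ X = _]heis0.
  rewrite [LHS](linZ (heis_lin _ _)) [RHS](linZ (heis_lin _ _)).
  rewrite [X in _ *: X = _]heis0 [X in _ = _ *: X]heis0.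
  by rewrite !scalerA mulrC.
- rewrite [X in _ = heis c2 _ X]heis0 [X in heis c1 _ X = _]heis_pos.
  rewrite [LHS](linZ (heis_lin _ _)) [RHS](linZ (heis_lin _ _)).
  rewrite [X in _ *: X = _]heis0 [X in _ = _ *: X]heis_pos.
  by rewrite !scalerA mulrC.
- rewrite [X in _ = heis c2 _ X]heis0 [X in heis c1 _ X = _]heis_neg.
  rewrite [RHS](linZ (heis_lin _ _)).
  by rewrite [LHS]heis0 [X in _ = _ *: X]heis_neg.
- rewrite [X in _ = heis c2 _ X]heis_pos [X in heis c1 _ X = _]heis0.
  rewrite [LHS](linZ (heis_lin _ _)) [RHS](linZ (heis_lin _ _)).
  rewrite [X in _ *: X = _]heis_pos [X in _ = _ *: X]heis0.
  by rewrite !scalerA mulrC.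
- rewrite [X in _ = heis c2 _ X]heis_pos [X in heis c1 _ X = _]heis_pos.
  rewrite [LHS](linZ (heis_lin _ _)) [RHS](linZ (heis_lin _ _)).
  rewrite [X in _ *: X = _]heis_pos [X in _ = _ *: X]heis_pos !scalerA.
  have -> : msetB (msetB ms [mset (c2, q)]%mset) [mset (c1, p)]%mset =
      msetB (msetB ms [mset (c1, p)]%mset) [mset (c2, q)]%mset.
    by apply/msetP => o; rewrite !msetB1E subnAC.
  congr (_ *: _); rewrite !msetB1E; have [[-> ->]|ne] := eqVneq (c1, p) (c2, q).
    by [].
  by rewrite ?(negPf ne) ?subn0; ring.
- rewrite [X in _ = heis c2 _ X]heis_neg [X in heis c1 _ X = _]heis0.
  rewrite [LHS](linZ (heis_lin _ _)).
  by rewrite [RHS]heis0 [X in _ *: X = _]heis_neg.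
- rewrite [X in _ = heis c2 _ X]heis_neg [X in heis c1 _ X = _]heis_neg.
  by rewrite [LHS]heis_neg [RHS]heis_neg msetDCA.
Qed.
End Fock.

(** * Fields of the lattice vertex algebra *)

Section Instance.
Variable F : numFieldType.
Local Notation V := (Vlat F).
Implicit Types (v u : V) (x y : lat) (c : bool).

Lemma hom_evec y : hom y 0 (evec F y).
Proof. by have := @hom_basis F mset0 y; rewrite mset_deg0. Qed.

Lemma evec_neq0 y : evec F y != 0.
Proof.
apply/eqP => /(congr1 (fun v : V => v@_(mset0, y))).
by rewrite mcoeffU mcoeff0 eqxx => /eqP; rewrite oner_eq0.
Qed.

Lemma heis0_hom c y d v : hom y d v -> heis c 0 v = charge F c y *: v.
Proof.
move=> hv; pose S := [set v : V | heis c 0 v = charge F c y *: v].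
apply: (@hom_ind _ S y d v _ hv) => [|m _]; last exact: heis0.
split; first by rewrite /S /= (lin0 (heis_lin c 0)) scaler0.
move=> a u w; rewrite /S /= => hu hw.
rewrite (heis_lin c 0) hu hw scalerDr !scalerA; congr (_ *: _ + _); exact: mulrC.
Qed.

Lemma hom_span (P : set V) : subspace P -> (forall y d v, hom y d v -> P v) ->
  forall v, P v.
Proof. by move=> sP Ph v; apply: (basis_ind sP) => k _; apply: Ph (@hom_basis F _ _). Qed.

Lemma fock_ind_neg (P : set V) : subspace P -> (forall y, P (evec F y)) ->
  (forall c p v, P v -> P (heis c (- p.+1%:Z) v)) -> forall v, P v.
Proof. by move=> sP Pe Ph; apply: fock_ind => // c p v Pv; rewrite NegzE; apply: Ph. Qed.

Definition vlat_heis : heis_space F :=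
  @HeisSpace F V lat (@heis F) (charge F) (evec F) (@hom F) (@shift F)
    (@chargeD F) (@heis_lin F) (@heis_comm F) (@hom_sub F) (@hom_lt0 F)
    hom_evec evec_neq0 (@heis_hom F) heis0_hom (@hom0_line F) (@hom_kernel F)
    hom_span fock_ind_neg (@shift_lin F) (@shift_hom F) (@shiftD F) (@shift0 F)
    (@shift_evec F) (@heis_shift F).
End Instance.

Lemma fsum_diag (V : nmodType) (G : nat -> nat -> V) (j : int) K :
  (forall a b, (K <= b)%N -> G a b = 0) ->
  \sum_(ij \in [set ij : nat * nat | ij.1%:Z - ij.2%:Z = j]) G ij.1 ij.2 =
  \sum_(b < K) (if j + b%:Z is Posz a then G a b else 0).
Proof.
move=> GK; pose P : set nat := [set b : nat | 0 <= j + b%:Z].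
pose h (b : nat) := (`|(j + b%:Z)%R|%N, b).
rewrite (reindex_fsbig h P) => [|]; last first.
  split=> [b|b b' _ _ [] //|[a b]] /=; rewrite /P /h /=; first lia.
  by move=> ab; exists b; [lia|congr pair; lia].
rewrite fsbig_mkcond -(@fsum_ord _ (fun b : nat => if (j + b%:Z)%R is Posz a then G a b else 0)).
  apply: eq_fsbigr => b _; rewrite /patch /h /=.
  have -> : (b \in P) = (0 <= j + b%:Z) by apply/idP/idP => [/set_mem|?]; last exact: mem_set.
  by case: (j + b%:Z)%R.
by move=> b Kb; case: (j + b%:Z) => // a; apply: GK.
Qed.

(** * Comparison of the fields with their degree-indexed versions *)

Section Modes.
Variable F : numFieldType.
Local Notation V := (Vlat F).
Local Notation H := (vlat_heis F).
Implicit Types (v u : V) (x y : lat) (c : bool).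

Lemma ser_expE (A A' : nat -> V -> V) k v : (forall n u, A n u = A' n u) ->
  ser_exp A k v = sexp A' k v.
Proof.
move=> AA'; suff E j i u : ser_pow A j i u = spow A' j i u.
  by apply: eq_bigr => j _; congr (_ *: _); exact: E.
elim: j i u => // j IH i u; apply: eq_bigr => k' _.
by transitivity (A k' (spow A' j (i - k') u)); [congr (A k' _); exact: IH|exact: AA'].
Qed.

Lemma EminusE x n v : Eminus x n v = em (V := H) x.1%:~R x.2%:~R n v.
Proof. exact: ser_expE. Qed.

Lemma EplusE x n v : Eplus x n v = ep (V := H) x.1%:~R x.2%:~R n v.
Proof. exact: ser_expE. Qed.

(** Cancelling <x,y> in the exponent leaves the integral condition a - b = j, which [fsum_diag]
    turns into a sum over the annihilation degree b. *)
Lemma vertex_exp_basis x m y (j : int) :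
  vertex_exp x (j%:~R + lat_form x y) (basis F m y) =
  vx (V := H) (x : hs_lat H) x.1%:~R x.2%:~R j (basis F m y).
Proof.
pose p : F := x.1%:~R; pose q : F := x.2%:~R.
have [K E] := @vx_ev F H x p q j (basis F m y).
have [K' B] := @ep_bound F H p q (basis F m (x + y)).
transitivity (\sum_(b < (K + K').+1) emz (V := H) p q (j + b%:Z) (ep (V := H) p q b (basis F m (x + y)))); last first.
  rewrite (E (K + K').+1); last by lia.
  by apply: eq_bigr => i _; rewrite -(shift_basis F x m y).
transitivity (\sum_(ij \in [set ij : nat * nat | ij.1%:Z - ij.2%:Z = j])
  em (V := H) p q ij.1 (ep (V := H) p q ij.2 (basis F m (x + y)))).
  rewrite /vertex_exp extend_lin_basis /=.
  transitivity (\sum_(ij \in [set ij : nat * nat | ij.1%:Z - ij.2%:Z = j])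
     Eminus x ij.1 (Eplus x ij.2 (basis F m (x + y)))).
    apply: eq_fsbigl; apply/seteqP; split=> -[a b] /=.
      move/addIr => ab.
      by apply: (@intr_inj rat); rewrite -ab intrB.
    by move=> ab; congr (_ + _); rewrite -ab intrB.
  apply: eq_fsbigr => ij _.
  exact: etrans (EminusE _ _ _) (congr1 _ (EplusE _ _ _)).
apply: (@fsum_diag _ (fun a b => em (V := H) p q a (ep (V := H) p q b (basis F m (x + y))))) => a b Kb; rewrite B; last by lia.
exact: (lin0 (em_lin _ _ _)).
Qed.

Lemma eq_hom (f g : V -> V) y d v : lin f -> lin g -> hom y d v ->
  (forall m, f (basis F m y) = g (basis F m y)) -> f v = g v.
Proof. by move=> lf lg hv fg; apply: (eq_lin_basis lf lg) => -[m z] /hv[/= -> _]. Qed.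

(* On the charge [y], the exponents of [B] lie in [s + Z]. *)
Definition represents y (s : rat) (B : zfield F) (B' : int -> V -> V) : Prop :=
  forall j d v, hom y d v -> B (j%:~R + s) v = B' j v.

Lemma vertex_exp_represents x y p q : p = x.1%:~R -> q = x.2%:~R ->
  represents y (lat_form x y) (vertex_exp x) (vx (V := H) (x : hs_lat H) p q).
Proof.
move=> -> -> j d v hv; apply: (eq_hom _ _ hv) => [||m].
- exact: extend_lin_is_lin.
- exact: (@vx_lin F H x x.1%:~R x.2%:~R j).
- exact: vertex_exp_basis.
Qed.

(** The weight [w] merges both binomial coefficients of (1/n!) (d/dz)^n i(z); this series has
    exponents lower by 1 + n than its degrees. *)
Lemma normal_prod_represents i (n : nat) (w : int -> F) y s B B' :
  (forall k : nat, w (- k.+1%:Z) = 'C(k, n)%:R) ->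
  (forall m : nat, w m%:Z = (- 1) ^+ n * 'C(m + n, n)%:R) ->
  represents y s B B' ->
  represents y (s - 1 - n%:R) (normal_prod i n B) (np (V := H) i w B').
Proof.
move=> wn wp rB j d v hv.
transitivity (\sum_(k \in [set: nat])
      w (- k.+1%:Z) *: heis i (- k.+1%:Z) (B' (j - k.+1%:Z) v) +
    \sum_(k \in [set: nat]) w k%:Z *: B' (j + k%:Z) (heis i k%:Z v)); last first.
  exact: esym (@np_defE F H i w B' j v).
rewrite /normal_prod.
refine (f_equal2 (fun a b : V => a + b) _ _); apply: eq_fsbigr => k _.
- rewrite wn; congr (_ *: _); congr (heis _ _ _).
  rewrite -(rB _ _ _ hv); congr (B _ _); rewrite intrB -pmulrn -natr1; ring.
- rewrite wp; congr (_ *: _).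
  rewrite -(rB _ _ _ (@heis_hom F i k%:Z y d v hv)); congr (B _ _).
  rewrite intrD -pmulrn -natr1; ring.
Qed.
End Modes.

(** * Truncation and linearity of the modes *)

Section Locality.
Variable F : numFieldType.
Local Notation V := (Vlat F).
Local Notation H := (vlat_heis F).
Implicit Types (v u : V) (x y : lat) (c : bool).

(** A sum over an infinite index set is additive only where supports are finite, which vanishing for
    very negative exponents ensures. [represents] cannot supply this, being confined to one charge
    and one coset of exponents. *)
Definition truncated (B : zfield F) : Prop := (forall q, lin (B q)) /\
  (forall v, exists K : nat, forall q, q < - K%:R -> B q v = 0).

Lemma vertex_exp_truncated x : truncated (@vertex_exp F x).
Proof.
have lB q : lin (@vertex_exp F x q) by exact: extend_lin_is_lin.
split=> // v; pose P := [set v | exists K : nat, forall q, q < - K%:R -> @vertex_exp F x q v = 0].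
apply: (@basis_ind F P) => [|[m y] _ /=].
  split; first by exists 0%N => q _; exact: lin0.
  move=> a u w [K1 H1] [K2 H2]; exists (maxn K1 K2) => q qK.
  have [q1 q2] : q < - K1%:R /\ q < - K2%:R.
    by split; apply: lt_le_trans qK _; rewrite lerN2 ler_nat; lia.
  by rewrite (lB q) (H1 q) ?(H2 q) // scaler0 addr0.
have [K B] := @ep_bound F H x.1%:~R x.2%:~R (basis F m (x + y)).
have [K' K'P] : exists K' : nat, `|lat_form x y| < K'%:R.
  by exists (Num.bound `|lat_form x y|); apply: archi_boundP.
exists (K' + K)%N => q qK; rewrite /vertex_exp extend_lin_basis /=.
apply: fsbig1 => -[a b] /= ab.
have bK : (K < b)%N.
  rewrite -(ltr_nat rat); have := ler_norm (- lat_form x y); rewrite normrN.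
  have : 0 <= a%:R :> rat by [].
  by move: qK; rewrite natrD; lra.
have -> : Eplus x b (basis F m (x + y)) = 0 by exact: etrans (EplusE _ _ _) (B b bK).
exact: etrans (EminusE _ _ _) (lin0 (@em_lin F H _ _ _)).
Qed.

Lemma normal_prod_ev i n B q v : truncated B -> exists K0 : nat, forall K, (K0 <= K)%N ->
  normal_prod i n B q v =
  \sum_(k < K) 'C(k, n)%:R *: heis i (- (k.+1%:Z)) (B (q - k%:R + n%:R) v) +
  \sum_(k < K) ((- 1) ^+ n * 'C(k + n, n)%:R) *: B (q + k.+1%:R + n%:R) (heis i k%:Z v).
Proof.
move=> [lB tB]; have [K1 H1] := @cur_bound F H v; have [K2 H2] := tB v.
have [K3 K3P] : exists K' : nat, `|q + n%:R + K2%:R| < K'%:R.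
  by exists (Num.bound `|q + n%:R + K2%:R|); apply: archi_boundP.
exists (K1 + K3).+1 => K KK; rewrite /normal_prod.
refine (f_equal2 (fun a b : V => a + b) _ _); apply: fsum_ord => k Kk.
  rewrite (H2 (q - k%:R + n%:R)) ?(lin0 (heis_lin _ _)) ?scaler0 //.
  have := ler_norm (q + n%:R + K2%:R).
  have : (K3 <= k)%N by lia.
  by rewrite -(ler_nat rat); lra.
have -> : heis i k%:Z v = 0 by apply: (H1 i k%:Z); lia.
by rewrite (lin0 (lB _)) scaler0.
Qed.

Lemma normal_prod_truncated i n B : truncated B -> truncated (normal_prod i n B).
Proof.
move=> tB; have [lB bB] := tB; split=> [q a u v|v].
  have [K1 E1] := normal_prod_ev i n q u tB; have [K2 E2] := normal_prod_ev i n q v tB.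
  have [K3 E3] := normal_prod_ev i n q (a *: u + v) tB.
  rewrite (E1 (K1 + K2 + K3)%N) ?(E2 (K1 + K2 + K3)%N) ?(E3 (K1 + K2 + K3)%N); try lia.
  rewrite scalerDr addrACA.
  refine (f_equal2 (fun a b : V => a + b) _ _);
    rewrite scaler_sumr -big_split /=; apply: eq_bigr => k _.
    by rewrite lB heis_lin scalerDr !scalerA mulrC.
  by rewrite heis_lin lB scalerDr !scalerA mulrC.
have [K1 H1] := @cur_bound F H v; have [K2 H2] := bB v.
(* Only modes of index at most [K1] of the current act nontrivially on [v], so finitely many
   truncation bounds for [B] have a common one. *)
have [K3 H3] : exists K : nat, forall k : nat, (k <= K1)%N -> forall q, q < - K%:R ->
    B q (heis i k%:Z v) = 0.
  elim: {H1}K1 => [|K1 [K IH]].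
    have [K HK] := bB (heis i 0 v); exists K => k; rewrite leqn0 => /eqP -> q qK.
    exact: HK.
  have [K' HK] := bB (heis i K1.+1%:Z v); exists (K + K')%N => k kK q qK.
  have [q1 q2] : q < - K%:R /\ q < - K'%:R.
    by split; apply: lt_le_trans qK _; rewrite lerN2 ler_nat; lia.
  have [->|kn] := eqVneq k K1.+1; first exact: HK.
  by apply: IH => //; lia.
exists (K1 + K2 + K3 + n).+1 => q; rewrite -natr1 !natrD => qK.
transitivity (0 + 0 : V); last exact: addr0.
refine (f_equal2 (fun a b : V => a + b) _ _); apply: fsbig1 => k _.
  have k0 : 0 <= k%:R :> rat by [].
  have lt : q - k%:R + n%:R < - K2%:R.
    have : 0 <= K1%:R :> rat by []. have : 0 <= K3%:R :> rat by []. lra.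
  by rewrite (H2 _ lt) (lin0 (heis_lin _ _)) scaler0.
have [kK|Kk] := leqP k K1; last first.
  have -> : heis i k%:Z v = 0 by apply: (H1 i k%:Z); lia.
  by rewrite (lin0 (lB _)) scaler0.
rewrite (H3 k kK) ?scaler0 // -natr1.
have : 0 <= K2%:R :> rat by [].
by move: kK; rewrite -(ler_nat rat); lra.
Qed.

Lemma Y_basis_truncated (k : state) : truncated (@Y_basis F k).
Proof.
rewrite /Y_basis; elim: (enum_mset k.1 : seq osc) => [|o s IH] /=.
  exact: vertex_exp_truncated.
exact: normal_prod_truncated.
Qed.

Lemma Y_linl q v : lin (fun u => @Y F u q v).
Proof. exact: extend_lin_is_lin. Qed.

Lemma Y_linr u q : lin (@Y F u q).
Proof.
apply: lin_bigsum => k; apply: lin_scale.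
by have [] := Y_basis_truncated k.
Qed.

Lemma mode_lin u s : lin (@mode F u s).
Proof. exact: Y_linr. Qed.

Lemma Y_basisE m y q v : Y (basis F m y) q v = Y_basis (m, y) q v.
Proof. exact: extend_lin_basis. Qed.

Lemma Y_evec y q v : Y (evec F y) q v = vertex_exp y q v.
Proof.
transitivity (Y_basis (mset0, y) q v); first exact: Y_basisE.
by rewrite /Y_basis /= enum_mset0.
Qed.

Lemma enum_mset2 (o : osc) : enum_mset (msetD [mset o] [mset o])%mset = [:: o; o].
Proof.
have -> : (msetD [mset o] [mset o])%mset = msetn 2 o.
  by apply/msetP => o'; rewrite mset1DE !msetnE; case: eqP.
exact: enum_msetn.
Qed.

Lemma Y_basis1 o y q v : Y (basis F [mset o]%mset y) q v =
  normal_prod o.1 o.2 (vertex_exp y) q v.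
Proof.
transitivity (Y_basis ([mset o]%mset, y) q v); first exact: Y_basisE.
by rewrite /Y_basis /= enum_msetn.
Qed.

Lemma Y_basis2 o y q v : Y (basis F (msetD [mset o] [mset o])%mset y) q v =
  normal_prod o.1 o.2 (normal_prod o.1 o.2 (vertex_exp y)) q v.
Proof.
transitivity (Y_basis ((msetD [mset o] [mset o])%mset, y) q v); first exact: Y_basisE.
have E : enum_mset (msetD [mset o] [mset o])%mset = [:: o; o] by exact: enum_mset2.
by rewrite /Y_basis /= E.
Qed.
End Locality.

(** * The modes of e, f, h and omega *)

Section Concrete.
Variable F : numFieldType.
Local Notation V := (Vlat F).
Local Notation H := (vlat_heis F).
Implicit Types (v u : V) (x y : lat) (c : bool).

Definition alpha : lat := (gamma - delta) *+ 3.
(** <alpha,y> is half of [y.1 + y.2], an integer on L; integer division extends it to all of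
    [lat]. *)
Definition pairing (y : lat) : int := ((y.1 + y.2) %/ 2)%Z.
(** This is 3 gamma(0)^2 - 3 delta(0)^2 + 2 gamma(0) on e^y; the linear term comes from - 2
    gamma(-2) in [omega]. *)
Definition conformal_weight (y : lat) : F :=
  (y.1%:~R ^+ 2 - y.2%:~R ^+ 2) / 12 + y.1%:~R / 3.

Lemma sublattice_LE y : sublattice_L y ->
  exists m n : int, y.1 = m + n /\ y.2 = m - n.
Proof.
have fstMz (z : lat) (n : int) : (z *~ n).1 = z.1 * n.
  by rewrite (raddfMz (@fst int int)) mulrzz.
have sndMz (z : lat) (n : int) : (z *~ n).2 = z.2 * n.
  by rewrite (raddfMz (@snd int int)) mulrzz.
case=> m [n ->]; exists m, n; split.
- transitivity (((gamma + delta) *~ m).1 + ((gamma - delta) *~ n).1); first by [].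
  by rewrite !fstMz mul1r mul1r.
- transitivity (((gamma + delta) *~ m).2 + ((gamma - delta) *~ n).2); first by [].
  by rewrite !sndMz mul1r mulN1r.
Qed.

Lemma pairing_L y : sublattice_L y -> y.1 + y.2 = 2 * pairing y.
Proof.
move=> /sublattice_LE[m [n [E1 E2]]]; rewrite /pairing E1 E2.
have -> : m + n + (m - n) = m * 2 by ring.
by rewrite mulzK // mulrC.
Qed.

Lemma sublattice_alpha (k : int) y : sublattice_L y -> sublattice_L (alpha *~ k + y).
Proof.
case=> m [n ->]; exists m, (3 * k + n).
by rewrite addrCA; congr (_ + _); rewrite mulrzDr mulrzA.
Qed.

Lemma lat_form_alpha y : sublattice_L y -> lat_form alpha y = (pairing y)%:~R.
Proof.
move=> Ly; transitivity ((y.1 + y.2)%:~R / 2 : rat); last first.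
  by rewrite pairing_L // intrM; field.
by rewrite intrD /lat_form /=; field.
Qed.

Lemma heis_evec c p y : heis c (- p.+1%:Z) (evec F y) = basis F [mset (c, p)]%mset y.
Proof.
transitivity (basis F (msetD [mset (c, p)] mset0)%mset y); last by rewrite msetD0.
by rewrite -NegzE; exact: heis_neg.
Qed.

Lemma heis_heis_evec c p y : heis c (- p.+1%:Z) (heis c (- p.+1%:Z) (evec F y)) =
  basis F (msetD [mset (c, p)] [mset (c, p)])%mset y.
Proof.
transitivity (heis c (- p.+1%:Z) (basis F [mset (c, p)]%mset y)).
  by congr (heis _ _ _); exact: heis_evec.
by rewrite -NegzE; exact: heis_neg.
Qed.

(** The factor - 2/9 turns the coefficients 36/2 and - 6/2 of the Schur polynomial for - 6 gamma
    into - 4 and 2/3. *)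
Lemma vec_fE : vec_f F =
  - 4 *: basis F (msetD [mset (false, 0)] [mset (false, 0)])%mset (- alpha) +
  (2 / 3) *: basis F [mset (false, 1)]%mset (- alpha).
Proof.
pose g : lat := - gamma *+ 6; pose y : lat := (gamma + delta) *+ 3.
have -> : vec_f F = - (2 / 9) *: em (V := H) (- 6) 0 2 (evec F (- alpha)).
  congr (_ *: _).
  (* Degree 2, because <- 6 gamma, 3 (gamma + delta)> = - 3 and [Q] extracts the coefficient of
     z^(-1). *)
  transitivity (@vertex_exp F g (2%:~R + lat_form g y) (evec F y)).
    by apply: etrans (Y_evec _ _ _) _; congr (vertex_exp _ _ _).
  rewrite (@vertex_exp_represents F g y (- 6) 0 _ _ 2 0 (evec F y)) //; last exact: hom_evec.
  exact: (@vx_vac F H g (- 6) 0 2 y).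
have chgg c' : charge F c' g = - 6 * osc_form F c' false + 0 * osc_form F c' true.
  by case: c'; rewrite !osc_form_values /charge /=; field.
have X n u : xcur (V := H) (- 6) 0 n u = - 6 *: heis false n u.
  by apply: etrans (addr0 _); congr (_ + _); exact: scale0r.
transitivity (- (2 / 9) *: (2^-1 *:
    (- 6 *: (- 6 *: heis false (- 1) (heis false (- 1) (evec F (- alpha)))) +
     - 6 *: heis false (- 2) (evec F (- alpha)))) : V).
  congr (_ *: _); apply: etrans (@em2 F H g (- 6) 0 (evec F (- alpha)) chgg) _.
  congr (_ *: _); refine (f_equal2 (fun a b : V => a + b) _ (X _ _)).
  apply: etrans (X _ _) _; congr (_ *: _).
  by apply: etrans (congr1 _ (X _ _)) _; exact: (linZ (heis_lin _ _)).
have e1 := heis_heis_evec false 0 (- alpha); have e2 := heis_evec false 1 (- alpha).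
rewrite -[LHS]/(- (2 / 9) *: (2^-1 *:
    (- 6 *: (- 6 *: heis false (- 1%:Z) (heis false (- 1%:Z) (evec F (- alpha)))) +
     - 6 *: heis false (- 2%:Z) (evec F (- alpha)))) : V) e1 e2.
move: (basis _ _ _) (basis _ _ _) => u w; lmod (Vlat F).
Qed.

Lemma lat_formN x y : lat_form (- x) y = - lat_form x y.
Proof. by rewrite /lat_form /= !intrN; field. Qed.

Lemma normal_prod0_represents i y s B B' : represents y s B B' ->
  represents (F := F) y (s - 1) (normal_prod i 0 B) (np (V := H) i (fun=> 1) B').
Proof.
move=> /(@normal_prod_represents F i 0 (fun=> 1)) rB.
rewrite -[s - 1]subr0; apply: rB => k; first by rewrite bin0.
by rewrite expr0 bin0 mulr1.
Qed.

Lemma normal_prod1_represents i y s B B' : represents y s B B' ->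
  represents (F := F) y (s - 2) (normal_prod i 1 B)
    (np (V := H) i (fun k => - (k + 1)%:~R) B').
Proof.
move=> /(@normal_prod_represents F i 1 (fun k => - (k + 1)%:~R)) rB.
have -> : s - 2 = s - 1 - 1%:R by ring.
apply: rB => k; first by rewrite bin1 [RHS]pmulrn -rmorphN /=; congr (_ *~ _); lia.
by rewrite expr1 addn1 bin1 mulN1r pmulrn; congr (- (_ *~ _)); lia.
Qed.

Lemma Y_comb a1 a2 u1 u2 q v :
  Y (a1 *: u1 + a2 *: u2) q v = a1 *: Y u1 q v + a2 *: Y u2 q v.
Proof. by rewrite (linD (Y_linl q v)) !(linZ (Y_linl q v)). Qed.

Lemma mode_e (n : int) y d v : sublattice_L y -> hom y d v ->
  mode (vec_e F) n%:~R v = fld_a (V := H) (alpha : hs_lat H) (- n - 1 - pairing y) v.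
Proof.
move=> Ly hv; have r : represents y _ _ _ :=
  @vertex_exp_represents F alpha y 3 (- 3) erefl erefl.
apply: etrans (Y_evec _ _ _) (etrans _ (r _ _ _ hv)); rewrite lat_form_alpha //.
congr (vertex_exp _ _ _); ring.
Qed.

(** On charge y the exponents of e^(-x) are shifted by - <x,y>, and gamma(-1)^2 and gamma(-2) both
    shift them by a further - 2; thus - n - 1 = j - <x,y> - 2. *)
Lemma mode_f (n : int) y d v : sublattice_L y -> hom y d v ->
  mode (vec_f F) n%:~R v = fld_f (V := H) (alpha : hs_lat H) (1 + pairing y - n) v.
Proof.
move=> Ly hv; have r0 : represents y _ _ _ :=
  @vertex_exp_represents F (- alpha) y (- 3) 3 erefl erefl.
have E : lat_form (- alpha) y = - (pairing y)%:~R by rewrite lat_formN lat_form_alpha.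
have r1 := normal_prod0_represents false (normal_prod0_represents false r0).
have r2 := normal_prod1_represents false r0.
transitivity (- 4 *: fld_r (V := H) (alpha : hs_lat H) (1 + pairing y - n) v +
  (2 / 3) *: fld_s (V := H) (alpha : hs_lat H) (1 + pairing y - n) v : V); last first.
  exact: esym (@fld_fE F H alpha _ v).
apply: etrans (congr1 (fun u => Y u (- n%:~R - 1) v) vec_fE) _.
apply: etrans (Y_comb _ _ _ _ _ _) _.
refine (f_equal2 (fun a b : V => a + b) _ _); congr (_ *: _).
  apply: etrans (Y_basis2 _ _ _ _) (etrans _ (r1 _ _ _ hv)).
  by apply: (congr1 (fun q => normal_prod _ _ _ q v)); rewrite E; ring.
apply: etrans (Y_basis1 _ _ _ _) (etrans _ (r2 _ _ _ hv)).
by apply: (congr1 (fun q => normal_prod _ _ _ q v)); rewrite E; ring.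
Qed.

Lemma lat_form0 y : lat_form 0 y = 0.
Proof. by transitivity ((0 * y.1%:~R - 0 * y.2%:~R) / 6 : rat); [|field]. Qed.

Lemma vertex_exp0_represents y :
  represents y 0 (@vertex_exp F 0) (fld_id (V := H)).
Proof.
move=> j d v hv; have r : represents y _ _ _ :=
  @vertex_exp_represents F 0 y 0 0 erefl erefl.
apply: etrans (etrans (r j d v hv) (@vx_id F H j v)).
by apply: (congr1 (fun q => vertex_exp _ q v)); rewrite lat_form0.
Qed.

Lemma normal_prod_id_represents i y :
  represents y (- 1) (normal_prod i 0 (@vertex_exp F 0)) (cur_field (V := H) i).
Proof.
move=> j d v hv; have r := normal_prod0_represents i (@vertex_exp0_represents y).
apply: etrans (etrans (r j d v hv) (@np_cur_field F H i j v)).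
by apply: (congr1 (fun q => normal_prod _ _ _ q v)); rewrite sub0r.
Qed.

Lemma mode_h (n : int) y d v : hom y d v ->
  mode (vec_h F) n%:~R v = 4 *: heis true n v.
Proof.
move=> hv; apply: etrans (linZ (Y_linl _ _) _ _) _; congr (_ *: _).
apply: etrans (congr1 (fun u => Y u _ v) (heis_evec true 0 0)) _.
apply: etrans (Y_basis1 _ _ _ _) _.
apply: (@etrans _ _ (normal_prod true 0 (vertex_exp 0) ((- n)%:~R - 1) v)).
  by apply: (congr1 (fun q => normal_prod _ _ _ q v)); rewrite intrN.
apply: etrans (@normal_prod_id_represents true y (- n) d v hv) _.
by rewrite /cur_field opprK.
Qed.

Lemma omegaE : omega F =
  3 *: basis F (msetD [mset (false, 0)] [mset (false, 0)])%mset 0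
  - 2 *: basis F [mset (false, 1)]%mset 0
  - 3 *: basis F (msetD [mset (true, 0)] [mset (true, 0)])%mset 0.
Proof.
rewrite -[LHS]/(3 *: heis false (- 1%:Z) (heis false (- 1%:Z) (evec F 0))
  - 2 *: heis false (- 2%:Z) (evec F 0)
  - 3 *: heis true (- 1%:Z) (heis true (- 1%:Z) (evec F 0)) : V).
have e1 := heis_heis_evec false 0 0; have e2 := heis_evec false 1 0.
by have e3 := heis_heis_evec true 0 0; rewrite e1 e2 e3.
Qed.

Lemma mode_omega y d v : hom y d v ->
  mode (omega F) 1 v = (d%:~R + conformal_weight y) *: v.
Proof.
move=> hv; pose q : rat := - 1 - 1.
have lY a1 a2 a3 (u1 u2 u3 : V) : Y (a1 *: u1 - a2 *: u2 - a3 *: u3) q v =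
    a1 *: Y u1 q v - a2 *: Y u2 q v - a3 *: Y u3 q v.
  by rewrite !(linB (Y_linl q v)) !(linZ (Y_linl q v)).
apply: etrans (congr1 (fun u => Y u q v) omegaE) _.
apply: etrans (lY _ _ _ _ _ _) _.
have rr i := normal_prod0_represents i (@normal_prod_id_represents i y).
have r1 := normal_prod1_represents false (@vertex_exp0_represents y).
have e i : Y (basis F (msetD [mset (i, 0)] [mset (i, 0)])%mset 0) q v = np2 (V := H) i v.
  apply: etrans (Y_basis2 _ _ _ _) (etrans _ (rr i 0 d v hv)).
  by apply: (congr1 (fun q => normal_prod _ _ _ q v)); rewrite /q; ring.
have e' : Y (basis F [mset (false, 1)]%mset 0) q v = - heis false 0 v.
  apply: etrans (Y_basis1 _ _ _ _) _.
  apply: (@etrans _ _ (normal_prod false 1 (vertex_exp 0) (0%:~R + (0 - 2)) v)).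
    by apply: (congr1 (fun q => normal_prod _ _ _ q v)); rewrite /q; ring.
  apply: etrans (r1 0 d v hv) _.
  apply: etrans (@np_id F H false (fun k => - (k + 1)%:~R) 0 v) _.
  exact: scaleN1r.
have h0 := @heis0_hom F false y d v hv.
have L2 : 3 *: np2 (V := H) false v - 3 *: np2 (V := H) true v =
    (d%:~R + 3 * charge F false y ^+ 2 - 3 * charge F true y ^+ 2) *: v :> V.
  exact: (@np2_degree F H y d v hv).
have comb (A A' B B' C C' : V) : A = A' -> B = B' -> C = C' ->
    3 *: A - 2 *: B - 3 *: C = (3 *: A' - 3 *: C') - 2 *: B'.
  by move=> -> -> ->; lmod (Vlat F).
apply: etrans (comb _ _ _ _ _ _ (e false) e' (e true)) _.
apply: etrans (congr1 (fun u : V => u - 2 *: - heis false 0 v) L2) _.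
apply: etrans (congr1 (fun u : V => _ - 2 *: - u) h0) _.
rewrite /charge /conformal_weight; move: (y.1%:~R) (y.2%:~R) => a b; lmod (Vlat F).
Qed.
End Concrete.

(** * Specialization to V_L and the two highest weight vectors *)

Section Final.
Variables (F : numFieldType) (kappa : F).
Local Notation V := (Vlat F).
Local Notation H := (vlat_heis F).
Local Notation L := sublattice_L.
Implicit Types (v u : V) (x y : lat) (c : bool).
Let M : ghat_ops F := VL kappa.

Let chgx (c : bool) : charge F c alpha = 1 / 2.
Proof. by rewrite /charge; case: c => /=; field. Qed.

Let Lx (y : lat) : L y -> L (alpha + y).
Proof. exact: (@sublattice_alpha 1). Qed.

Let LNx (y : lat) : L y -> L (- alpha + y).
Proof. by move=> Ly; have := @sublattice_alpha (- 1) y Ly; rewrite mulrN1z. Qed.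

Let Nx (y : lat) : L y -> pairing (alpha + y) = pairing y.
Proof.
move=> Ly; have E1 := pairing_L Ly; have := pairing_L (Lx Ly).
have -> : (alpha + y).1 + (alpha + y).2 = y.1 + y.2.
  transitivity ((3 + y.1) + (- 3 + y.2)); [by []|ring].
by rewrite E1 => /mulfI -> //.
Qed.

Let chg_delta (y : lat) : L y ->
  charge F true y = charge F false y - (pairing y)%:~R / 3.
Proof.
move=> Ly; have := congr1 (fun n : int => n%:~R : F) (pairing_L Ly).
rewrite /charge intrD intrM => E.
have -> : (pairing y)%:~R = (y.1%:~R + y.2%:~R) / 2 :> F by rewrite E; field.
by field.
Qed.

Let wtx (y : lat) : L y ->
  conformal_weight F (alpha + y) = conformal_weight F y + (pairing y)%:~R + 1.
Proof.
move=> Ly; have := congr1 (fun n : int => n%:~R : F) (pairing_L Ly).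
rewrite intrD intrM => E.
have -> : (pairing y)%:~R = (y.1%:~R + y.2%:~R) / 2 :> F by rewrite E; field.
rewrite /conformal_weight -[(alpha + y).1]/(3 + y.1) -[(alpha + y).2]/(- 3 + y.2).
by rewrite !intrD; field.
Qed.

Let subC : subspace (car M).
Proof.
split=> [k|a u v hu hv k]; first by rewrite msupp0.
move=> /(fsubsetP (msuppD_le _ _)); rewrite inE => /orP[|]; last exact: hv.
by move=> /(fsubsetP (msuppZ_le _ _))/hu.
Qed.

Let C_homog (y : lat) d v : L y -> hom y d v -> car M v.
Proof. by move=> Ly hv k /hv[-> _]. Qed.

Let C_span (P : set V) : subspace P ->
  (forall y d v, L y -> hom y d v -> P v) -> forall v, car M v -> P v.
Proof.
move=> sP Ph v Cv; apply: (basis_ind sP) => k /Cv Lk.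
exact: Ph Lk (@hom_basis F _ _).
Qed.

Let ac_lin X a u v : car M u -> car M v ->
  act M X (a *: u + v) = a *: act M X u + act M X v.
Proof.
move=> _ _; case: X => [s n| |]; first exact: mode_lin.
- have l := lin_scale (- (4 / 3)) (@lin_id F V); exact: l.
- have l := lin_sub (lin_scale kappa (@lin_id F V)) (@mode_lin F (omega F) 1).
  exact: l.
Qed.

Let ac_d (y : lat) d v : L y -> hom y d v ->
  act M Der v = (kappa - d%:~R - conformal_weight F y) *: v.
Proof.
move=> _ hv; apply: etrans (congr1 (fun u : V => kappa *: v - u) (mode_omega hv)) _.
by rewrite -scalerBl; congr (_ *: _); ring.
Qed.

Let e_act n (y : lat) d v (Ly : L y) (hv : hom y d v) := @mode_e F n y d v Ly hv.
Let f_act n (y : lat) d v (Ly : L y) (hv : hom y d v) := @mode_f F n y d v Ly hv.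
Let h_act n (y : lat) d v (Ly : L y) (hv : hom y d v) := @mode_h F n y d v hv.

Lemma VL_module : is_module M.
Proof.
exact: (@affine_module F H (alpha : hs_lat H) chgx L pairing (conformal_weight F)
  Lx LNx Nx chg_delta wtx (car M) (act M) kappa subC C_homog C_span ac_lin
  e_act f_act h_act (fun v _ => erefl) ac_d).
Qed.

Lemma VL_highest_weight (y : lat) : L y -> 0 <= pairing y ->
  (charge F false y = 0 \/ charge F false y = - (1 / 6)) ->
  (forall n : int, 0 < n -> fld_f (V := H) (alpha : hs_lat H) (1 + pairing y - n) (evec F y) = 0) ->
  singular (M := M) (evec F y) /\
  isomorphic_to_L (4 * charge F true y, - (4 / 3), kappa - conformal_weight F y)
    (Usub (M := M) (evec F y)).
Proof.
move=> Ly Ny gy fy.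
have fM n : 0 < n -> act M (Loop sl2f n) (evec F y) = 0.
  by move=> n0; apply: etrans (@f_act n y 0 _ Ly (@hom_evec F y)) (fy n n0).
split.
  exact: (@hw_singular F H (alpha : hs_lat H) L pairing (conformal_weight F)
    (car M) (act M) kappa C_homog e_act h_act (fun v _ => erefl) ac_d y Ly Ny fM).
exact: (@hw_isomorphic F H (alpha : hs_lat H) chgx L pairing (conformal_weight F)
  Lx LNx Nx chg_delta wtx (car M) (act M) kappa subC C_homog C_span ac_lin
  e_act f_act h_act (fun v _ => erefl) ac_d y Ly Ny gy fM).
Qed.

(** Here <x,y> = 0, so f(1) acts by f_0, which vanishes at gamma(0) = - 1/6; for n > 1 the degree of
    f(n) is negative. *)
Lemma VL_evec_minus :
  singular (M := M) (evec F (- gamma + delta)) /\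
  isomorphic_to_L (4 * charge F true (- gamma + delta), - (4 / 3),
      kappa - conformal_weight F (- gamma + delta))
    (Usub (M := M) (evec F (- gamma + delta))).
Proof.
have g : charge F false (- gamma + delta) = - (1 / 6) by rewrite /charge /=; field.
have N0 : pairing (- gamma + delta) = 0 by [].
apply: VL_highest_weight; rewrite ?N0 //; last 1 first.
- move=> n n0; have [->|n1] := eqVneq n 1.
    transitivity ((- 4 * charge F false (- gamma + delta) ^+ 2
      - 2 / 3 * charge F false (- gamma + delta)) *: evec F (- alpha + (- gamma + delta))).
      exact: (@f0_vac F H alpha (- gamma + delta)).
    by rewrite g (_ : _ - _ = 0) ?scale0r //; field.
  apply: (@graded_vac_lt0 F H (- alpha) (fld_f (V := H) (alpha : hs_lat H))); last by lia.
  exact: (@graded_f F H alpha).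
- exists 0, (- 1); rewrite mulr0z add0r mulrN1z opprB addrC //.
- by right.
Qed.

(** Here <x,y> = 1, so f(1) and f(2) have degrees 1 and 0; both kill the vacuum because gamma(0) =
    0. For n > 2 the degree is negative. *)
Lemma VL_evec_delta :
  singular (M := M) (evec F (delta *+ 2)) /\
  isomorphic_to_L (4 * charge F true (delta *+ 2), - (4 / 3),
      kappa - conformal_weight F (delta *+ 2))
    (Usub (M := M) (evec F (delta *+ 2))).
Proof.
have g : charge F false (delta *+ 2) = 0 by rewrite /charge /=; field.
have N1 : pairing (delta *+ 2) = 1 by [].
apply: VL_highest_weight; rewrite ?N1 //; last 1 first.
- move=> n n0; have [->|n1] := eqVneq n 1.
    exact: (@f1_vac F H alpha (delta *+ 2) g).
  have [->|n2] := eqVneq n 2.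
    transitivity ((- 4 * charge F false (delta *+ 2) ^+ 2
      - 2 / 3 * charge F false (delta *+ 2)) *: evec F (- alpha + (delta *+ 2))).
      exact: (@f0_vac F H alpha (delta *+ 2)).
    by rewrite g (_ : _ - _ = 0) ?scale0r //; field.
  apply: (@graded_vac_lt0 F H (- alpha) (fld_f (V := H) (alpha : hs_lat H))); last by lia.
  exact: (@graded_f F H alpha).
- by exists 1, (- 1).
- by left.
Qed.

Lemma weight_minus :
  (4 * charge F true (- gamma + delta), - (4 / 3),
    kappa - conformal_weight F (- gamma + delta)) =
  - (2 / 3) *: Lambda0 F - (2 / 3) *: Lambda1 F + (kappa + 1 / 3) *: delta_im F.
Proof.
transitivity (- (2 / 3) * 0 - (2 / 3) * 1 + (kappa + 1 / 3) * 0,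
   - (2 / 3) * 1 - (2 / 3) * 1 + (kappa + 1 / 3) * 0,
   - (2 / 3) * 0 - (2 / 3) * 0 + (kappa + 1 / 3) * 1 : F); last by [].
by rewrite /charge /conformal_weight /=; congr (_, _, _); field.
Qed.

Lemma weight_delta :
  (4 * charge F true (delta *+ 2), - (4 / 3),
    kappa - conformal_weight F (delta *+ 2)) =
  - (4 / 3) *: Lambda1 F + (kappa + 1 / 3) *: delta_im F.
Proof.
transitivity (- (4 / 3) * 1 + (kappa + 1 / 3) * 0,
   - (4 / 3) * 1 + (kappa + 1 / 3) * 0,
   - (4 / 3) * 0 + (kappa + 1 / 3) * 1 : F); last by [].
by rewrite /charge /conformal_weight /=; congr (_, _, _); field.
Qed.
End Final.

Theorem corollary4p2 (R : realType) (kappa : R[i]) :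
  [/\ is_module (VL kappa),
      singular (M := VL kappa) (evec _ (- gamma + delta)),
      singular (M := VL kappa) (evec _ (delta *+ 2)),
      isomorphic_to_L
        (- (2 / 3) *: Lambda0 _ - (2 / 3) *: Lambda1 _
           + (kappa + 1 / 3) *: delta_im _)
        (Usub (M := VL kappa) (evec _ (- gamma + delta)))
    & isomorphic_to_L
        (- (4 / 3) *: Lambda1 _ + (kappa + 1 / 3) *: delta_im _)
        (Usub (M := VL kappa) (evec _ (delta *+ 2)))].
Proof.
have [s1 i1] := VL_evec_minus kappa; have [s2 i2] := VL_evec_delta kappa.
rewrite weight_minus in i1; rewrite weight_delta in i2.
split; [exact: VL_module|exact: s1|exact: s2|exact: i1|exact: i2].
Qed.
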